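(* Consider the scalar impulsive delay differential equation $$x'(t)+a(t)x(t)=f(t,x_t)\quad (0\le t\neq t_k),\qquad \Delta x(t_k):=x(t_k^+)-x(t_k)=I_k(x(t_k))\quad (k=1,2,\dots),\tag{E}$$ in the setting described in the context, with $f(t,x_t)=\sum_{i=1}^n f_i(t,x_t^i)$, where $f_i(t,x_t^i)=f_i(t,x|_{[t-\tau_i(t),t]})$. Assume: (1) there exist positive sequences $(a_k)$ and $(b_k)$ such that $b_kx^2\le x[x+I_k(x)]\le a_kx^2$ for all $x\in\mathbb{R}$, $k\in\mathbb{N}$; (2) at least one of the following two conditions (2a), (2b) holds: (2a) the sequence $P_n=\prod_{k=1}^n a_k$ is bounded, and $\int_0^\infty a(u)\,du=\infty$; (2b) the sequence $P_n=\prod_{k=1}^n a_k$ is convergent, and whenever $w:[0,\infty)\to\mathbb{R}$ is a bounded, non-oscillatory and piecewise differentiable function with $w'(t)w(t)\le 0$ on $(t_k,t_{k+1})$, $k\in\mathbb{N}$, and $\lim_{t\to\infty}w(t)=c\neq 0$, then $\int_0^\infty f(s,w_s)\,ds=-\operatorname{sgn}(c)\,\infty$; (3) there exist piecewise continuous functions $\lambda_{1,i},\lambda_{2,i}:[0,\infty)\to[0,\infty)$, $1\le i\le n$, such that $$-\lambda_{1,i}(t)\mathcal{M}^i_t(\varphi)\le f_i(t,\varphi)\le\lambda_{2,i}(t)\mathcal{M}^i_t(-\varphi),\qquad t\ge0,\ 1\le i\le n,\ \varphi\in PC^i(t),$$ where $PC^i(t)=PC([-\tau_i(t),0];\mathbb{R})$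 and $\mathcal{M}^i_t(\varphi)=\max\{0,\sup_{\theta\in[-\tau_i(t),0]}\varphi(\theta)\}$; (4) there is $T>0$ such that $\alpha_1\alpha_2<1$, where $$\alpha_j=\sup_{t\ge T}\int_{t-\tau(t)}^t\sum_{i=1}^n\lambda_{j,i}(s)e^{-\int_s^ta(u)\,du}B_i(s)\,ds,\quad j=1,2,\qquad B_i(t)=\max_{\theta\in[-\tau_i(t),0]}\Big(\prod_{k:\,t+\theta\le t_k<t}b_k^{-1}\Big),\ i=1,\dots,n.$$ Then the zero solution of (E) is globally asymptotically stable (with respect to initial conditions in $BPC$).
   Context: Setting. $\tau_1,\dots,\tau_n:[0,\infty)\to[0,\infty)$ are continuous with $\lim_{t\to\infty}(t-\tau_i(t))=\infty$ and $t\mapsto t-\tau_i(t)$ non-decreasing; $\tau(t)=\max_{1\le i\le n}\tau_i(t)$. For a compact interval $[\alpha,\beta]$, $B([\alpha,\beta];\mathbb{R})$ is the space of bounded functions with the supremum norm and $PC([\alpha,\beta];\mathbb{R})$ its subspace of piecewise continuous functions that are left continuous on $(\alpha,\beta]$; $PC(t)=PC([-\tau(t),0];\mathbb{R})$. $PC$ is the space of functions $(-\infty,0]\to\mathbb{R}$ whose restriction to each compact $[\alpha,\beta]\subset(-\infty,0]$ lies in the closure of $PC([\alpha,\beta];\mathbb{R})$ in $B([\alpha,\beta];\mathbb{R})$; $BPC$ is the set of bounded elements of $PC$, with norm $\|\varphi\|=\sup_{s\le0}|\varphi(s)|$. $(t_k)_{k\ge1}$ is an increasing sequence of positive numbers with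 $t_k\to\infty$; $a:[0,\infty)\to[0,\infty)$ and $I_k:\mathbb{R}\to\mathbb{R}$ are continuous, $I_k(0)=0$; $f(t,\varphi)\in\mathbb{R}$ is defined for $t\ge0$, $\varphi\in PC(t)$, with $f(t,0)=0$. In (E), $x'(t)$ is the left-hand derivative, $x$ is left continuous, $x_t(\theta)=x(t+\theta)$ for $-\tau(t)\le\theta\le0$, and $x_t^i$ is the restriction of $x_t$ to $[-\tau_i(t),0]$. Initial conditions are $x(t_0+s)=\varphi(s)$, $s\le0$, with $t_0\ge0$, $\varphi\in BPC$. The extension $F(t,\varphi)=f(t,\varphi|_{[-\tau(t),0]})$ of $f$ to $[0,\infty)\times BPC$ is continuous or piecewise continuous, and each such initial value problem has a unique solution $x(t,t_0,\varphi)$ on $[t_0,\infty)$. A function is oscillatory if it is not eventually zero and has arbitrarily large zeros; otherwise it is non-oscillatory. An empty product equals 1. The divergence of $\int_0^\infty f(s,w_s)\,ds$ to $\pm\infty$ concerns large $s$ (where $s-\tau(s)\ge0$, so that $w_s$ is defined). The zero solution is stable if for every $\varepsilon>0$, $t_0\ge0$ there is $\delta=\delta(t_0,\varepsilon)>0$ such that $\varphi\in BPC$, $\|\varphi\|<\delta$ imply $|x(t,t_0,\varphi)|<\varepsilon$ for $t\ge t_0$; globally attractive if all solutions with initial conditions in $BPC$ tend to $0$ as $t\to\infty$; globally asymptotically stable if it is stable and globally attractive. *)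

(* Defs.v *)
(* Library: MathComp-Analysis, over an arbitrary R : realType. *)
From HB Require Import structures.
From mathcomp Require Export all_boot all_order all_algebra.
From mathcomp Require Export all_classical all_reals all_analysis.
Export Order.TTheory GRing.Theory Num.Theory.
Export numFieldNormedType.Exports.

Set Implicit Arguments.
Unset Strict Implicit.
Unset Printing Implicit Defensive.

Local Open Scope classical_set_scope.
Local Open Scope ring_scope.

(* Functions on [0, +oo[, on ]-oo, 0] or on a compact interval are represented
   by total functions R -> R, of which only the values on that interval are
   ever constrained or used. *)

Definition piecewise_continuous_on (R : realType) (al be : R) (g : R -> R) :
    Prop :=
  exists s : seq R,
    [/\ forall t, al <= t <= be -> t \notin s ->
          g u @[u --> within `[al, be] (nbhs t)] --> g t,
        forall t, al < t <= be -> cvg (g u @[u --> t^'-]) &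
        forall t, al <= t < be -> cvg (g u @[u --> t^'+])].

Definition piecewise_continuous_pos (R : realType) (g : R -> R) : Prop :=
  forall be, 0 < be -> piecewise_continuous_on 0 be g.

(* PC([al, be]; R) *)
Definition PC_on (R : realType) (al be : R) (g : R -> R) : Prop :=
  piecewise_continuous_on al be g /\
  forall t, al < t <= be -> g u @[u --> t^'-] --> g t.

(* Closure of PC([al, be]; R) in B([al, be]; R); a uniform limit of elements of
   PC([al, be]; R), which are bounded, is automatically bounded. *)
Definition PC_closure_on (R : realType) (al be : R) (g : R -> R) : Prop :=
  forall e, 0 < e ->
    exists2 psi, PC_on al be psi &
      forall t, al <= t <= be -> `|g t - psi t| < e.

Definition BPC (R : realType) (phi : R -> R) : Prop :=
  (forall al be, al <= be -> be <= 0 -> PC_closure_on al be phi) /\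
  exists M, forall s, s <= 0 -> `|phi s| <= M.

Definition normBPC (R : realType) (phi : R -> R) : R :=
  sup [set `|phi s| | s in [set s | s <= 0]].

(* The segment x_t; its restrictions to the various intervals [-tau_i(t), 0]
   are not materialized, see [history_local]. *)
Definition segment (R : realType) (x : R -> R) (t : R) : R -> R :=
  fun theta => x (t + theta).

Definition max_delay (R : realType) (n : nat) (tau : 'I_n -> R -> R) (t : R) :
    R :=
  \big[Num.max/0]_(i < n) tau i t.

(* f_i(t, phi) only depends on t >= 0 and on phi restricted to
   [-tau_i(t), 0]. *)
Definition history_local (R : realType) (n : nat) (tau : 'I_n -> R -> R)
    (f_ : 'I_n -> R -> (R -> R) -> R) : Prop :=
  forall i t phi psi, 0 <= t ->
    (forall theta, - tau i t <= theta <= 0 -> phi theta = psi theta) ->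
    f_ i t phi = f_ i t psi.

Definition total_rhs (R : realType) (n : nat)
    (f_ : 'I_n -> R -> (R -> R) -> R) (t : R) (phi : R -> R) : R :=
  \sum_(i < n) f_ i t phi.

(* F(s, psi) --> l as (s, psi) --> (t, phi) in A * BPC. *)
Definition BPC_limit (R : realType) (F : R -> (R -> R) -> R) (A : set R)
    (t : R) (phi : R -> R) (l : R) : Prop :=
  forall e, 0 < e -> exists2 d, 0 < d &
    forall s psi, A s -> BPC psi -> `|s - t| < d ->
      normBPC (psi \- phi) < d -> `|F s psi - l| < e.

Definition BPC_continuous (R : realType) (F : R -> (R -> R) -> R) : Prop :=
  forall t phi, 0 <= t -> BPC phi -> BPC_limit F `[0, +oo[ t phi (F t phi).

(* Continuity on [0, +oo[ * BPC except at a locally finite set D of times, where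
   F has limits from both sides. *)
Definition BPC_piecewise_continuous (R : realType) (F : R -> (R -> R) -> R) :
    Prop :=
  exists D : set R,
    [/\ forall be, finite_set (D `&` `[0, be]),
        forall t phi, 0 <= t -> ~ D t -> BPC phi ->
          BPC_limit F `[0, +oo[ t phi (F t phi),
        forall t phi, 0 < t -> D t -> BPC phi ->
          exists l, BPC_limit F `[0, t[ t phi l &
        forall t phi, 0 <= t -> D t -> BPC phi ->
          exists l, BPC_limit F `]t, +oo[ t phi l].

Definition is_left_derive (R : realType) (x : R -> R) (t d : R) : Prop :=
  h^-1 * (x (t + h) - x t) @[h --> 0^'-] --> d.

(* x : R -> R solves (E) on [t0, +oo[ with initial condition phi.  The impulse
   times are tk 0 < tk 1 < ...; an impulse at tk k = t0 does act, consistently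
   with the left continuity of x.  Away from the impulse times x is continuous,
   so that the only jumps are those prescribed by (E). *)
Definition solution (R : realType) (tk : nat -> R) (a : R -> R)
    (Ik : nat -> R -> R) (f : R -> (R -> R) -> R)
    (t0 : R) (phi x : R -> R) : Prop :=
  [/\ forall s, s <= 0 -> x (t0 + s) = phi s,
      forall t, t0 < t -> x u @[u --> t^'-] --> x t,
      forall t, t0 <= t -> (forall k, t != tk k) -> x u @[u --> t^'+] --> x t,
      forall t, t0 < t -> (forall k, t != tk k) ->
        exists2 d, is_left_derive x t d & d + a t * x t = f t (segment x t) &
      forall k, t0 <= tk k ->
        x u @[u --> (tk k)^'+] --> x (tk k) + Ik k (x (tk k))].

Definition uniquely_solvable (R : realType)
    (sol : R -> (R -> R) -> (R -> R) -> Prop) : Prop :=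
  forall t0 phi, 0 <= t0 -> BPC phi ->
    (exists x, sol t0 phi x) /\
    (forall x y, sol t0 phi x -> sol t0 phi y -> x =1 y).

Definition zero_stable (R : realType)
    (sol : R -> (R -> R) -> (R -> R) -> Prop) : Prop :=
  forall e t0, 0 < e -> 0 <= t0 -> exists2 d, 0 < d &
    forall phi x, BPC phi -> normBPC phi < d -> sol t0 phi x ->
      forall t, t0 <= t -> `|x t| < e.

Definition zero_globally_attractive (R : realType)
    (sol : R -> (R -> R) -> (R -> R) -> Prop) : Prop :=
  forall t0 phi x, 0 <= t0 -> BPC phi -> sol t0 phi x ->
    x t @[t --> +oo] --> (0 : R).

Definition zero_globally_asymptotically_stable (R : realType)
    (sol : R -> (R -> R) -> (R -> R) -> Prop) : Prop :=
  zero_stable sol /\ zero_globally_attractive sol.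

Definition oscillatory (R : realType) (x : R -> R) : Prop :=
  ~ (exists T, forall t, T <= t -> x t = 0) /\
  (forall T, exists2 t, T <= t & x t = 0).

(* Functions w on [0, +oo[, piecewise differentiable with respect to the
   impulse times: left continuous, with right limits, continuous and left
   differentiable away from the impulse times.  As in (E), the derivative is
   the left-hand one. *)
Definition piecewise_differentiable (R : realType) (tk : nat -> R)
    (w : R -> R) : Prop :=
  [/\ forall t, 0 < t -> w u @[u --> t^'-] --> w t,
      forall t, 0 <= t -> (forall k, t != tk k) -> w u @[u --> t^'+] --> w t,
      forall k, cvg (w u @[u --> (tk k)^'+]) &
      forall t, 0 < t -> (forall k, t != tk k) ->
        exists d, is_left_derive w t d].

Definition test_function (R : realType) (tk : nat -> R) (w : R -> R) : Prop :=
  [/\ exists M, forall t, 0 <= t -> `|w t| <= M,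
      ~ oscillatory w,
      piecewise_differentiable tk w &
      forall k t d, tk k < t < tk k.+1 -> is_left_derive w t d -> d * w t <= 0].

(* The integral of f(s, w_s) over [0, +oo[ is [l], for an infinite [l]; w_s is
   only defined for large s, so the integral starts from some S beyond which
   s - tau(s) >= 0. *)
Definition history_integral_diverges (R : realType) (tau : R -> R)
    (f : R -> (R -> R) -> R) (w : R -> R) (l : \bar R) : Prop :=
  exists S, [/\ 0 <= S, forall s, S <= s -> tau s <= s &
    (\int[@lebesgue_measure R]_(s in `[S, +oo[) (f s (segment w s))%:E = l)%E].

Definition partial_prod (R : realType) (c : nat -> R) (m : nat) : R :=
  \prod_(k < m) c k.

(* script M^i_t, for the delay value r = tau_i(t) *)
Definition Msup (R : realType) (r : R) (phi : R -> R) : R :=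
  Num.max 0 (sup [set phi theta | theta in `[- r, 0]]).

(* B_i(t), for tau = tau_i.  The product is over a finite set since
   tk k --> +oo, and the supremum is attained. *)
Definition Bmax (R : realType) (tk b : nat -> R) (tau : R -> R) (t : R) : R :=
  sup [set \big[*%R/1]_(k \in [set k | t + theta <= tk k < t]) (b k)^-1
      | theta in `[- tau t, 0]].

Definition alpha_integrand (R : realType) (n : nat) (tk b : nat -> R)
    (a : R -> R) (tau lam : 'I_n -> R -> R) (t s : R) : R :=
  \sum_(i < n) lam i s * expR (- \int[@lebesgue_measure R]_(u in `[s, t]) a u)
    * Bmax tk b (tau i) s.

Definition alpha (R : realType) (n : nat) (tk b : nat -> R) (a : R -> R)
    (tau lam : 'I_n -> R -> R) (T : R) : \bar R :=
  ereal_sup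
    [set (\int[@lebesgue_measure R]_(s in `[(t - max_delay tau t)%R, t])
           (alpha_integrand tk b a tau lam t s)%:E)%E
    | t in [set t | T <= t]].

(* Main.v *)
Require Import Defs.
From HB Require Import structures.
From mathcomp Require Import all_boot all_order all_algebra.
From mathcomp Require Import all_classical all_reals all_analysis.
From mathcomp Require Import measurable_realfun ring lra.
Import Order.TTheory GRing.Theory Num.Theory.
Import numFieldNormedType.Exports.

Set Implicit Arguments.
Unset Strict Implicit.
Unset Printing Implicit Defensive.

Local Open Scope classical_set_scope.
Local Open Scope ring_scope.

(** Why the zero solution is globally asymptotically stable.

    The impulses are divided out.  With J_k = x(t_k) / (x(t_k) + I_k(x(t_k)))
    the function y(t) = x(t) * prod_(t_k < t) J_k ([smoothed]) is continuous on
    [t0, +oo[, because the jump of the product at t_k cancels the jump of x.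
    The bounds on I_k say 1/a_k <= J_k <= 1/b_k; the lower bound together with
    the boundedness of the products of the a_k bounds |x| by a multiple of |y|
    ([solution_le_smoothed]), the upper bound turns the bounds on the f_i into a
    scalar delay inequality free of impulses ([smoothed_delay_ineq_upper],
    [smoothed_delay_ineq_lower]): if y >= - V on the delay window before t, then
    y' + a y <= V g2 at t, where g2 = sum_i lambda_(2,i) B_i, and symmetrically
    for - y with g1 = sum_i lambda_(1,i) B_i.

    The heart of the matter is [excursion_le].  While y stays nonnegative after
    a time p, it is pushed up only as long as the delayed argument t - tau(t) is
    before p; from then on y' + a y <= 0.  Variation of constants over that
    first stretch, which fits in the window of integration of alpha_2, gives
    y <= y(p) + alpha_2 V, where - V bounds y from below on the window before p.
    Started at the last zero of y ([last_zero]), this compares the positive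
    excursions of y with alpha_2 times the preceding negative ones, and the
    negative ones with alpha_1 times the positive ones.  As
    alpha_1 alpha_2 < 1, going back and forth contracts.  From time max(T, t0)
    on this bounds y by a constant multiple of its past ([global_bound]);
    before that time a crude growth estimate suffices ([finite_time_growth]);
    together they give stability.  If y has arbitrarily large zeros, the
    contraction can be repeated on later and later half-lines and y tends to 0
    ([oscillating_cvg0]).

    Otherwise y is eventually of one sign, say positive, and then
    y' + a y <= 0 eventually.  If the integral of a diverges, y decays like
    exp(- int a).  If instead the products of the a_k converge, y decreases to a
    limit, the product of the J_k^-1 converges because its ratio to the
    convergent product of the a_k is monotone ([jump_weight_inv_cvg]), hence x
    converges to some c.  If c were nonzero, x made constant before a large time
    would be a test function, so that the integral of f(s, x_s) would be
    infinite; but f(s, x_s) is eventually of the sign opposite to x, so y would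
    have to move by an infinite amount ([frozen_not_divergent]).

    Two points need care.  No measurability of s |-> f(s, x_s) is assumed, so
    every estimate compares y with the integral of a measurable bound; such
    comparisons rest on [left_derive_le_integral], for a function with a left
    derivative outside a finite set.  And the bounds on the f_i are given for
    piecewise continuous arguments, while the segments x_t reaching before t0
    are only uniform limits of such functions; they are handled by approximation
    and by the continuity of f on BPC ([rhs_le], [rhs_ge]), outside the locally
    finite set of times where that continuity fails. *)

(** * Monotonicity from one-sided difference quotients *)

Lemma notin_seq_itv (R : realType) (s : seq R) (a b : R) : a < b ->
  exists2 m, a < m < b & m \notin s.
Proof.
elim: s a b => [|x s IH] a b ab; first by exists ((a + b) / 2) => //; lra.
have [xab|xab] := boolP (a < x < b).
  have /IH[m mab ms] : a < x by lra.
  by exists m; [lra|rewrite inE negb_or ms andbT; apply/eqP => mx; lra].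
have [m mab ms] := IH _ _ ab.
exists m; first by [].
by rewrite inE negb_or ms andbT; apply: contra xab => /eqP <-.
Qed.

Lemma within_itvP (R : realType) (p q : R) (u : R -> R) :
  {within `[p, q], continuous u} <->
  forall t, p <= t <= q -> forall e, 0 < e -> exists2 d, 0 < d &
    forall s, p <= s <= q -> `|s - t| < d -> `|u s - u t| < e.
Proof.
split => [cu t tpq e e0|cu].
  have tI : `[p, q]%classic t by rewrite /= in_itv.
  have /(@cvgr_dist_lt _ _ _ _ _ _ _)/(_ _ e0) :=
    (@subspace_continuousP _ `[p, q]%classic _ u).1 cu t tI.
  rewrite near_withinE => /nbhs_ballP[d /= d0 dP].
  exists d => // s spq sd.
  by rewrite distrC; apply: dP; rewrite /ball/= ?in_itv// distrC.
apply/subspace_continuousP => t; rewrite /= in_itv/= => tpq.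
apply/cvgrPdist_lt => e e0; have [d d0 dP] := cu t tpq e e0.
rewrite near_withinE; apply/nbhs_ballP; exists d => // s; rewrite /ball/= => sd.
by rewrite in_itv/= => spq; rewrite distrC; apply: dP => //; rewrite distrC.
Qed.

(** If u rose from p to q, subtracting a small slope would leave a function v that
    still rises.  At the first time when v reaches a level m strictly between v p
    and v q, the left difference quotients of v are positive, against the assumption.  Infinitely many
    levels are available, so m can avoid the values of v on the finite set E. *)
Lemma dini_nonincreasing (R : realType) (p q : R) (u : R -> R) (E : set R) :
    p <= q -> finite_set (E `&` `[p, q]) -> {within `[p, q], continuous u} ->
    (forall t, p < t <= q -> ~ E t -> forall e, 0 < e -> exists2 d, 0 < d &
      forall h, 0 < h < d -> u t - u (t - h) <= e * h) ->
  u q <= u p.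
Proof.
move=> pq finE /within_itvP cu dini; rewrite leNgt; apply/negP => upq.
have {}pq : p < q.
  by rewrite lt_neqAle pq andbT; apply/eqP => pq'; move: upq; rewrite pq' ltxx.
(* Half the mean slope of u, so that v still rises. *)
set ep := (u q - u p) / (2 * (q - p)).
have ep0 : 0 < ep by rewrite divr_gt0//; lra.
have epE : ep * (q - p) = (u q - u p) / 2.
  by rewrite /ep; field; lra.
pose v t := u t - ep * (t - p).
have vpq : v p < v q by rewrite /v epE; lra.
have [s sE] := (finite_seqP _).1 finE.
have [m /andP[pm mq] ms] := notin_seq_itv (map v s) vpq.
have cv t : p <= t <= q -> forall e, 0 < e -> exists2 d, 0 < d &
    forall s, p <= s <= q -> `|s - t| < d -> `|v s - v t| < e.
  move=> tpq e e0; have [|d d0 dP] := cu t tpq (e / 2); first lra.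
  exists (Num.min d (e / 2 / ep)).
    by rewrite lt_min d0 divr_gt0//; lra.
  move=> r rpq; rewrite lt_min => /andP[/(dP r rpq) h1].
  rewrite ltr_pdivlMr// => h2.
  have -> : v r - v t = (u r - u t) - ep * (r - t) by rewrite /v; ring.
  rewrite (le_lt_trans (ler_normB _ _))// normrM (gtr0_norm ep0).
  by lra.
pose S := [set t | p <= t <= q /\ m <= v t].
have Sq : S q by split; [rewrite lexx ltW|exact: ltW].
have hS : has_inf S by split; [by exists q | by exists p; move=> t [/andP[pt _] _]].
pose c := inf S.
have pc : p <= c by apply: lb_le_inf; [by exists q|by move=> t [/andP[]]].
have cq : c <= q by apply: ge_inf => //; exact: hS.2.
have cpq : p <= c <= q by rewrite pc.
have nS t : p <= t <= q -> t < c -> v t < m.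
  move=> tpq tc; rewrite ltNge; apply/negP => mt.
  have /(ge_inf hS.2) : S t by [].
  by rewrite leNgt tc.
have mc : m <= v c.
  rewrite leNgt; apply/negP => cm.
  have [|d d0 dP] := cv c cpq (m - v c); first lra.
  have [t [tpq mt] tcd] := inf_adherent d0 hS.
  have ct : c <= t by apply: ge_inf => //; exact: hS.2.
  have := dP t tpq; rewrite ger0_norm ?subr_ge0// ltrBlDl => /(_ tcd).
  by rewrite ltr_norml => /andP[_]; lra.
have {}pc : p < c.
  by rewrite lt_neqAle pc andbT; apply/eqP => pc'; move: mc; rewrite -pc'; lra.
have cm : v c = m.
  apply/eqP; rewrite eq_le mc andbT leNgt; apply/negP => mc'.
  have [|d d0 dP] := cv c cpq (v c - m); first lra.
  pose t := Num.max p (c - d / 2).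
  have tp : p <= t by rewrite le_max lexx.
  have td : c - d / 2 <= t by rewrite le_max lexx orbT.
  have tc : t < c by rewrite gt_max pc/=; lra.
  have tpq : p <= t <= q by lra.
  have := nS _ tpq tc.
  have := dP t tpq; rewrite ltr0_norm; last lra.
  have cd : - (t - c) < d by lra.
  by move=> /(_ cd); rewrite ltr_norml => /andP[]; lra.
have cE : ~ E c.
  move=> Ec; move/negP : ms; apply; rewrite -cm.
  apply: map_f.
  have : (E `&` `[p, q]) c by split => //=; rewrite in_itv/=.
  by rewrite sE.
have pcq : p < c <= q by rewrite pc.
have [|d d0 dP] := dini c pcq cE (ep / 2); first lra.
pose h := Num.min (d / 2) (c - p).
have h0 : 0 < h by rewrite lt_min; apply/andP; split; lra.
have hd : h <= d / 2 by rewrite ge_min lexx.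
have hp : h <= c - p by rewrite ge_min lexx orbT.
have h0d : 0 < h < d by lra.
have := dP h h0d.
have hpq : p <= c - h <= q by lra.
have hc : c - h < c by lra.
have := nS _ hpq hc; rewrite -cm /v.
have : 0 < ep * h by rewrite mulr_gt0.
have -> : ep * (c - h - p) = ep * (c - p) - ep * h by ring.
have -> : ep / 2 * h = ep * h / 2 by field.
lra.
Qed.

(** * Integrating a pointwise bound on a left derivative *)

Lemma bounded_integrable_itv (R : realType) (A : set R) (p q C : R) (f : R -> R) :
  measurable A -> A `<=` `[p, q] ->
  measurable_fun A f -> (forall t, A t -> `|f t| <= C) ->
  (@lebesgue_measure R).-integrable A (EFin \o f).
Proof.
move=> mA Apq mf fC; apply: measurable_bounded_integrable => //.
  apply: (@le_lt_trans _ _ (@lebesgue_measure R `[p, q])).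
    by apply: le_measure => //; rewrite inE.
  by rewrite lebesgue_measure_itv/=; case: ifP => _; rewrite ?ltry.
exists C; split; first exact: num_real.
by move=> x Cx t At; apply: (le_trans (fC t At)); exact: ltW.
Qed.

Lemma lebesgue_fine_itv (R : realType) (b1 b2 : bool) (p q : R) : p <= q ->
  fine (@lebesgue_measure R [set` Interval (BSide b1 p) (BSide b2 q)]) = q - p.
Proof.
move=> pq; rewrite lebesgue_measure_itv/= lte_fin; case: ltP => //= qp.
lra.
Qed.

Lemma Rintegral_itv_le (R : realType) (p q C c : R) (f : R -> R) (t' t : R) :
  measurable_fun `[p, q] f -> (forall t, p <= t <= q -> `|f t| <= C) ->
  p <= t' -> t' <= t -> t <= q -> (forall s, t' < s <= t -> f s <= c) ->
  \int[@lebesgue_measure R]_(s in `[p, t]) f s <=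
  \int[@lebesgue_measure R]_(s in `[p, t']) f s + c * (t - t').
Proof.
move=> mf fC pt' t't tq fc; rewrite -lerBlDl.
have intf : (@lebesgue_measure R).-integrable `[p, t] (EFin \o f).
  have sub : `[p, t] `<=` `[p, q] by apply: subset_itvl; rewrite bnd_simp.
  apply: (@bounded_integrable_itv _ _ p q C) => //.
    exact: measurable_funS mf.
  by move=> s /sub/=; rewrite in_itv/=; exact: fC.
rewrite Rintegral_itvB//.
have intf' : (@lebesgue_measure R).-integrable `]t', t] (EFin \o f).
  by apply: integrableS intf => //; apply: subset_itvr; rewrite bnd_simp.
apply: (@le_trans _ _ (\int[@lebesgue_measure R]_(s in `]t', t]) (cst c s))).
  apply: le_Rintegral => //.
    apply: (@bounded_integrable_itv _ _ t' t `|c|) => //.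
    by apply: subset_itvr; rewrite bnd_simp.
by rewrite Rintegral_cst// lebesgue_fine_itv.
Qed.

Lemma is_left_derive_upper (R : realType) (z : R -> R) (t d : R) :
  is_left_derive z t d -> forall e, 0 < e -> exists2 r, 0 < r &
    forall h, 0 < h < r -> z t - z (t - h) <= (d + e) * h.
Proof.
move=> /cvgrPdist_lt dz e e0; have := dz e e0.
rewrite near_withinE => /nbhs_ballP[r /= r0 rP].
exists r => // h /andP[h0 hr].
have := rP (- h); rewrite /ball/= sub0r opprK gtr0_norm// => /(_ hr).
rewrite oppr_lt0 => /(_ h0); rewrite ltr_norml => /andP[].
rewrite invrN mulNr opprK => H _.
have /ltW := H; rewrite -(ler_pM2r h0) mulrDl mulrAC mulVf ?gt_eqF// mul1r.
by rewrite mulrDl; lra.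
Qed.

(** With k = C - g >= 0, Lusin's theorem yields a compact K of almost full measure
    on which k is continuous; k restricted to K and extended by 0 is then upper
    semicontinuous, so its primitive G has upper left difference quotients at
    most k(t), and z - C t + G is nonincreasing.  Lebesgue differentiation would
    only give an almost everywhere statement, which does not control z. *)
Lemma left_derive_le_integral (R : realType) (p q C : R) (z g : R -> R)
    (E : set R) :
    p <= q -> finite_set (E `&` `[p, q]) -> {within `[p, q], continuous z} ->
    measurable_fun `[p, q] g -> (forall t, p <= t <= q -> `|g t| <= C) ->
    (forall t, p < t <= q -> ~ E t ->
      exists2 d, is_left_derive z t d & d <= g t) ->
  z q - z p <= \int[@lebesgue_measure R]_(t in `[p, q]) g t.
Proof.
move=> pq finE cz mg gC dz.
set mu := @lebesgue_measure R.
have C0 : 0 <= C by apply: le_trans (gC p _); rewrite ?lexx.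
apply/ler_addgt0Pr => e e0.
(* k is at most 2 C, so discarding a set of measure eta costs less than e. *)
pose eta := e / (2 * C + 1).
have eta0 : 0 < eta by rewrite divr_gt0//; lra.
pose k t := C - g t.
have mk : measurable_fun `[p, q] k by exact: measurable_funB.
have k0 t : p <= t <= q -> 0 <= k t <= 2 * C.
  by move=> /gC; rewrite ler_norml /k; lra.
have mupq : (mu [set` `[p, q]] < +oo)%E.
  by rewrite /mu lebesgue_measure_itv/=; case: ifP => _; rewrite ?ltry.
have [K [cK Kpq muK kK]] := @measurable_almost_continuous R [set` `[p, q]]
  (measurable_itv _) mupq k eta eta0 mk.
have mK : measurable K by exact: compact_measurable.
have clK : closed K by apply: compact_closed => //; exact: Rhausdorff.
pose k' := k \_ K.
have k'E t : k' t = if t \in K then k t else 0 by [].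
have k'0 t : p <= t <= q -> 0 <= k' t <= 2 * C.
  by rewrite k'E; case: ifP => _; [exact: k0|lra].
have k'C t : p <= t <= q -> `|k' t| <= 2 * C.
  by move=> /k'0 /andP[? ?]; rewrite ger0_norm.
have mk' : measurable_fun `[p, q] k'.
  apply/measurable_restrict => //.
  by apply: measurable_funS mk => // t [].
pose G t := \int[mu]_(s in `[p, t]) k' s.
have GI t' t c : p <= t' -> t' <= t -> t <= q ->
    (forall s, t' < s <= t -> k' s <= c) -> G t <= G t' + c * (t - t').
  by move=> *; exact: (Rintegral_itv_le mk' k'C).
have Gnd t' t : p <= t' -> t' <= t -> t <= q -> G t' <= G t.
  move=> pt' t't tq; rewrite -subr_ge0 /G Rintegral_itvB//.
    apply: Rintegral_ge0 => s; rewrite /= in_itv/= => spq.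
    by have /k'0/andP[] : p <= s <= q by lra.
  have sub : `[p, t] `<=` `[p, q] by apply: subset_itvl; rewrite bnd_simp.
  apply: (@bounded_integrable_itv _ _ p q (2 * C)) => //.
    exact: measurable_funS mk'.
  by move=> s /sub/=; rewrite in_itv/=; exact: k'C.
pose u t := z t - C * t + G t.
suff : u q <= u p.
  rewrite /u {2}/G set_itv1 Rintegral_set1 addr0 => uqp.
  have intk' : mu.-integrable `[p, q] (EFin \o k').
    exact: (@bounded_integrable_itv _ _ p q (2 * C)).
  have intg : mu.-integrable `[p, q] (EFin \o g).
    exact: (@bounded_integrable_itv _ _ p q C).
  have intC (A : set R) c : measurable A -> A `<=` `[p, q] ->
      mu.-integrable A (EFin \o cst c).
    by move=> mA ApQ; apply: (@bounded_integrable_itv _ _ p q `|c|).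
  have kG : C * (q - p) - \int[mu]_(t in `[p, q]) g t = \int[mu]_(t in `[p, q]) k t.
    by rewrite RintegralB//; [rewrite Rintegral_cst// lebesgue_fine_itv|exact: intC].
  have intkA (A : set R) : measurable A -> A `<=` `[p, q] ->
      mu.-integrable A (EFin \o k).
    move=> mA Apq; apply: (@bounded_integrable_itv _ _ p q (2 * C)) => //.
      exact: measurable_funS mk.
    by move=> s /Apq; rewrite /= in_itv/= => /k0 /andP[? ?]; rewrite ger0_norm.
  have mD : measurable (`[p, q] `\` K) by exact: measurableD.
  have kE : \int[mu]_(t in `[p, q]) k t =
      G q + \int[mu]_(t in `[p, q] `\` K) k t.
    rewrite /G /k' -Rintegral_mkcondr -Rintegral_setU//=.
    - by rewrite setUIDK.
    - exact: measurableI.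
    - by rewrite setUIDK; exact: intkA.
    - apply/disj_setPS => x [[_ Kx]] [_]; exact.
  have kle : \int[mu]_(t in `[p, q] `\` K) k t <= e.
    apply: (@le_trans _ _ (\int[mu]_(t in `[p, q] `\` K) (cst (2 * C) t))).
      apply: le_Rintegral => //.
      - by apply: intkA => // x [].
      - by apply: intC => // x [].
      - by move=> x [/=]; rewrite in_itv/= => /k0/andP[].
    rewrite Rintegral_cst//.
    have : fine (mu (`[p, q] `\` K)) <= eta.
      rewrite -lee_fin fineK ?(ltW muK)//.
      by rewrite ge0_fin_numE// (lt_trans muK) ?ltry.
    have C20 : 0 <= 2 * C by rewrite mulr_ge0.
    move=> /(ler_wpM2l C20) H; apply: (le_trans H).
    rewrite /eta mulrA ler_pdivrMr ?ltr_wpDl// mulrDr mulr1 mulrC.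
    by rewrite lerDl ltW.
  move: uqp kle kG; rewrite kE.
  move: (\int[mu]_(t in _) k t) (\int[mu]_(t in _) g t) (G q) => i1 i2 i3.
  by clear -e C z p q; lra.
apply: (@dini_nonincreasing _ p q u E) => //.
  apply/within_itvP => t tpq r r0.
  have [|d d0 dP] := (within_itvP _ _ _).1 cz t tpq (r / 2); first lra.
  exists (Num.min d (r / 2 / (4 * C + 1))).
    by rewrite lt_min d0 !divr_gt0//; lra.
  move=> s spq; rewrite lt_min => /andP[/(dP _ spq) zst].
  have C1 : 0 < 4 * C + 1 by lra.
  rewrite ltr_pdivlMr// => st.
  have Gst : `|G s - G t| <= 2 * C * `|s - t|.
    case: (leP s t) => h.
      have h1 : G s <= G t by apply: Gnd; lra.
      have h2 : G t <= G s + 2 * C * (t - s).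
        by apply: GI; [lra|lra|lra|move=> v vst; have /k'0/andP[] : p <= v <= q by lra].
      by rewrite distrC [X in _ <= _ * X]distrC ger0_norm ?subr_ge0// ger0_norm; lra.
    have h1 : G t <= G s by apply: Gnd; lra.
    have h2 : G s <= G t + 2 * C * (s - t).
      by apply: GI; [lra|lra|lra|move=> v vst; have /k'0/andP[] : p <= v <= q by lra].
    by rewrite ger0_norm ?subr_ge0// ger0_norm; lra.
  have -> : u s - u t = (z s - z t) + (G s - G t) - C * (s - t).
    by rewrite /u; ring.
  rewrite (le_lt_trans (ler_normB _ _))// normrM (ger0_norm C0).
  have := ler_normD (z s - z t) (G s - G t).
  have : 0 <= `|s - t| by [].
  have : 0 <= C * `|s - t| by rewrite mulr_ge0.
  nra.
move=> t /andP[pt tq] Et r r0.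
have ptq : p < t <= q by rewrite pt.
have [d dP dg] := dz t ptq Et.
have r20 : 0 < r / 2 by lra.
have [d1 d10 d1P] := is_left_derive_upper dP r20.
have [d2 d20 d2P] : exists2 d2, 0 < d2 &
    forall s, t - d2 < s <= t -> k' s <= k t + r / 2.
  have kt0 : 0 <= k t by have /k0/andP[] : p <= t <= q by lra.
  have [Kt|Kt] := pselect (K t).
    have /subspace_continuousP/(_ t Kt)/cvgrPdist_lt/(_ _ r20) := kK.
    rewrite near_withinE => /nbhs_ballP[d2 /= d20 d2P].
    exists d2 => // s std; rewrite k'E.
    case: ifPn => [/set_mem Ks|_]; last by lra.
    have := d2P s; rewrite /ball/= ger0_norm; last lra.
    have h : t - s < d2 by lra.
    move=> /(_ h Ks) kts; have {kts} : `|k t - k s| < r / 2 := kts.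
    by rewrite ltr_norml => /andP[]; lra.
  have oK : open (~` K) by exact: closed_openC.
  have /nbhs_ballP[d2 /= d20 d2P] := oK t Kt.
  exists d2 => // s std; rewrite k'E.
  case: ifPn => [/set_mem Ks|_]; last by lra.
  exfalso; apply: (d2P s) => //; rewrite /ball/= ger0_norm; lra.
exists (Num.min d1 (Num.min d2 (t - p))); first by rewrite !lt_min d10 d20; lra.
move=> h; rewrite !lt_min => /and4P[h0 hd1 hd2 hp].
have H1 := d1P h; rewrite h0 hd1 in H1; have {}H1 := H1 isT.
have H2 : G t <= G (t - h) + (k t + r / 2) * (t - (t - h)).
  apply: GI; [lra|lra|lra|move=> s sth].
  by apply: d2P; lra.
have H3 : d * h <= g t * h by rewrite ler_wpM2r// ltW.
rewrite /u; move: H2; rewrite /k; nra.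
Qed.

(** * Variation of constants *)

Lemma is_derive_left (R : realType) (f : R -> R) (t d : R) :
  is_derive t 1 f d -> is_left_derive f t d.
Proof.
move=> [df <-].
suff : (h^-1 *: (f (h *: 1 + t) - f t) : R) @[h --> (0:R)^'-] --> 'D_1 f t.
  apply: cvg_trans; apply: near_eq_cvg; apply: nearW => h.
  by rewrite [h *: 1]mulr1 [t + h]addrC.
apply: cvg_trans df => P; rewrite /nbhs/= /at_left /dnbhs => -[r r0 rP].
exists r => // s rs s0; apply: rP => //.
by rewrite lt_eqF.
Qed.

Lemma is_left_derive_cvg (R : realType) (f : R -> R) (t d : R) :
  is_left_derive f t d -> f (t + h) @[h --> 0^'-] --> f t.
Proof.
move=> df.
have h0 : (h : R) @[h --> (0:R)^'-] --> (0 : R).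
  by apply: cvg_within.
have := cvgD (cvgM h0 df) (cvg_cst (f t)); rewrite mul0r add0r.
move=> H; apply: cvg_trans (H _ _ _); apply: near_eq_cvg.
rewrite near_withinE; apply: nearW => h hlt0 /=.
rewrite -[LHS]/(h * (h^-1 * (f (t + h) - f t)) + f t).
by rewrite mulrA divff ?lt_eqF// mul1r subrK.
Qed.

Lemma is_left_deriveM (R : realType) (u y : R -> R) (t du dy : R) :
  is_left_derive u t du -> is_left_derive y t dy ->
  is_left_derive (fun s => u s * y s) t (u t * dy + du * y t).
Proof.
move=> Hu Hy.
have := cvgD (cvgM (is_left_derive_cvg Hu) Hy) (cvgM Hu (cvg_cst (y t))).
move=> H; apply: cvg_trans (H _ _ _ _); apply: near_eq_cvg; apply: nearW => h.
rewrite -[LHS]/(u (t + h) * (h^-1 * (y (t + h) - y t)) +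
  h^-1 * (u (t + h) - u t) * y t).
ring.
Qed.

Section primitive.
Variables (R : realType) (a : R -> R).
Hypothesis a_ge0 : forall t : R, 0 <= t -> 0 <= a t.
Hypothesis a_cont : {within `[0, +oo[, continuous a}.
Let mu := @lebesgue_measure R.
Let A t := \int[mu]_(s in `[0, t]) a s.

Lemma rate_integrable (p q : R) : 0 <= p -> mu.-integrable `[p, q] (EFin \o a).
Proof.
move=> p0; apply: continuous_compact_integrable; first exact: segment_compact.
apply: continuous_subspaceW a_cont => x /=; rewrite !in_itv/= andbT.
by move=> /andP[px _]; apply: le_trans px.
Qed.

Lemma rate_integralB (s t : R) : 0 <= s -> s <= t ->
  \int[mu]_(u in `[s, t]) a u = A t - A s.
Proof.
move=> s0 st; rewrite /A Rintegral_itvB//; first by rewrite Rintegral_itv_obnd_cbnd//;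
  apply: integrableS (@rate_integrable s t s0) => //; apply: subset_itvr; rewrite bnd_simp.
exact: rate_integrable.
Qed.

Lemma rate_integral_ge0 (s t : R) : 0 <= s -> 0 <= \int[mu]_(u in `[s, t]) a u.
Proof.
move=> s0; apply: Rintegral_ge0 => x; rewrite /= in_itv/= => /andP[sx _].
by apply: a_ge0; lra.
Qed.

Lemma rate_primitive_is_derive (t : R) : 0 < t -> is_derive t 1 A (a t).
Proof.
move=> t0.
have ca : {for t, continuous a}.
  have tI : `[0, +oo[%classic t by rewrite /= in_itv/= ltW.
  have /cvgrPdist_lt H := (subspace_continuousP _ _).1 a_cont t tI.
  apply/cvgrPdist_lt => e /H; rewrite near_withinE => He.
  have : \forall x \near t, 0 < x by exact: lt_nbhsr.
  by apply: filterS2 He => x Hx x0; apply: Hx; rewrite /= in_itv/= ltW.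
have tt : t < t + 1 by lra.
have [] := @continuous_FTC1_closed _ a 0 t (t + 1) tt (rate_integrable _ (lexx 0)) t0 ca.
by rewrite derive1E => ? ?; split.
Qed.

Lemma rate_primitive_continuous (p q : R) : 0 <= p -> p <= q ->
  {within `[p, q], continuous A}.
Proof.
move=> p0 pq; have q0 : 0 <= q by lra.
apply: (continuous_subspaceW _ (parameterized_integral_continuous q0
  (rate_integrable q (lexx 0)))).
by apply: subset_itvr; rewrite bnd_simp.
Qed.

Lemma rate_kernel_measurable (p q t : R) : 0 <= p -> p <= q -> q <= t ->
  measurable_fun `[p, q] (fun s => expR (- \int[mu]_(u in `[s, t]) a u)).
Proof.
move=> p0 pq qt.
have mA : measurable_fun `[p, q] A.
  by apply: subspace_continuous_measurable_fun => //; exact: rate_primitive_continuous.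
apply: (@eq_measurable_fun _ _ _ _ _ (fun s => expR (- (A t - A s)))).
  move=> s; rewrite inE/= in_itv/= => spq; rewrite rate_integralB//; lra.
apply: measurableT_comp => //; apply: measurableT_comp => //.
exact: measurable_funB.
Qed.

Lemma rate_kernel_le1 (s t : R) : 0 <= s ->
  expR (- \int[mu]_(u in `[s, t]) a u) <= 1.
Proof. by move=> s0; rewrite -expR0 ler_expR oppr_le0 rate_integral_ge0. Qed.

(** The integrating factor exp(A(s) - A(q)) is used instead of exp(A(s)), so that
    the factor stays below 1 on [p, q] and the bound on g carries over. *)
Lemma variation_of_constants_le (p q V C : R) (y g : R -> R) (E : set R) :
    0 <= p -> p <= q -> finite_set (E `&` `[p, q]) ->
    {within `[p, q], continuous y} ->
    measurable_fun `[p, q] g -> (forall t, p <= t <= q -> `|g t| <= C) ->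
    (forall t, p < t <= q -> ~ E t ->
      exists2 d, is_left_derive y t d & d + a t * y t <= V * g t) ->
  y q <= y p * expR (- \int[mu]_(u in `[p, q]) a u) +
    V * \int[mu]_(s in `[p, q]) (expR (- \int[mu]_(u in `[s, q]) a u) * g s).
Proof.
move=> p0 pq finE cy mg gC dy.
have cA := rate_primitive_continuous p0 pq.
have mA : measurable_fun `[p, q] A by exact: subspace_continuous_measurable_fun.
pose eA s := expR (A s - A q).
have eA1 s : p <= s <= q -> 0 <= eA s <= 1.
  move=> spq; rewrite expR_ge0/= -expR0 ler_expR subr_le0 -subr_ge0.
  by rewrite -rate_integralB; [apply: rate_integral_ge0; lra|lra|lra].
have eAE s : p <= s <= q -> expR (- \int[mu]_(u in `[s, q]) a u) = eA s.
  by move=> spq; rewrite rate_integralB ?opprB//; lra.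
have meA : measurable_fun `[p, q] eA.
  by apply: measurableT_comp => //; exact: measurable_funB.
have C0 : 0 <= C by apply: le_trans (gC p _); rewrite ?lexx.
have eAgC t : p <= t <= q -> `|eA t * g t| <= C.
  move=> tpq; have /andP[e0 e1] := eA1 _ tpq.
  by rewrite normrM ger0_norm// -[C]mul1r ler_pM// gC.
have eq1 : eA q = 1 by rewrite /eA subrr expR0.
have ppq : p <= p <= q by rewrite lexx.
have -> : \int[mu]_(s in `[p, q]) (expR (- \int[mu]_(u in `[s, q]) a u) * g s) =
    \int[mu]_(s in `[p, q]) (eA s * g s).
  by apply: eq_Rintegral => s; rewrite inE/= in_itv/= => spq; rewrite eAE.
have intg : mu.-integrable `[p, q] (EFin \o (fun s => eA s * g s)).
  by apply: (@bounded_integrable_itv _ _ p q C) => //; exact: measurable_funM.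
rewrite -lerBlDl [y p * _]mulrC eAE// -RintegralZl// -[y q]mul1r -{1}eq1.
apply: (@left_derive_le_integral R p q (`|V| * C) (fun s => eA s * y s)
  (fun s => V * (eA s * g s)) E pq finE).
- apply/subspace_continuousP => x xpq; apply: cvgM.
    apply: (@continuous_cvg _ _ _ _ _ (fun s => A s - A q) expR).
      exact: continuous_expR.
    apply: cvgB; last exact: cvg_cst.
    exact: ((subspace_continuousP _ _).1 cA).
  exact: ((subspace_continuousP _ _).1 cy).
- by apply: measurable_funM => //; exact: measurable_funM.
- by move=> t tpq; rewrite normrM ler_wpM2l// eAgC.
move=> t ptq nE; have [d yd dV] := dy t ptq nE.
have t0 : 0 < t by lra.
have deA : is_derive t 1 eA (eA t * a t).
  have := rate_primitive_is_derive t0 => dA.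
  have dAq : is_derive t 1 (fun s => A s - A q) (a t).
    by rewrite -[a t]subr0; apply: is_deriveB.
  exact: (is_derive1_comp (is_derive_expR _) dAq).
exists (eA t * d + eA t * a t * y t).
  by apply: is_left_deriveM => //; exact: is_derive_left.
have e0 : 0 <= eA t by exact: expR_ge0.
have := ler_wpM2l e0 dV; lra.
Qed.

End primitive.

(** * Affine iteration and last zeros *)

Lemma geometric_small (R : realType) (rho V0 e : R) :
  0 <= rho < 1 -> 0 <= V0 -> 0 < e -> exists n, rho ^+ n * V0 < e.
Proof.
move=> /andP[r0 r1] V00 e0.
have e1 : 0 < e / (V0 + 1) by rewrite divr_gt0//; lra.
have : (fun n => rho ^+ n) @ \oo --> (0 : R).
  by apply: cvg_expr; rewrite ger0_norm.
move=> /cvgrPdist_lt/(_ _ e1)[n _ /(_ n (leqnn n))].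
rewrite sub0r normrN ger0_norm ?exprn_ge0// ltr_pdivlMr; last lra.
move=> h; exists n; apply: le_lt_trans h.
by rewrite ler_wpM2l ?exprn_ge0//; lra.
Qed.

(** Any bound V on x improves to K + rho V, and the fixed point of this map is
    K / (1 - rho).  The predicate P stands for the family of bounds that is
    improved, which usually concerns a whole half-line and not only x. *)
Lemma affine_contraction_bound (R : realType) (P : R -> Prop) (x rho K V0 : R) :
    0 <= rho < 1 -> 0 <= K -> 0 <= V0 -> P V0 ->
    (forall V, 0 <= V -> P V -> P (K + rho * V)) ->
    (forall V, P V -> x <= V) -> x <= K / (1 - rho).
Proof.
move=> r01 K0 V00 PV0 PS Px.
have /andP[r0 r1] := r01.
have r10 : 0 < 1 - rho by lra.
have C0 : 0 <= K / (1 - rho) by rewrite divr_ge0// ltW.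
(* The n-th iterate of V |-> K + rho V at V0. *)
pose W n := K / (1 - rho) * (1 - rho ^+ n) + rho ^+ n * V0.
have W0 n : 0 <= W n.
  have : rho ^+ n <= 1 by rewrite exprn_ile1// ltW.
  move=> h; apply: addr_ge0; apply: mulr_ge0 => //; first by rewrite subr_ge0.
  exact: exprn_ge0.
have Pn n : P (W n).
  elim: n => [|n IH]; first by rewrite /W expr0 subrr mulr0 add0r mul1r.
  have := PS _ (W0 n) IH; congr P; rewrite /W exprS; field; lra.
apply/ler_addgt0Pr => e e0.
have [n nP] := geometric_small r01 V00 e0.
apply: (le_trans (Px _ (Pn n))); rewrite /W.
have : 0 <= K / (1 - rho) * rho ^+ n by rewrite mulr_ge0// exprn_ge0.
lra.
Qed.

(** Locates the start of a positive excursion: either a zero of y, or the left end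
    of the interval when y has no zero there. *)
Lemma last_zero (R : realType) (y : R -> R) (p q : R) :
    p <= q -> {within `[p, q], continuous y} -> 0 < y q ->
  exists xi, [/\ p <= xi <= q, forall s, xi <= s <= q -> 0 <= y s &
    y xi = 0 \/ (xi = p /\ 0 < y p)].
Proof.
move=> pq /within_itvP cy yq.
have [ypos|] := pselect (forall s, p <= s <= q -> 0 < y s).
  exists p; split; first by rewrite lexx.
    by move=> s /ypos/ltW.
  by right; split => //; apply: ypos; rewrite lexx.
move=> /existsNP[s0 /not_implyP[s0pq /negP]]; rewrite -leNgt => ys0.
pose S := [set s | p <= s <= q /\ y s <= 0].
have hS : has_sup S by split; [exists s0|exists q => s [/andP[]]].
pose xi := sup S.
have s0xi : s0 <= xi by apply: ub_le_sup => //; exact: hS.2.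
have xiq : xi <= q by apply: sup_le_ub => //; [exists s0|move=> s [/andP[]]].
have xipq : p <= xi <= q by lra.
have ypos s : xi < s -> s <= q -> 0 < y s.
  move=> xis sq; rewrite ltNge; apply/negP => ys.
  have : s <= xi by apply: ub_le_sup; [exact: hS.2|split => //; lra].
  lra.
have yxi : y xi <= 0.
  rewrite leNgt; apply/negP => yxi.
  have [d d0 dP] := cy xi xipq _ yxi.
  have [s [spq ys] sd] := sup_adherent d0 hS.
  have sxi : s <= xi by apply: ub_le_sup => //; exact: hS.2.
  have := dP s spq; rewrite ler0_norm; last lra.
  have sd' : - (s - xi) < d by rewrite -/xi in sd; lra.
  by move=> /(_ sd'); rewrite ltr_norml => /andP[]; lra.
have {}xiq : xi < q.
  rewrite lt_neqAle xiq andbT; apply/eqP => xq; move: yxi; rewrite xq; lra.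
have yxi0 : y xi = 0.
  apply/eqP; rewrite eq_le yxi/= leNgt; apply/negP => yneg.
  have yn : 0 < - y xi by lra.
  have [d d0 dP] := cy xi xipq _ yn.
  pose s := Num.min q (xi + d / 2).
  have s1 : s <= q by rewrite ge_min lexx.
  have s2 : s <= xi + d / 2 by rewrite ge_min lexx orbT.
  have s3 : xi < s by rewrite lt_min xiq; lra.
  have spq : p <= s <= q by lra.
  have := dP s spq; rewrite gtr0_norm; last lra.
  have sd' : s - xi < d by lra.
  have := ypos s s3 s1.
  by move=> ? /(_ sd'); rewrite ltr_norml => /andP[]; lra.
exists xi; split => //; last by left.
move=> s /andP[]; rewrite le_eqVlt => /predU1P[<- _|xis sq]; first by rewrite yxi0.
by rewrite ltW// ypos.
Qed.

(** * The scalar delay inequality *)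

(** The form that the equation takes for y: a lower bound - V on the delay window
    is the only information on the past that enters.  It is used for the
    function y and its opposite, with different gains g. *)
Definition delay_ineq (R : realType) (a tau : R -> R) (E : set R) (t0 : R)
    (g y : R -> R) : Prop :=
  forall t V : R, t0 < t -> ~ E t -> 0 <= V ->
    (forall r, t - tau t <= r <= t -> - V <= y r) ->
    exists2 d, is_left_derive y t d & d + a t * y t <= V * g t.

Definition admissible_gain (R : realType) (g : R -> R) : Prop :=
  [/\ forall t : R, 0 <= t -> 0 <= g t,
      forall N : R, measurable_fun `[0, N] g &
      forall N : R, exists C : R, forall t : R, 0 <= t <= N -> g t <= C].

(** For g the gain built from lambda_(j,i), the least such al is alpha_j. *)
Definition gain_bound (R : realType) (a tau g : R -> R) (T al : R) : Prop :=
  forall t, T <= t -> \int[@lebesgue_measure R]_(s in `[t - tau t, t])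
    (expR (- \int[@lebesgue_measure R]_(u in `[s, t]) a u) * g s) <= al.

Section comparison.
Variables (R : realType) (a tau : R -> R) (E : set R) (t0 T : R).
Hypothesis a_ge0 : forall t : R, 0 <= t -> 0 <= a t.
Hypothesis a_cont : {within `[0, +oo[, continuous a}.
Hypothesis tau_ge0 : forall t : R, 0 <= t -> 0 <= tau t.
Hypothesis tau_mono : forall s t : R, 0 <= s -> s <= t -> s - tau s <= t - tau t.
Hypothesis tau_infty : forall M : R, exists S : R, forall t, S <= t -> M <= t - tau t.
Hypothesis finE : forall N : R, finite_set (E `&` `[0, N]).
Hypothesis t0_ge0 : 0 <= t0.
Hypothesis T_ge0 : 0 <= T.
Hypothesis T_tau : 0 <= T - tau T.
Let mu := @lebesgue_measure R.

Lemma finite_exceptions (p q : R) : 0 <= p -> finite_set (E `&` `[p, q]).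
Proof.
move=> p0; apply: sub_finite_set (finE q) => x [Ex]; rewrite /= !in_itv/= => xpq.
by split=> //; lra.
Qed.

Section one_sided.
Variables (g y : R -> R) (al : R).
Hypothesis g_adm : admissible_gain g.
Hypothesis g_al : gain_bound a tau g T al.
Hypothesis y_cont : forall q : R, {within `[t0, q], continuous y}.
Hypothesis y_ineq : delay_ineq a tau E t0 g y.

Lemma continuous_tail (p q : R) : t0 <= p -> {within `[p, q], continuous y}.
Proof.
by move=> tp; apply: continuous_subspaceW (y_cont (q := q)); apply: subset_itvr; rewrite bnd_simp.
Qed.

Lemma gain_bound_ge0 : 0 <= al.
Proof.
apply: le_trans (g_al (lexx T)); apply: Rintegral_ge0 => s.
rewrite /= in_itv/= => /andP[s1 _]; rewrite mulr_ge0 ?expR_ge0//.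
by case: g_adm => + _ _; apply; exact: le_trans T_tau s1.
Qed.

Lemma step_le (p q V : R) : t0 <= p -> p <= q ->
  (forall t, p < t <= q -> ~ E t ->
      exists2 d, is_left_derive y t d & d + a t * y t <= V * g t) ->
  y q <= y p * expR (- \int[mu]_(u in `[p, q]) a u) +
    V * \int[mu]_(s in `[p, q]) (expR (- \int[mu]_(u in `[s, q]) a u) * g s).
Proof.
move=> tp pq H.
have p0 : 0 <= p by have := t0_ge0; lra.
have [g0 mg gC] := g_adm; have [C CP] := gC q.
apply: (@variation_of_constants_le _ _ a_ge0 a_cont p q V C y g E) => //.
- exact: finite_exceptions.
- exact: continuous_tail.
- apply: measurable_funS (mg q) => //; apply: subset_itvr; rewrite bnd_simp//.
- by move=> t tpq; rewrite ger0_norm ?g0 ?CP; lra.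
Qed.

Lemma gain_integral_le (p q : R) : T <= q -> q - tau q <= p -> p <= q ->
  \int[mu]_(s in `[p, q]) (expR (- \int[mu]_(u in `[s, q]) a u) * g s) <= al.
Proof.
have t00 := t0_ge0; have T0 := T_ge0; have Tt := T_tau.
move=> Tq qp pq; apply: le_trans (g_al Tq).
have [g0 mg gC] := g_adm; have [C CP] := gC q.
have q0 : 0 <= q - tau q by have := tau_mono T_ge0 Tq; lra.
have qq : q - tau q <= q by lra.
have int : mu.-integrable `[q - tau q, q]
    (EFin \o (fun s => expR (- \int[mu]_(u in `[s, q]) a u) * g s)).
  apply: (@bounded_integrable_itv _ _ (q - tau q) q C) => //.
    apply: measurable_funM; first exact: rate_kernel_measurable.
    by apply: measurable_funS (mg q) => //; apply: subset_itvr; rewrite bnd_simp.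
  move=> s; rewrite /= in_itv/= => spq.
  have s0 : 0 <= s by lra.
  rewrite normrM !ger0_norm ?expR_ge0 ?g0// -[C]mul1r ler_pM ?expR_ge0 ?g0//.
    exact: rate_kernel_le1.
  by apply: CP; lra.
rewrite -lee_fin !fineK.
- apply: ge0_subset_integral => //.
  + by have /integrableP[] := int.
  + move=> s; rewrite /= in_itv/= => spq; rewrite lee_fin mulr_ge0 ?expR_ge0//.
    by apply: g0; lra.
  + by apply: subset_itvr; rewrite bnd_simp.
- exact: integrable_fin_num.
- apply: integrable_fin_num => //; apply: integrableS int => //.
  by apply: subset_itvr; rewrite bnd_simp.
Qed.

(** Once s - tau s has passed p the window of s lies where y >= 0, so that y does
    not increase; let q' be the supremum of the times s at which it has not
    passed p.  For these s the forcing on [p, s] is at most V g, and [p, s] is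
    contained in [s - tau s, s], so it contributes at most al * V; continuity of y
    extends the bound to q'. *)
Lemma excursion_le (p q V : R) : t0 <= p -> T <= p -> p <= q ->
    (forall s, p <= s <= q -> 0 <= y s) -> 0 <= V ->
    (forall s, p - tau p <= s <= p -> - V <= y s) ->
  y q <= y p + al * V.
Proof.
have t00 := t0_ge0.
move=> tp Tp pq ypos V0 yV.
have p0 : 0 <= p by lra.
have yp0 : 0 <= y p by apply: ypos; lra.
(* The delayed argument s - tau s has not passed p as long as s <= r, so
   [p, r] is part of the window over which the gain is integrated. *)
have early r : p <= r -> r <= q -> r - tau r <= p -> y r <= y p + al * V.
  move=> pr rq rp.
  have H : forall t, p < t <= r -> ~ E t ->
      exists2 d, is_left_derive y t d & d + a t * y t <= V * g t.
    move=> t ptr nE; apply: y_ineq => //; first lra.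
    move=> s st; have [sp|ps] := leP s p.
      by apply: yV; have := @tau_mono p t p0; lra.
    by have := ypos s; lra.
  apply: (le_trans (step_le tp pr H)); apply: lerD.
    by rewrite ler_piMr// rate_kernel_le1.
  by rewrite mulrC ler_wpM2r// gain_integral_le//; lra.
pose S := [set s | p <= s <= q /\ s - tau s <= p].
have Sp : S p by split; [lra|have := tau_ge0 p0; lra].
have hS : has_sup S by split; [exists p|exists q => s [/andP[]]].
pose q' := sup S.
have pq' : p <= q' by apply: ub_le_sup => //; exact: hS.2.
have q'q : q' <= q by apply: sup_le_ub; [exists p|move=> s [/andP[]]].
have yq' : y q' <= y p + al * V.
  apply/ler_addgt0Pr => e e0.
  have /within_itvP/(_ q' _ e e0)[|d d0 dP] := continuous_tail (q := q) tp; first lra.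
  have [s [spq sp] sd] := sup_adherent d0 hS.
  have sq' : s <= q' by apply: ub_le_sup => //; exact: hS.2.
  have := dP s spq; rewrite ler0_norm; last lra.
  have sd' : - (s - q') < d by rewrite -/q' in sd; lra.
  move=> /(_ sd'); rewrite ltr_norml => /andP[? ?].
  have := early s; lra.
apply: le_trans yq'.
have H : forall t, q' < t <= q -> ~ E t ->
      exists2 d, is_left_derive y t d & d + a t * y t <= 0 * g t.
  move=> t ptr nE; apply: y_ineq => //; first lra.
  have tp' : p < t - tau t.
    rewrite ltNge; apply/negP => tp'.
    have : t <= q' by apply: ub_le_sup; [exact: hS.2|split => //; lra].
    lra.
  by move=> s st; rewrite oppr0; apply: ypos; lra.
have tq' : t0 <= q' by lra.
apply: (le_trans (step_le tq' q'q H)); rewrite mul0r addr0.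
by rewrite ler_piMr ?rate_kernel_le1 ?ypos//; lra.
Qed.

(** The excursion containing q starts at a zero, or at p. *)
Lemma upper_bound_le (p q Y V : R) : t0 <= p -> T <= p -> p <= q ->
    0 <= Y -> 0 <= V -> y p <= Y -> (forall s, s <= q -> - V <= y s) ->
  y q <= Y + al * V.
Proof.
move=> tp Tp pq Y0 V0 yp yV.
have al0 := gain_bound_ge0.
have [yq|yq] := leP (y q) 0; first by have := mulr_ge0 al0 V0; lra.
have [xi [xipq ypos xiE]] := last_zero pq (continuous_tail (q := q) tp) yq.
have xiq : xi <= q by lra.
have h1 : t0 <= xi by lra. have h2 : T <= xi by lra.
have : y q <= y xi + al * V.
  by apply: excursion_le => // s sxi; apply: yV; lra.
have : y xi <= Y by case: xiE => [->|[-> _]].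
lra.
Qed.

(** A zero p with p - tau p >= S starts the comparison: later excursions begin at
    zeros beyond p, whose windows lie in [S, +oo[. *)
Lemma eventually_upper_le (S V : R) : (forall M, exists2 t, M <= t & y t = 0) ->
    0 <= V -> (forall t, S <= t -> - V <= y t) ->
  exists S', forall t, S' <= t -> y t <= al * V.
Proof.
move=> osc V0 yV.
have al0 := gain_bound_ge0.
have [S1 S1P] := tau_infty S.
pose m := Num.max S1 (Num.max t0 T).
have [p mp yp] := osc m.
have [pS1 tp Tp] : [/\ S1 <= p, t0 <= p & T <= p].
  by move: mp; rewrite !ge_max => /and3P[].
exists p => q pq.
have [yq|yq] := leP (y q) 0; first by have := mulr_ge0 al0 V0; lra.
have [xi [xipq ypos xiE]] := last_zero pq (continuous_tail (q := q) tp) yq.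
have xiq : xi <= q by lra.
have h1 : t0 <= xi by lra. have h2 : T <= xi by lra.
have yxi : y xi = 0 by case: xiE => // -[-> _].
rewrite -[al * V]add0r -yxi; apply: excursion_le => // s sxi.
by apply: yV; have := S1P xi; lra.
Qed.

Lemma eventually_pos_decay (S : R) : (forall t, S <= t -> 0 < y t) ->
  exists2 p, t0 <= p /\ S <= p & forall r q, p <= r -> r <= q ->
    y q <= y r * expR (- \int[mu]_(u in `[r, q]) a u).
Proof.
have t00 := t0_ge0.
move=> ypos; have [S1 S1P] := tau_infty S.
exists (Num.max S1 (Num.max t0 S)); first by rewrite !le_max !lexx !orbT.
move=> r q; rewrite !ge_max => /and3P[S1r tr Sr] rq.
rewrite -[X in _ <= X]addr0 -[X in _ <= _ + X](mul0r (\int[mu]_(s in `[r, q])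
  (expR (- \int[mu]_(u in `[s, q]) a u) * g s))).
apply: step_le => // t rtq nE; apply: y_ineq => //; first lra.
by move=> s st; rewrite oppr0 ltW// ypos//; have := S1P t; lra.
Qed.

(** Over a step so short that the integral of g is at most 1/2, new values are
    fed back with a factor at most 1/2. *)
Lemma short_step_le (p q N L Y V : R) : t0 <= p -> p <= q -> q <= N ->
    (forall t, 0 <= t <= N -> g t <= L) -> (q - p) * L <= 1 / 2 ->
    0 <= Y -> 0 <= V -> y p <= Y -> (forall s, s <= q -> - V <= y s) ->
  y q <= Y + 1 / 2 * V.
Proof.
have t00 := t0_ge0.
move=> tp pq qN gL Lpq Y0 V0 yp yV.
have p0 : 0 <= p by lra.
have [g0 mg _] := g_adm.
have kg s : p <= s <= q ->
    0 <= expR (- \int[mu]_(u in `[s, q]) a u) * g s <= L.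
  move=> spq; have s0 : 0 <= s by lra.
  rewrite mulr_ge0 ?expR_ge0 ?g0//= -[L]mul1r ler_pM ?expR_ge0 ?g0//.
    exact: rate_kernel_le1.
  by apply: gL; lra.
have int : \int[mu]_(s in `[p, q]) (expR (- \int[mu]_(u in `[s, q]) a u) * g s)
    <= L * (q - p).
  have := @Rintegral_itv_le R p q L L
    (fun s => expR (- \int[mu]_(u in `[s, q]) a u) * g s) p q.
  rewrite set_itv1 Rintegral_set1 add0r; apply => //.
  - apply: measurable_funM; first exact: rate_kernel_measurable.
    by apply: measurable_funS (mg q) => //; apply: subset_itvr; rewrite bnd_simp.
  - by move=> s /kg/andP[h1 h2]; rewrite ger0_norm.
  - by move=> s ps; have /kg/andP[] : p <= s <= q by lra.
have H : forall t, p < t <= q -> ~ E t ->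
    exists2 d, is_left_derive y t d & d + a t * y t <= V * g t.
  by move=> t ptq nE; apply: y_ineq => // [|s st]; [lra|apply: yV; lra].
have yY : y p * expR (- \int[mu]_(u in `[p, q]) a u) <= Y.
  have [yp0|yp0] := leP 0 (y p).
    by apply: le_trans yp; rewrite ler_piMr// rate_kernel_le1.
  by apply: le_trans Y0; rewrite nmulr_rle0// expR_ge0.
have := step_le tp pq H.
have := ler_wpM2l V0 int.
have : V * (L * (q - p)) <= V * (1 / 2) by rewrite ler_wpM2l// mulrC.
lra.
Qed.

End one_sided.

Lemma continuous_bounded (y : R -> R) (p q : R) : {within `[p, q], continuous y} ->
  exists2 M, 0 <= M & forall s, p <= s <= q -> `|y s| <= M.
Proof.
move=> cy; have [pq|qp] := leP p q; last by exists 0 => // s; lra.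
have cy' : {within `[p, q], continuous (fun s => `|y s|)}.
  apply/within_itvP => t tpq e e0.
  have [d d0 dP] := (within_itvP _ _ _).1 cy t tpq e e0.
  exists d => // s spq sd; apply: le_lt_trans (dP s spq sd).
  exact: ler_dist_dist.
have [c cpq cP] := EVT_max pq cy'.
by exists `|y c| => // s spq; apply: cP; rewrite in_itv.
Qed.

Section two_sided.
Variables (g1 g2 y : R -> R) (al1 al2 : R).
Hypothesis g1_adm : admissible_gain g1.
Hypothesis g2_adm : admissible_gain g2.
Hypothesis g1_al : gain_bound a tau g1 T al1.
Hypothesis g2_al : gain_bound a tau g2 T al2.
Hypothesis al12 : al1 * al2 < 1.
Hypothesis y_cont : forall q : R, {within `[t0, q], continuous y}.
Hypothesis y_ineq2 : delay_ineq a tau E t0 g2 y.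
Hypothesis y_ineq1 : delay_ineq a tau E t0 g1 (fun t => - y t).

Lemma opp_continuous (q : R) : {within `[t0, q], continuous (fun t => - y t)}.
Proof. by move=> x; apply: cvgN; exact: y_cont. Qed.

(** A bound U for y from above gives the bound Y + al1 * U for - y, which in turn
    gives Y + al2 * (Y + al1 * U) for y: an affine map of slope al1 * al2. *)
Lemma global_upper_bound (p Y : R) : t0 <= p -> T <= p -> 0 <= Y ->
  (forall s, s <= p -> `|y s| <= Y) ->
  forall t, y t <= (Y + al2 * Y) / (1 - al1 * al2).
Proof.
move=> tp Tp Y0 yY t.
have al10 := gain_bound_ge0 g1_adm g1_al.
have al20 := gain_bound_ge0 g2_adm g2_al.
have [M M0 yM] := continuous_bounded (y_cont (q := t)).
apply: (@affine_contraction_bound R (fun U => forall s, s <= t -> y s <= U) _ _ _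
  (Num.max Y M)).
- by rewrite mulr_ge0.
- by rewrite addr_ge0 ?mulr_ge0.
- by rewrite le_max Y0.
- move=> s st; rewrite le_max; have [sp|ps] := leP s p.
    by have := yY s sp; rewrite ler_norml => /andP[_ ->].
  have : t0 <= s <= t by lra.
  by move=> /yM; rewrite ler_norml => /andP[_ ->]; rewrite orbT.
- move=> U U0 yU.
  have yl s : s <= t -> - (Y + al1 * U) <= y s.
    move=> st; rewrite lerNl; have [sp|/ltW ps] := leP s p.
      have := yY s sp; rewrite ler_norml => /andP[].
      by have := mulr_ge0 al10 U0; lra.
    apply: (upper_bound_le g1_adm g1_al opp_continuous y_ineq1 tp Tp ps) => //.
      by have := yY p (lexx p); rewrite ler_norml => /andP[]; lra.
    by move=> r rs; rewrite lerN2; apply: yU; lra.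
  move=> s st; have [sp|/ltW ps] := leP s p.
    have := yY s sp; rewrite ler_norml => /andP[].
    have := mulr_ge0 al20 Y0.
    by have := mulr_ge0 (mulr_ge0 al10 al20) U0; lra.
  have V0 : 0 <= Y + al1 * U by rewrite addr_ge0 ?mulr_ge0.
  have ypY : y p <= Y by have := yY p (lexx p); rewrite ler_norml => /andP[].
  have := upper_bound_le g2_adm g2_al y_cont y_ineq2 tp Tp ps Y0 V0 ypY.
  have H r : r <= s -> - (Y + al1 * U) <= y r by move=> rs; apply: yl; lra.
  by move=> /(_ H); lra.
- by move=> U; apply.
Qed.

Lemma short_growth (p q N L Y : R) : t0 <= p -> p <= q -> q <= N ->
    (forall t, 0 <= t <= N -> g1 t <= L /\ g2 t <= L) -> (q - p) * L <= 1 / 2 ->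
    0 <= Y -> (forall s, s <= p -> `|y s| <= Y) ->
  forall s, s <= q -> `|y s| <= 2 * Y.
Proof.
move=> tp pq qN gL Lpq Y0 yY s sq.
have [M M0 yM] := continuous_bounded (y_cont (q := q)).
have -> : 2 * Y = Y / (1 - 1 / 2) by field.
apply: (@affine_contraction_bound R (fun U => forall s, s <= q -> `|y s| <= U) _ _ _
  (Num.max Y M)) => //.
- by lra.
- by rewrite le_max Y0.
- move=> r rq; rewrite le_max; have [rp|pr] := leP r p; first by rewrite yY.
  by rewrite yM ?orbT//; lra.
- move=> U U0 yU r rq; have [rp|/ltW pr] := leP r p.
    by apply: (le_trans (yY r rp)); lra.
  have Lrp : (r - p) * L <= 1 / 2.
    have [L0|L0] := leP 0 L; last by have := @nmulr_lle0 _ _ (r - p) L0; lra.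
    by apply: le_trans Lpq; rewrite ler_wpM2r//; lra.
  have ypY : `|y p| <= Y by exact: yY.
  have rN : r <= N by lra.
  have yU' v : v <= r -> - U <= y v <= U by move=> vr; rewrite -ler_norml; apply: yU; lra.
  rewrite ler_norml lerNl; apply/andP; split.
    apply: (short_step_le g1_adm opp_continuous y_ineq1 tp pr rN _ Lrp Y0 U0).
    + by move=> t /gL[].
    + by move: ypY; rewrite ler_norml => /andP[]; lra.
    + by move=> v /yU'/andP[]; rewrite lerN2.
  apply: (short_step_le g2_adm y_cont y_ineq2 tp pr rN _ Lrp Y0 U0).
  + by move=> t /gL[].
  + by move: ypY; rewrite ler_norml => /andP[].
  + by move=> v /yU'/andP[].
- by move=> U; apply.
Qed.

Lemma oscillating_cvg0 (M0 : R) : (forall M, exists2 t, M <= t & y t = 0) ->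
    0 <= M0 -> (forall t, t0 <= t -> `|y t| <= M0) ->
  y t @[t --> +oo] --> (0 : R).
Proof.
move=> osc M00 yM.
have al10 := gain_bound_ge0 g1_adm g1_al.
have al20 := gain_bound_ge0 g2_adm g2_al.
have osc' M : exists2 t, M <= t & - y t = 0.
  by have [t Mt yt] := osc M; exists t => //; rewrite yt oppr0.
have step n : exists S, forall t, S <= t ->
    `|y t| <= (al1 * al2) ^+ n * M0.
  elim: n => [|n [S SP]].
    by exists t0 => t /yM; rewrite expr0 mul1r.
  pose U := (al1 * al2) ^+ n * M0.
  have U0 : 0 <= U by rewrite mulr_ge0 ?exprn_ge0 ?mulr_ge0.
  have lowU t : S <= t -> - U <= y t by move=> /SP; rewrite ler_norml => /andP[].
  have lowU' t : S <= t -> - U <= - y t.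
    by move=> /SP; rewrite ler_norml lerN2 => /andP[].
  have [S1 S1P] := eventually_upper_le g2_adm g2_al y_cont y_ineq2 osc U0 lowU.
  have [S2 S2P] := eventually_upper_le g1_adm g1_al opp_continuous y_ineq1 osc' U0 lowU'.
  have V10 := mulr_ge0 al10 U0; have V20 := mulr_ge0 al20 U0.
  have lo1 t : S2 <= t -> - (al1 * U) <= y t by move=> /S2P; rewrite lerNl.
  have lo2 t : S1 <= t -> - (al2 * U) <= - y t by move=> /S1P; rewrite lerN2.
  have [S3 S3P] := eventually_upper_le g2_adm g2_al y_cont y_ineq2 osc V10 lo1.
  have [S4 S4P] := eventually_upper_le g1_adm g1_al opp_continuous y_ineq1 osc' V20 lo2.
  exists (Num.max S3 S4) => t; rewrite ge_max => /andP[/S3P h3 /S4P h4].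
  rewrite exprS -mulrA -/U ler_norml lerNl; apply/andP; split; lra.
apply/cvgrPdist_lt => e e0.
have r01 : 0 <= al1 * al2 < 1 by rewrite mulr_ge0.
have [n nP] := geometric_small r01 M00 e0.
have [S SP] := step n.
exists S; split; first exact: num_real.
move=> t St; rewrite sub0r normrN; apply: le_lt_trans nP; apply: SP.
exact: ltW.
Qed.

End two_sided.

Lemma global_bound (g1 g2 y : R -> R) (al1 al2 p Y : R) :
    admissible_gain g1 -> admissible_gain g2 ->
    gain_bound a tau g1 T al1 -> gain_bound a tau g2 T al2 -> al1 * al2 < 1 ->
    (forall q : R, {within `[t0, q], continuous y}) ->
    delay_ineq a tau E t0 g2 y -> delay_ineq a tau E t0 g1 (fun t => - y t) ->
    t0 <= p -> T <= p -> 0 <= Y -> (forall s, s <= p -> `|y s| <= Y) ->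
  forall t, `|y t| <= (1 + al1 + al2) / (1 - al1 * al2) * Y.
Proof.
move=> ga1 ga2 gb1 gb2 al12 cy i2 i1 tp Tp Y0 yY t.
have al10 := gain_bound_ge0 ga1 gb1.
have al20 := gain_bound_ge0 ga2 gb2.
have yY' s : s <= p -> `|- y s| <= Y by rewrite normrN; exact: yY.
have i2' : delay_ineq a tau E t0 g2 (fun t => - - y t).
  by rewrite (_ : (fun _ => _) = y)//; apply/funext => s; rewrite opprK.
have up := global_upper_bound ga1 ga2 gb1 gb2 al12 cy i2 i1 tp Tp Y0 yY t.
have al21 : al2 * al1 < 1 by rewrite mulrC.
have lo := global_upper_bound ga2 ga1 gb2 gb1 al21 (opp_continuous cy) i1 i2' tp Tp Y0 yY' t.
have r0 : 0 < (1 - al1 * al2)^-1 by rewrite invr_gt0; lra.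
rewrite [al2 * al1]mulrC in lo.
have H1 := mulr_ge0 al10 Y0; have H2 := mulr_ge0 al20 Y0.
have le1 : (Y + al2 * Y) / (1 - al1 * al2) <= (1 + al1 + al2) / (1 - al1 * al2) * Y.
  rewrite [leRHS]mulrAC; apply: ler_wpM2r; first exact: ltW.
  by lra.
have le2 : (Y + al1 * Y) / (1 - al1 * al2) <= (1 + al1 + al2) / (1 - al1 * al2) * Y.
  rewrite [leRHS]mulrAC; apply: ler_wpM2r; first exact: ltW.
  by lra.
by rewrite ler_norml lerNl (le_trans lo le2) (le_trans up le1).
Qed.

(** Between t0 and T nothing is known about the integral of the gains, but they
    are bounded, by L say; each step of length 1 / (2 L) at most doubles the bound
    on |y|.  The constant has to be found before y, as stability requires. *)
Lemma finite_time_growth (g1 g2 : R -> R) (N : R) :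
    admissible_gain g1 -> admissible_gain g2 ->
  exists2 K, 0 < K & forall (y : R -> R) Y,
    (forall q : R, {within `[t0, q], continuous y}) ->
    delay_ineq a tau E t0 g2 y -> delay_ineq a tau E t0 g1 (fun t => - y t) ->
    0 <= Y -> (forall s, s <= t0 -> `|y s| <= Y) ->
    forall s, s <= N -> `|y s| <= K * Y.
Proof.
move=> ga1 ga2.
have [_ _ /(_ N)[C1 C1P]] := ga1.
have [_ _ /(_ N)[C2 C2P]] := ga2.
pose L := Num.max 1 (Num.max C1 C2).
have L1 : 1 <= L by rewrite le_max lexx.
have gL t : 0 <= t <= N -> g1 t <= L /\ g2 t <= L.
  move=> tN; have := C1P t tN; have := C2P t tN.
  by rewrite !le_max => -> ->; rewrite !orbT.
pose l := (2 * L)^-1.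
have l0 : 0 < l by rewrite invr_gt0; lra.
have lL : l * L = 1 / 2 by rewrite /l; field; lra.
pose P n := Num.min (t0 + n%:R * l) (Num.max t0 N).
have [n nP] : exists n : nat, N - t0 <= n%:R * l.
  have := Num.Theory.archi_boundP (normr_ge0 ((N - t0) / l)).
  move=> /ltW h; exists (Num.bound `|(N - t0) / l|).
  rewrite -ler_pdivrMr//; apply: le_trans h; exact: ler_norm.
exists (2 ^+ n); first by rewrite exprn_gt0.
move=> y Y cy i2 i1 Y0 yY.
suff H m : forall s, s <= P m -> `|y s| <= 2 ^+ m * Y.
  move=> s sN; apply: H; rewrite le_min le_max sN orbT andbT; lra.
elim: m => [|m IH].
  move=> s; rewrite /P mul0r addr0 expr0 mul1r le_min => /andP[st _].
  exact: yY.
have l' : m.+1%:R * l = m%:R * l + l by rewrite -natr1 mulrDl mul1r.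
have ml0 : 0 <= m%:R * l by rewrite mulr_ge0// ltW.
have tPm : t0 <= P m by rewrite le_min le_max lexx/= andbT; lra.
have PP : P m <= P m.+1.
  by rewrite /P le_min !ge_min lexx orbT andbT l'; apply/orP; left; lra.
have PP' : P m.+1 <= P m + l.
  rewrite /P l'; case: (leP (t0 + m%:R * l) (Num.max t0 N)) => h.
    by rewrite ge_min addrA lexx.
  by rewrite ge_min; apply/orP; right; lra.
have [tN|Nt] := leP t0 N; last first.
  move=> s sP; have st : s <= t0.
    by apply: (le_trans sP); rewrite /P ge_min (max_idPl (ltW Nt)) lexx orbT.
  by apply: (le_trans (yY s st)); rewrite ler_peMl// exprn_ege1// ler1n.
have PN : P m.+1 <= N by rewrite /P ge_min (max_idPr tN) lexx orbT.
rewrite exprS -mulrA; apply: (short_growth ga1 ga2 cy i2 i1 tPm PP PN gL _ _ IH).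
  have : (P m.+1 - P m) * L <= l * L by rewrite ler_wpM2r; lra.
  by rewrite lL.
by rewrite mulr_ge0// exprn_ge0.
Qed.

End comparison.

(** * Impulse times, the weights B_i and piecewise continuity *)

Lemma measurable_fun_if_in (R : realType) (D : set R) (c : R -> bool) (f g : R -> R) :
  measurable D -> measurable_fun D c -> measurable_fun D f -> measurable_fun D g ->
  measurable_fun D (fun t => if c t then f t else g t).
Proof.
move=> mD mc mf mg; apply: measurable_fun_if => //.
  exact: measurable_funS mf.
exact: measurable_funS mg.
Qed.

Lemma measurable_bigmax (R : realType) (D : set R) (I : Type) (s : seq I)
    (h : I -> R -> R) : (forall i, measurable_fun D (h i)) ->
  measurable_fun D (fun t => \big[Num.max/1]_(i <- s) h i t).
Proof.
move=> mh; elim: s => [|i s IH].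
  rewrite (_ : (fun t => _) = cst 1)//; apply/funext => t.
  by rewrite big_nil.
rewrite (_ : (fun t => _) =
  (fun t => Num.max (h i t) (\big[Num.max/1]_(i <- s) h i t))).
  exact: measurable_maxr.
by apply/funext => t; rewrite big_cons.
Qed.

(** The number of impulse times before t.  Counting turns products over the
    impulse times of an interval into products over intervals of integers. *)
Definition jump_count (R : realType) (tk : nat -> R) (t : R) : nat :=
  xget 0%N [set m | forall k, (k < m)%N = (tk k < t)].

Section impulse_times.
Variables (R : realType) (tk : nat -> R).
Hypothesis tk_incr : forall k, tk k < tk k.+1.
Hypothesis tk_infty : tk k @[k --> \oo] --> +oo.

Lemma impulse_lt i j : (tk i < tk j) = (i < j)%N.
Proof.
have homo : {homo tk : i j / (i < j)%N >-> i < j} by apply: homo_ltn => //; exact: lt_trans.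
exact: (leW_mono (le_mono homo)).
Qed.

Lemma jump_countP t k : (k < jump_count tk t)%N = (tk k < t).
Proof.
rewrite /jump_count; case: xgetP => [m -> //|nom]; exfalso.
have ex : exists m, t <= tk m.
  have /cvgryPge/(_ t)[m _ mP] := tk_infty.
  by exists m; apply: mP => /=.
apply: (nom (ex_minn ex)); case: ex_minnP => m tm mmin j.
apply/idP/idP => [jm|]; first by rewrite ltNge; apply/negP => /mmin; rewrite leqNgt jm.
by move=> jt; rewrite -impulse_lt; apply: lt_le_trans tm.
Qed.

Lemma jump_count_leP t k : (jump_count tk t <= k)%N = (t <= tk k).
Proof. by rewrite leqNgt jump_countP leNgt. Qed.

Lemma jump_count_le s t : s <= t -> (jump_count tk s <= jump_count tk t)%N.
Proof.
move=> st; rewrite leqNgt; apply/negP; rewrite jump_countP => h.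
by have := lt_le_trans h st; rewrite -jump_countP ltnn.
Qed.

Lemma jump_count_impulse k : jump_count tk (tk k) = k.
Proof.
apply/eqP; rewrite eqn_leq jump_count_leP lexx/=.
by case: k => // k; rewrite jump_countP.
Qed.

Lemma jump_count_left t : exists2 d, 0 < d &
  forall s, t - d < s -> s <= t -> jump_count tk s = jump_count tk t.
Proof.
case E : (jump_count tk t) => [|m].
  exists 1 => // s _ st; apply/eqP; rewrite -leqn0 -E; exact: jump_count_le.
have mt : tk m < t by rewrite -jump_countP E.
exists (t - tk m); first by rewrite subr_gt0.
move=> s ts st; apply/eqP; rewrite eqn_leq; apply/andP; split.
  by rewrite -E jump_count_le.
by rewrite jump_countP; lra.
Qed.

Lemma jump_count_right t : (forall k, t != tk k) -> exists2 d, 0 < d &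
  forall s, t <= s -> s < t + d -> jump_count tk s = jump_count tk t.
Proof.
move=> nt; set m := jump_count tk t.
have tm : t < tk m by rewrite lt_neqAle nt -jump_count_leP leqnn.
exists (tk m - t); first by rewrite subr_gt0.
move=> s ts st; apply/eqP; rewrite eqn_leq jump_count_leP [X in _ && X]jump_count_le// andbT; lra.
Qed.

Lemma jump_count_after k : exists2 d, 0 < d &
  forall s, tk k < s -> s < tk k + d -> jump_count tk s = k.+1.
Proof.
have h := tk_incr k; exists (tk k.+1 - tk k); first by rewrite subr_gt0.
move=> s ts st; apply/eqP; rewrite eqn_leq jump_count_leP jump_countP ts andbT; lra.
Qed.

Lemma impulse_finite N : finite_set [set t | t <= N /\ exists k, t = tk k].
Proof.
apply: (@sub_finite_set _ _ (tk @` `I_(jump_count tk (N + 1)))).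
  move=> t [tN [k tE]]; exists k => //=; rewrite jump_countP -tE; lra.
exact/finite_image/finite_II.
Qed.

Variable b : nat -> R.
Hypothesis b_gt0 : forall k, 0 < b k.
Let J (s t : R) := \prod_(jump_count tk s <= k < jump_count tk t) (b k)^-1.

Lemma fsbig_impulses (s t : R) (F : nat -> R) :
  \big[*%R/1]_(k \in [set k | s <= tk k < t]) F k =
  \prod_(jump_count tk s <= k < jump_count tk t) F k.
Proof.
have -> : [set k | s <= tk k < t] =
    [set` index_iota (jump_count tk s) (jump_count tk t)].
  apply/seteqP; split=> k /=; rewrite mem_index_iota jump_countP jump_count_leP//.
by rewrite -fsbig_seq ?iota_uniq.
Qed.

Let maxb k := Num.max 1 (b k)^-1.

Lemma impulse_prod_le (s t N : R) : t <= N ->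
  J s t <= \prod_(k < jump_count tk N) maxb k.
Proof.
move=> tN; rewrite /J big_geq_mkord (big_ord_widen_cond _ (fun k => _ <= k)%N
  (fun k => (b k)^-1) (jump_count_le tN)) big_mkcond/=.
apply: ler_prod => k _; case: ifP => _; rewrite /maxb ?le_max ?lexx ?orbT ?andbT//.
by rewrite invr_ge0 ltW.
Qed.

Variable tau : R -> R.
Hypothesis tau_ge0 : forall t : R, 0 <= t -> 0 <= tau t.

Lemma Bmax_has_ubound (t : R) : has_ubound
  [set \big[*%R/1]_(k \in [set k | t + theta <= tk k < t]) (b k)^-1
      | theta in `[- tau t, 0]].
Proof.
exists (\prod_(k < jump_count tk t) maxb k) => _ [th _ <-].
by rewrite fsbig_impulses; exact: impulse_prod_le.
Qed.

Lemma le_Bmax (s t : R) : t - tau t <= s <= t -> J s t <= Bmax tk b tau t.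
Proof.
move=> st; apply: ub_le_sup; first exact: Bmax_has_ubound.
exists (s - t); first by rewrite /= in_itv/=; lra.
by rewrite fsbig_impulses addrC subrK.
Qed.

Lemma Bmax_ge1 (t : R) : 0 <= t -> 1 <= Bmax tk b tau t.
Proof.
move=> t0; have tt := tau_ge0 t0.
have -> : 1 = J t t by rewrite /J big_geq.
by apply: le_Bmax; lra.
Qed.

Lemma Bmax_le (t N : R) : 0 <= t <= N ->
  Bmax tk b tau t <= \prod_(k < jump_count tk N) maxb k.
Proof.
move=> /andP[t0 tN]; have tt := tau_ge0 t0; apply: sup_le_ub.
  by eexists; exists 0; [rewrite /= in_itv/=; lra|reflexivity].
by move=> _ [th _ <-]; rewrite fsbig_impulses; exact: impulse_prod_le.
Qed.

Let term K j t := if t - tau t <= tk j then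
  \prod_(k < K) (if tk k < t then (if (j <= k)%N then (b k)^-1 else 1) else 1) else 1.

Let termE K j t : (jump_count tk t <= K)%N ->
  \prod_(k < K) (if tk k < t then (if (j <= k)%N then (b k)^-1 else 1) else 1) =
  \prod_(j <= k < jump_count tk t) (b k)^-1.
Proof.
move=> tK; rewrite big_geq_mkord (big_ord_widen_cond _ (fun k => _ <= k)%N
  (fun k => (b k)^-1) tK) [RHS]big_mkcond/=.
by apply: eq_bigr => k _; rewrite jump_countP; case: ltP; case: leqP.
Qed.

(** On [0, N] the supremum is a maximum over finitely many left ends: the product
    changes only when t + theta crosses an impulse time.  Each candidate is a step
    function of t, which gives measurability. *)
Lemma Bmax_bigmax (t N : R) : 0 <= t <= N ->
  Bmax tk b tau t = \big[Num.max/1]_(j < jump_count tk N) term (jump_count tk N) j t.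
Proof.
move=> /andP[t0 tN]; have tt := tau_ge0 t0.
have tK := jump_count_le tN.
apply/eqP; rewrite eq_le; apply/andP; split.
  apply: sup_le_ub.
    by eexists; exists 0; [rewrite /= in_itv/=; lra|reflexivity].
  move=> _ [th + <-]; rewrite /= in_itv/= => thI; rewrite fsbig_impulses.
  have [jt|tj] := ltnP (jump_count tk (t + th)) (jump_count tk t); last first.
    by rewrite big_geq//; exact: bigmax_ge_id.
  have jK : (jump_count tk (t + th) < jump_count tk N)%N by apply: leq_trans tK.
  apply: (@bigmax_sup _ _ _ _ (Ordinal jK)) => //=.
  rewrite /term termE//; case: ifPn => // /negP[].
  have : t + th <= tk (jump_count tk (t + th)) by rewrite -jump_count_leP.
  lra.
apply: bigmax_le => [|j _]; first exact: Bmax_ge1.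
rewrite /term; case: ifP => h; last exact: Bmax_ge1.
rewrite termE//; have [tj|tj] := leP t (tk j).
  by rewrite big_geq ?Bmax_ge1// jump_count_leP.
rewrite -{1}[nat_of_ord j]jump_count_impulse.
by apply: le_Bmax; rewrite h ltW.
Qed.

Hypothesis tau_cont : {within `[0, +oo[, continuous tau}.

Lemma Bmax_measurable (N : R) : measurable_fun `[0, N] (Bmax tk b tau).
Proof.
have mt : measurable_fun `[0, N] tau.
  apply: subspace_continuous_measurable_fun => //.
  apply: continuous_subspaceW tau_cont => x; rewrite /= !in_itv/= andbT.
  by move=> /andP[].
apply: (@eq_measurable_fun _ _ _ _ _
  (fun t => \big[Num.max/1]_(j < jump_count tk N) term (jump_count tk N) j t)).
  by move=> t; rewrite inE/= in_itv/= => tN; rewrite (Bmax_bigmax tN).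
apply: measurable_bigmax => j; apply: measurable_fun_if_in => //.
  by apply: measurable_fun_ler => //; exact: measurable_funB.
apply: measurable_prod => k _; apply: measurable_fun_if_in => //.
exact: measurable_fun_ltr.
Qed.

End impulse_times.

(** One-sided limits bound g near each point; the set of those r for which g is
    bounded on [al, r] is then closed and open in [al, be]. *)
Lemma one_sided_limits_bounded (R : realType) (al be : R) (g : R -> R) :
    (forall t, al < t <= be -> cvg (g u @[u --> t^'-])) ->
    (forall t, al <= t < be -> cvg (g u @[u --> t^'+])) ->
  exists2 C, 0 <= C & forall t, al <= t <= be -> `|g t| <= C.
Proof.
move=> gl gr.
have loc t : al <= t <= be -> exists C, exists2 d, 0 < d &
    forall s, al <= s <= be -> `|s - t| < d -> `|g s| <= C.
  move=> /andP[alt tbe].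
  have [C1 [d1 d10 H1]] : exists C, exists2 d, 0 < d &
      forall s, al <= s <= be -> t - d < s < t -> `|g s| <= C.
    have [alt'|tal] := ltP al t; last by exists 0, 1 => // s; lra.
    have tI : al < t <= be by lra.
    have /cvg_ex[l /cvgrPdist_lt/(_ 1 ltr01)] := gl t tI.
    rewrite near_withinE => /nbhs_ballP[d /= d0 dP].
    exists (`|l| + 1), d => // s _ /andP[ts st].
    have := dP s; rewrite /ball/= gtr0_norm; last lra.
    have h : t - s < d by lra.
    move=> /(_ h st) h'; have := ler_normB l (l - g s).
    by rewrite opprB addrC subrK; lra.
  have [C2 [d2 d20 H2]] : exists C, exists2 d, 0 < d &
      forall s, al <= s <= be -> t < s < t + d -> `|g s| <= C.
    have [tbe'|bet] := ltP t be; last by exists 0, 1 => // s; lra.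
    have tI : al <= t < be by lra.
    have /cvg_ex[l /cvgrPdist_lt/(_ 1 ltr01)] := gr t tI.
    rewrite near_withinE => /nbhs_ballP[d /= d0 dP].
    exists (`|l| + 1), d => // s _ /andP[ts st].
    have := dP s; rewrite /ball/= ltr0_norm; last lra.
    have h : - (t - s) < d by lra.
    move=> /(_ h ts) h'; have := ler_normB l (l - g s).
    by rewrite opprB addrC subrK; lra.
  exists (Num.max `|g t| (Num.max C1 C2)), (Num.min d1 d2).
    by rewrite lt_min d10.
  move=> s sI; rewrite lt_min ltr_norml !ltr_norml => /andP[h1 h2].
  rewrite !le_max; case: (ltgtP s t) => [st|st|->]; last by rewrite lexx.
    by rewrite H1 ?orbT//; lra.
  by rewrite H2 ?orbT//; lra.
have [albe|] := leP al be; last by exists 0 => // t; lra.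
pose S := [set r | al <= r <= be /\
  exists2 C, 0 <= C & forall t, al <= t <= r -> `|g t| <= C].
have Sal : S al.
  split; first lra.
  exists `|g al| => // t tal; rewrite (_ : t = al)//; lra.
have hS : has_sup S by split; [exists al|exists be => r [/andP[]]].
pose r := sup S.
have alr : al <= r by apply: ub_le_sup => //; exact: hS.2.
have rbe : r <= be by apply: sup_le_ub; [exists al|move=> s [/andP[]]].
have [|C [d d0 CP]] := loc r; first by rewrite alr.
have [s [sI [C' C'0 C'P]] sd] := sup_adherent d0 hS.
have sr : s <= r by apply: ub_le_sup; [exact: hS.2|split => //; exists C'].
pose r' := Num.min be (r + d / 2).
have r'be : r' <= be by rewrite ge_min lexx.
have r'r : r' <= r + d / 2 by rewrite ge_min lexx orbT.
have rr' : r <= r' by rewrite le_min rbe; lra.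
have Sr' : S r'.
  split; first lra.
  exists (Num.max C' C) => [|t tr']; first by rewrite le_max C'0.
  rewrite le_max; have [ts|st] := leP t s; first by rewrite C'P//; lra.
  rewrite CP ?orbT//; first lra.
  by rewrite ltr_norml; apply/andP; split; rewrite -/r in sd; lra.
have r'S : r' <= r by apply: ub_le_sup => //; exact: hS.2.
have r'E : r' = be.
  by move: r'S; rewrite /r'; case: (leP be (r + d / 2)) => // h1 h2; lra.
case: Sr' => _ [C0 C00 C0P]; exists C0 => // t tI.
by apply: C0P; rewrite r'E.
Qed.

Lemma piecewise_continuous_bounded (R : realType) (al be : R) (g : R -> R) :
  piecewise_continuous_on al be g ->
  exists2 C, 0 <= C & forall t, al <= t <= be -> `|g t| <= C.
Proof. by move=> [s [_ gl gr]]; exact: one_sided_limits_bounded. Qed.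

Lemma piecewise_continuous_measurable (R : realType) (al be : R) (g : R -> R) :
  piecewise_continuous_on al be g -> measurable_fun `[al, be] g.
Proof.
move=> [s [gs _ _]].
have fin_meas (r : seq R) : measurable ([set` r] : set R).
  apply: countable_measurable; first by move=> x; exact: measurable_set1.
  exact/finite_set_countable/finite_seq.
have ms := fin_meas s.
rewrite -(setUIDK `[al, be] [set` s]); apply/measurable_funU => //.
- exact: measurableI.
- exact: measurableD.
split.
  have : finite_set (`[al, be] `&` [set` s]) by apply: finite_setIr; exact: finite_seq.
  move=> /finite_seqP[r rE]; rewrite rE.
  move: r {rE}; elim => [|x r IH].
    by rewrite set_nil; exact: measurable_fun_set0.
  rewrite (_ : [set` x :: r] = [set x] `|` [set` r]).
    by apply/measurable_funU => //; split => //; exact: measurable_fun_set1.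
  apply/seteqP; split=> z /=; rewrite inE; first by case/predU1P; [left|right].
  by case=> [->|zr]; rewrite ?eqxx// zr orbT.
apply: subspace_continuous_measurable_fun; first exact: measurableD.
apply/subspace_continuousP => t [/= ]; rewrite in_itv/= => tI /negP ts.
apply: cvg_trans (gs t tI ts); apply: cvg_app.
by apply: within_subset => // r [].
Qed.

(** * The maximal delay and the gains *)

Section max_delay.
Variables (R : realType) (n : nat) (tau : 'I_n -> R -> R).

Lemma le_max_delay i t : tau i t <= max_delay tau t.
Proof. exact: (le_bigmax _ (fun i => tau i t)). Qed.

Lemma max_delay_ge0 t : 0 <= max_delay tau t.
Proof. exact: bigmax_ge_id. Qed.

Lemma max_delay_mono (s t : R) :
  (forall i, s - tau i s <= t - tau i t) -> s <= t ->
  s - max_delay tau s <= t - max_delay tau t.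
Proof.
move=> h st; rewrite lerBrDr addrAC -lerBrDr opprK.
suff : max_delay tau t <= t - s + max_delay tau s by lra.
apply: bigmax_le => [|i _]; first by have := max_delay_ge0 s; lra.
by have := h i; have := le_max_delay i s; lra.
Qed.

Lemma max_delay_infty :
  (forall i, (t - tau i t) @[t --> +oo] --> +oo) ->
  forall M : R, exists S : R, forall t, S <= t -> M <= t - max_delay tau t.
Proof.
move=> ti M.
have Hi i : exists S, forall t, S <= t -> M <= t - tau i t.
  have /cvgryPge/(_ M)[S [_ SP]] := ti i.
  by exists (S + 1) => t St; apply: SP; lra.
have [S SP] := choice Hi.
exists (\big[Num.max/M]_(i < n) S i) => t St.
have tM : M <= t by apply: le_trans St; exact: bigmax_ge_id.
suff : max_delay tau t <= t - M by lra.
apply: bigmax_le => [|i _]; first lra.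
suff : M <= t - tau i t by lra.
apply: SP; apply: le_trans St; exact: (le_bigmax _ S).
Qed.

End max_delay.

Section gains.
Variables (R : realType) (n : nat) (tau lam : 'I_n -> R -> R) (tk b : nat -> R).
Hypothesis tau_ge0 : forall i (t : R), 0 <= t -> 0 <= tau i t.
Hypothesis tau_cont : forall i, {within `[0, +oo[, continuous (tau i)}.
Hypothesis tk_incr : forall k, tk k < tk k.+1.
Hypothesis tk_infty : tk k @[k --> \oo] --> +oo.
Hypothesis b_gt0 : forall k, 0 < b k.
Hypothesis lam_ge0 : forall i (t : R), 0 <= t -> 0 <= lam i t.
Hypothesis lam_pc : forall i, piecewise_continuous_pos (lam i).

(** The sum g_j of lambda_(j,i) B_i: the strength with which a bound on y over
    the delay window forces y. *)
Definition gain (s : R) : R := \sum_(i < n) lam i s * Bmax tk b (tau i) s.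

Lemma gain_admissible : admissible_gain gain.
Proof.
have B0 i (t : R) : 0 <= t -> 0 <= Bmax tk b (tau i) t.
  move=> t0; apply: le_trans ler01 _.
  exact: (Bmax_ge1 tk_incr tk_infty b_gt0 (@tau_ge0 i)).
split=> [t t0|N|N].
- by apply: sumr_ge0 => i _; rewrite mulr_ge0 ?B0 ?lam_ge0.
- have N'0 : 0 < Num.max 1 N by rewrite lt_max ltr01.
  have sub : `[0, N] `<=` `[0, Num.max 1 N].
    by apply: subset_itvl; rewrite bnd_simp le_max lexx orbT.
  apply: (measurable_funS _ sub) => //; apply: measurable_sum => i; apply: measurable_funM.
    by apply: piecewise_continuous_measurable; exact: lam_pc.
  exact: (Bmax_measurable tk_incr tk_infty b_gt0 (@tau_ge0 i) (@tau_cont i)).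

- pose N' := Num.max 1 N.
  have N'0 : 0 < N' by rewrite lt_max ltr01.
  have Ci i : exists C, forall t : R, 0 <= t <= N -> lam i t * Bmax tk b (tau i) t <= C.
    have [C C0 CP] := piecewise_continuous_bounded (lam_pc i N'0).
    eexists => t tN.
    have tN' : 0 <= t <= N' by rewrite le_max; lra.
    have t0 : 0 <= t by lra.
    apply: ler_pM; [exact: lam_ge0|exact: B0| |].
      exact: le_trans (ler_norm _) (CP t tN').
    exact: (Bmax_le tk_incr tk_infty b_gt0 (@tau_ge0 i) tN).
  have [C CP] := choice Ci.
  exists (\sum_i C i) => t tN; apply: ler_sum => i _; exact: CP.
Qed.

Variables (a : R -> R) (T : R).

Lemma alpha_gain_bound : alpha tk b a tau lam T \is a fin_num ->
  (forall t, T <= t -> 0 <= t - max_delay tau t) ->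
  gain_bound a (max_delay tau) gain T (fine (alpha tk b a tau lam T)).
Proof.
move=> fa Tt t tT.
have [g0 _ _] := gain_admissible.
set I := (X in X <= _).
have IE : I = fine (\int[@lebesgue_measure R]_(s in `[(t - max_delay tau t)%R, t])
           (alpha_integrand tk b a tau lam t s)%:E)%E.
  congr fine; apply: eq_integral => s _; congr EFin.
  rewrite /alpha_integrand /gain big_distrr/=; apply: eq_bigr => i _; ring.
rewrite IE; set J := (\int[_]_(_ in _) _)%E.
have Ja : (J <= alpha tk b a tau lam T)%E by apply: ereal_sup_ubound; exists t.
have J0 : (0 <= J)%E.
  apply: integral_ge0 => s; rewrite /= in_itv/= => /andP[s1 _].
  have s0 : 0 <= s by have := Tt t tT; lra.
  rewrite lee_fin; apply: sumr_ge0 => i _; rewrite !mulr_ge0 ?expR_ge0 ?lam_ge0//.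
  apply: le_trans ler01 _.
  exact: (Bmax_ge1 tk_incr tk_infty b_gt0 (@tau_ge0 i)).
apply: fine_le => //.
rewrite ge0_fin_numE//; apply: (le_lt_trans Ja).
by rewrite -ge0_fin_numE//; exact: le_trans Ja.
Qed.

End gains.

(** * One-sided limits *)

Section one_sided_limits.
Variable R : realType.
Implicit Types (g h : R -> R) (t l : R).

Definition left_lim g t l : Prop := forall e : R, 0 < e -> exists2 d : R, 0 < d &
  forall u, t - d < u < t -> `|g u - l| < e.

Definition right_lim g t l : Prop := forall e : R, 0 < e -> exists2 d : R, 0 < d &
  forall u, t < u < t + d -> `|g u - l| < e.

Lemma left_limP g t l : g u @[u --> t^'-] --> l <-> left_lim g t l.
Proof.
split=> [/cvgrPdist_lt gl e e0|gl].
  have := gl e e0; rewrite near_withinE => /nbhs_ballP[d /= d0 dP].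
  exists d => // u /andP[tu ut]; rewrite distrC; apply: dP => //.
  by rewrite /ball/= gtr0_norm; lra.
apply/cvgrPdist_lt => e e0; have [d d0 dP] := gl e e0.
rewrite near_withinE; apply/nbhs_ballP; exists d => // u; rewrite /ball/= => ut ut'.
by rewrite distrC; apply: dP; move: ut; rewrite gtr0_norm; lra.
Qed.

Lemma right_limP g t l : g u @[u --> t^'+] --> l <-> right_lim g t l.
Proof.
split=> [/cvgrPdist_lt gl e e0|gl].
  have := gl e e0; rewrite near_withinE => /nbhs_ballP[d /= d0 dP].
  exists d => // u /andP[tu ut]; rewrite distrC; apply: dP => //.
  by rewrite /ball/= ltr0_norm; lra.
apply/cvgrPdist_lt => e e0; have [d d0 dP] := gl e e0.
rewrite near_withinE; apply/nbhs_ballP; exists d => // u; rewrite /ball/= => ut ut'.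
by rewrite distrC; apply: dP; move: ut; rewrite ltr0_norm; lra.
Qed.

Lemma left_lim_eq g h t l r : r < t -> (forall u, r < u -> u < t -> g u = h u) ->
  left_lim h t l -> left_lim g t l.
Proof.
move=> rt gh hl e /hl[d d0 dP]; exists (Num.min d (t - r)).
  by rewrite lt_min d0 subr_gt0.
move=> u /andP[tu ut]; have := ge_min d d (t - r); have := ge_min (t - r) d (t - r).
rewrite !lexx orbT /= => /esym m1 /esym m2.
by rewrite gh ?dP//; lra.
Qed.

Lemma right_lim_eq g h t l r : t < r -> (forall u, t < u -> u < r -> g u = h u) ->
  right_lim h t l -> right_lim g t l.
Proof.
move=> rt gh hl e /hl[d d0 dP]; exists (Num.min d (r - t)).
  by rewrite lt_min d0 subr_gt0.
move=> u /andP[tu ut]; have := ge_min d d (r - t); have := ge_min (r - t) d (r - t).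
rewrite !lexx orbT /= => /esym m1 /esym m2.
by rewrite gh ?dP//; lra.
Qed.

Lemma left_lim_shift g s t l : left_lim g (s + t) l -> left_lim (fun u => g (s + u)) t l.
Proof. by move=> gl e /gl[d d0 dP]; exists d => // u ut; apply: dP; lra. Qed.

Lemma right_lim_shift g s t l : right_lim g (s + t) l -> right_lim (fun u => g (s + u)) t l.
Proof. by move=> gl e /gl[d d0 dP]; exists d => // u ut; apply: dP; lra. Qed.

Lemma left_lim_cst (c t : R) : left_lim (fun=> c) t c.
Proof. by move=> e e0; exists 1 => // u _; rewrite subrr normr0. Qed.

Lemma right_lim_cst (c t : R) : right_lim (fun=> c) t c.
Proof. by move=> e e0; exists 1 => // u _; rewrite subrr normr0. Qed.

Lemma within_itv_one_sided (p q : R) g :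
  (forall t, p < t <= q -> left_lim g t (g t)) ->
  (forall t, p <= t < q -> right_lim g t (g t)) ->
  {within `[p, q], continuous g}.
Proof.
move=> gl gr; apply/within_itvP => t tpq e e0.
have [d1 d10 H1] : exists2 d, 0 < d & forall u, p <= u -> t - d < u < t -> `|g u - g t| < e.
  have [pt|tp] := ltP p t; last by exists 1 => // u; lra.
  have [|d d0 dP] := gl t _ e e0; first lra.
  by exists d => // u _; exact: dP.
have [d2 d20 H2] : exists2 d, 0 < d & forall u, u <= q -> t < u < t + d -> `|g u - g t| < e.
  have [pt|tp] := ltP t q; last by exists 1 => // u; lra.
  have [|d d0 dP] := gr t _ e e0; first lra.
  by exists d => // u _; exact: dP.
exists (Num.min d1 d2); first by rewrite lt_min d10.
move=> s spq; rewrite lt_min => /andP[]; rewrite !(ltr_norml (s - t)) => h1 h2.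
case: (ltgtP s t) => [st|st|->]; last by rewrite subrr normr0.
  by apply: H1; lra.
by apply: H2; lra.
Qed.

(** Left continuity makes two-sided continuity within [al, be] a matter of the
    right limits alone. *)
Lemma PC_onI (s : seq R) (al be : R) g :
  (forall t, al < t <= be -> left_lim g t (g t)) ->
  (forall t, al <= t < be -> exists l, right_lim g t l) ->
  (forall t, al <= t < be -> t \notin s -> right_lim g t (g t)) ->
  PC_on al be g.
Proof.
move=> gl gr gs; split; last by move=> t /gl/left_limP.
exists s; split.
- move=> t tI ts; apply/cvgrPdist_lt => e e0.
  have [d1 d10 H1] : exists2 d, 0 < d & forall u, al <= u -> t - d < u < t -> `|g u - g t| < e.
    have [pt|tp] := ltP al t; last by exists 1 => // u; lra.
    have [|d d0 dP] := gl t _ e e0; first lra.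
    by exists d => // u _; exact: dP.
  have [d2 d20 H2] : exists2 d, 0 < d & forall u, u <= be -> t < u < t + d -> `|g u - g t| < e.
    have [pt|tp] := ltP t be; last by exists 1 => // u; lra.
    have [||d d0 dP] := gs t _ _ e e0 => //; first lra.
    by exists d => // u _; exact: dP.
  rewrite near_withinE; apply/nbhs_ballP; exists (Num.min d1 d2).
    by rewrite /= lt_min d10.
  move=> u; rewrite /ball/= lt_min in_itv/= => /andP[].
  rewrite !(ltr_norml (t - u)) => h1 h2 uI.
  rewrite distrC; case: (ltgtP u t) => [st|st|->]; last by rewrite subrr normr0.
    by apply: H1; lra.
  by apply: H2; lra.
- by move=> t /gl/left_limP tI; apply/cvg_ex; exists (g t).
- by move=> t /gr[l /right_limP gl']; apply/cvg_ex; exists l.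
Qed.

Lemma PC_onE (al be : R) g : PC_on al be g -> exists s : seq R,
  [/\ forall t, al < t <= be -> left_lim g t (g t),
      forall t, al <= t < be -> exists l, right_lim g t l &
      forall t, al <= t < be -> t \notin s -> right_lim g t (g t)].
Proof.
move=> [[s [gs _ gr]] gl]; exists s; split.
- by move=> t /gl/left_limP.
- by move=> t /gr/cvg_ex[l /right_limP]; exists l.
move=> t tI ts e e0.
have tI' : al <= t <= be by lra.
have /cvgrPdist_lt/(_ _ e0) := gs t tI' ts.
rewrite near_withinE => /nbhs_ballP[d /= d0 dP].
exists (Num.min d (be - t)); first by rewrite lt_min d0; lra.
move=> u /andP[tu]; rewrite -ltrBlDl lt_min => /andP[ud ub].
rewrite distrC; apply: dP; first by rewrite /ball/= ltr0_norm; lra.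
by rewrite in_itv/=; lra.
Qed.

End one_sided_limits.

(** * Segments of solutions and bounds on the right-hand side *)

Section regular_functions.
Variable R : realType.
Implicit Types (g h x phi : R -> R) (t c B : R).

(** A function that is piecewise continuous and left continuous on ]-oo, B], with
    the points of discontinuity in the finite list s. *)
Definition regular_below B (s : seq R) g : Prop :=
  [/\ forall t, t <= B -> left_lim g t (g t),
      forall t, t < B -> exists l, right_lim g t l &
      forall t, t < B -> t \notin s -> right_lim g t (g t)].

Lemma regular_below_PC B s g al be : regular_below B s g -> be <= B -> PC_on al be g.
Proof.
move=> [gl gr gs] beB; apply: (@PC_onI _ s) => t tI.
- by apply: gl; lra.
- by apply: gr; lra.
- by apply: gs; lra.
Qed.

(** Cutting at c with the value at c taken from the left piece preserves left
    continuity, at the expense of one possible discontinuity at c. *)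
Definition glue c g h (u : R) : R := if u <= c then g u else h u.

Lemma glue_left_lim c g h t : (t <= c -> left_lim g t (g t)) ->
  (c < t -> left_lim h t (h t)) -> left_lim (glue c g h) t (glue c g h t).
Proof.
move=> gl hl; rewrite {2}/glue; case: (leP t c) => tc.
  apply: (@left_lim_eq _ _ g _ _ (t - 1)) (gl tc) => [|u _ ut]; first lra.
  by rewrite /glue ifT//; lra.
apply: (@left_lim_eq _ _ h _ _ c) (hl tc) => // u cu _.
by rewrite /glue leNgt cu.
Qed.

Lemma glue_right_lim1 c g h t l : t < c -> right_lim g t l -> right_lim (glue c g h) t l.
Proof.
by move=> tc; apply: (@right_lim_eq _ _ _ _ _ c) => // u tu uc; rewrite /glue ltW.
Qed.

Lemma glue_right_lim2 c g h t l : c <= t -> right_lim h t l -> right_lim (glue c g h) t l.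
Proof.
move=> ct; apply: (@right_lim_eq _ _ _ _ _ (t + 1)) => [|u tu _]; first lra.
by rewrite /glue ifF//; apply/negbTE; rewrite -ltNge; lra.
Qed.

Lemma glue_regular c B g h (sg sh : seq R) : c <= B ->
    (forall t, t <= c -> left_lim g t (g t)) ->
    (forall t, t < c -> exists l, right_lim g t l) ->
    (forall t, t < c -> t \notin sg -> right_lim g t (g t)) ->
    (forall t, c < t <= B -> left_lim h t (h t)) ->
    (forall t, c <= t < B -> exists l, right_lim h t l) ->
    (forall t, c < t < B -> t \notin sh -> right_lim h t (h t)) ->
  regular_below B (c :: sg ++ sh) (glue c g h).
Proof.
move=> cB gl gr gs hl hr hs; split=> t tB.
- by apply: glue_left_lim => [/gl|ct]//; apply: hl; rewrite ct.
- have [tc|ct] := ltP t c.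
    by have [l lP] := gr t tc; exists l; exact: glue_right_lim1.
  by have [|l lP] := hr t; [rewrite ct|exists l; exact: glue_right_lim2].
- rewrite inE mem_cat !negb_or => /and3P[tc tg th].
  rewrite {2}/glue; case: (ltgtP t c) => // [ltc|gtc|tcE].
  + by apply: glue_right_lim1 => //; exact: gs.
  + by apply: glue_right_lim2; [exact: ltW|apply: hs => //; rewrite gtc].
  + by rewrite tcE eqxx in tc.
Qed.

Lemma regular_below_BPC s g M : regular_below 0 s g ->
  (forall t, t <= 0 -> `|g t| <= M) -> BPC g.
Proof.
move=> rg gM; split; last by exists M.
move=> al be albe be0 e e0; exists g; first exact: (regular_below_PC _ rg be0).
by move=> t _; rewrite subrr normr0.
Qed.

Lemma BPC_approx phi : (forall e, 0 < e -> exists psi s,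
      regular_below 0 s psi /\ forall t, t <= 0 -> `|psi t - phi t| < e) ->
    (exists M, forall t, t <= 0 -> `|phi t| <= M) -> BPC phi.
Proof.
move=> ap bd; split => // al be albe be0 e e0.
have [psi [s [rp pe]]] := ap e e0.
exists psi; first exact: (regular_below_PC _ rp be0).
by move=> t tI; rewrite distrC; apply: pe; lra.
Qed.

Lemma BPC_le_norm phi t : BPC phi -> t <= 0 -> `|phi t| <= normBPC phi.
Proof.
move=> [_ [M MP]] t0; apply: ub_le_sup; last by exists t.
by exists M => _ [s s0 <-]; exact: MP.
Qed.

Lemma normBPC_le phi e : (forall t, t <= 0 -> `|phi t| <= e) -> normBPC phi <= e.
Proof.
move=> pe; apply: sup_le_ub; first by exists `|phi 0|; exists 0 => //=.
by move=> _ [s s0 <-]; exact: pe.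
Qed.

(** The segment x_t, truncated beyond its delay window, is a uniform limit of
    piecewise continuous functions: before t0 the history phi is replaced by an
    approximation, after t0 the solution is piecewise continuous itself.  The
    truncation makes the function bounded on ]-oo, 0] and uses phi on a compact
    interval only. *)
Lemma segment_approx (x phi : R -> R) (t0 t L : R) (sx : seq R) : t0 <= t -> 0 < L ->
    BPC phi -> (forall s, s <= 0 -> x (t0 + s) = phi s) ->
    (forall u, t0 < u -> left_lim x u (x u)) ->
    (forall u, t0 <= u -> exists l, right_lim x u l) ->
    (forall u, t0 <= u < t -> u \notin sx -> right_lim x u (x u)) ->
  let phi' := glue (- (t - t0 + L)) (fun=> 0) (segment x t) in
  forall e, 0 < e -> exists psi s,
    regular_below 0 s psi /\ forall th, th <= 0 -> `|psi th - phi' th| < e.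
Proof.
move=> t0t L0 [phiPC _] xphi xl xr xs phi' e e0.
have mL0 : - L <= 0 by lra.
have [psi0 pPC pe] := phiPC _ _ mL0 (lexx 0) e e0.
have [s0 [pl pr ps]] := PC_onE pPC.
pose d := t - t0.
pose psi1 th := psi0 (d + th).
pose r := - (d + L).
pose late := glue (- d) psi1 (segment x t).
pose psi := glue r (fun=> 0) late.
exists psi; eexists; split.
  apply: (@glue_regular r 0 _ _ [::] (- d :: map (fun u => u - d) s0 ++ map (fun u => u - t) sx)).
  - rewrite /r /d; lra.
  - by move=> th _; exact: left_lim_cst.
  - by move=> th _; exists 0; exact: right_lim_cst.
  - by move=> th _ _; exact: right_lim_cst.
  - move=> th thI; apply: glue_left_lim => h.
      by apply: left_lim_shift; apply: pl; rewrite /r /d in thI h *; lra.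
    by apply: left_lim_shift; apply: xl; rewrite /d in h; lra.
  - move=> th thI; have [h|h] := ltP th (- d).
      have [|l lP] := pr (d + th); first by rewrite /r /d in thI h *; lra.
      by exists l; apply: glue_right_lim1 => //; exact: right_lim_shift.
    have [|l lP] := xr (t + th); first by rewrite /d in h; lra.
    by exists l; apply: glue_right_lim2 => //; exact: right_lim_shift.
  - move=> th thI; rewrite inE mem_cat !negb_or => /and3P[hd h0 hx].
    rewrite {2}/late /glue; case: (ltgtP th (- d)) => [h|h|h].
    + apply: glue_right_lim1 => //; apply: right_lim_shift; apply: ps.
        by rewrite /r /d in thI h *; lra.
      apply: contra h0 => h0; apply/mapP; exists (d + th) => //; lra.
    + apply: glue_right_lim2; first exact: ltW.
      apply: right_lim_shift; apply: xs; first by rewrite /d in h; lra.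
      apply: contra hx => hx; apply/mapP; exists (t + th) => //; lra.
    + by rewrite h eqxx in hd.
move=> th th0; rewrite /psi /phi' /glue -/d -/r.
case: (leP th r) => hr; first by rewrite subrr normr0.
rewrite /late /glue; case: (leP th (- d)) => hd; last by rewrite subrr normr0.
rewrite /psi1 /segment distrC.
have -> : t + th = t0 + (d + th) by rewrite /d; ring.
rewrite xphi; last lra.
by apply: pe; rewrite /r in hr; lra.
Qed.

End regular_functions.

Section rhs_bound.
Variables (R : realType) (n : nat) (tau lam1 lam2 : 'I_n -> R -> R).
Variable f_ : 'I_n -> R -> (R -> R) -> R.
Hypothesis tau_ge0 : forall i (t : R), 0 <= t -> 0 <= tau i t.
Hypothesis f_local : history_local tau f_.
Hypothesis lam1_ge0 : forall i (t : R), 0 <= t -> 0 <= lam1 i t.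
Hypothesis lam2_ge0 : forall i (t : R), 0 <= t -> 0 <= lam2 i t.
Hypothesis f_bounds : forall i (t : R) phi, 0 <= t -> PC_on (- tau i t) 0 phi ->
     - lam1 i t * Msup (tau i t) phi <= f_ i t phi /\
     f_ i t phi <= lam2 i t * Msup (tau i t) (\- phi).

Lemma Msup_le (r : R) (phi : R -> R) (W : R) : 0 <= r -> 0 <= W ->
  (forall th, - r <= th <= 0 -> phi th <= W) -> Msup r phi <= W.
Proof.
move=> r0 W0 pW; rewrite /Msup ge_max W0/=; apply: sup_le_ub.
  by exists (phi 0); exists 0 => //=; rewrite in_itv/=; lra.
by move=> _ [th + <-]; rewrite /= in_itv/=; exact: pW.
Qed.

Lemma rhs_le_PC (t : R) (phi : R -> R) (W : 'I_n -> R) : 0 <= t ->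
    (forall i, PC_on (- tau i t) 0 phi) -> (forall i, 0 <= W i) ->
    (forall i th, - tau i t <= th <= 0 -> - W i <= phi th) ->
  total_rhs f_ t phi <= \sum_i lam2 i t * W i.
Proof.
move=> t0 pc W0 pW; apply: ler_sum => i _.
have [_ h] := f_bounds t0 (pc i); apply: (le_trans h).
rewrite ler_wpM2l ?lam2_ge0// Msup_le ?tau_ge0// => th thI.
by rewrite lerNl; exact: pW.
Qed.

Lemma rhs_ge_PC (t : R) (phi : R -> R) (W : 'I_n -> R) : 0 <= t ->
    (forall i, PC_on (- tau i t) 0 phi) -> (forall i, 0 <= W i) ->
    (forall i th, - tau i t <= th <= 0 -> phi th <= W i) ->
  - \sum_i lam1 i t * W i <= total_rhs f_ t phi.
Proof.
move=> t0 pc W0 pW; rewrite -sumrN; apply: ler_sum => i _.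
have [h _] := f_bounds t0 (pc i); apply: (le_trans _ h).
by rewrite mulNr lerN2 ler_wpM2l ?lam1_ge0// Msup_le ?tau_ge0// => th; exact: pW.
Qed.

Section approximable.
Variables (t : R) (phi : R -> R).
Hypothesis t_ge0 : 0 <= t.
Hypothesis phi_BPC : BPC phi.
Hypothesis phi_approx : forall e, 0 < e -> exists psi s,
    regular_below 0 s psi /\ forall th, th <= 0 -> `|psi th - phi th| < e.
Hypothesis F_cont : BPC_limit (total_rhs f_) `[0, +oo[ t phi (total_rhs f_ t phi).

(** Continuity of F at (t, phi) along BPC, in the form in which the bounds for
    piecewise continuous arguments can be transferred to phi. *)
Lemma rhs_approx (e : R) : 0 < e -> exists psi,
  [/\ forall al, PC_on al 0 psi, forall th, th <= 0 -> `|psi th - phi th| < e &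
      `|total_rhs f_ t psi - total_rhs f_ t phi| < e].
Proof.
move=> e0; have [d d0 dP] := F_cont e0.
pose eta := Num.min e (d / 2).
have eta0 : 0 < eta by rewrite lt_min e0; lra.
have [psi [s [rp pe]]] := phi_approx eta0.
exists psi; split.
- by move=> al; exact: (regular_below_PC _ rp (lexx 0)).
- by move=> th th0; apply: lt_le_trans (pe th th0) _; rewrite ge_min lexx.
- apply: dP; first by rewrite /= in_itv/= t_ge0.
  + have [_ [M MP]] := phi_BPC.
    apply: (@regular_below_BPC _ s _ (M + eta)) => // th th0.
    have -> : psi th = phi th + (psi th - phi th) by ring.
    by apply: (le_trans (ler_normD _ _)); rewrite lerD// ?MP// ltW// pe.
  + by rewrite subrr normr0.
  + apply: (@le_lt_trans _ _ (d / 2)); last lra.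
    apply: normBPC_le => th th0; apply: le_trans (ltW (pe th th0)) _.
    by rewrite ge_min lexx orbT.
Qed.

(** Only the sum of the f_i is continuous, so the bounds on the separate f_i are
    added before passing to the limit. *)
Lemma rhs_le (W : 'I_n -> R) : (forall i, 0 <= W i) ->
    (forall i th, - tau i t <= th <= 0 -> - W i <= phi th) ->
  total_rhs f_ t phi <= \sum_i lam2 i t * W i.
Proof.
move=> W0 pW; apply/ler_addgt0Pr => e e0.
pose K := \sum_i lam2 i t.
have K0 : 0 <= K by apply: sumr_ge0 => i _; exact: lam2_ge0.
(* An error e' in F and in each W i costs (K + 1) e' = e in total. *)
pose e' := e / (K + 1).
have e'0 : 0 < e' by rewrite divr_gt0//; lra.
have [psi [pc pe pF]] := rhs_approx e'0.
have : total_rhs f_ t psi <= \sum_i lam2 i t * (W i + e').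
  apply: rhs_le_PC => // [i|i th thI]; first by rewrite addr_ge0// ltW.
  have th0 : th <= 0 by lra.
  by have := pe th th0; have := pW i th thI; rewrite ltr_norml; lra.
under eq_bigr do rewrite mulrDr.
rewrite big_split/= -mulr_suml -/K => H.
have eE : K * e' + e' = e by rewrite /e'; field; lra.
by move: pF; rewrite ltr_norml => /andP[]; lra.
Qed.

Lemma rhs_ge (W : 'I_n -> R) : (forall i, 0 <= W i) ->
    (forall i th, - tau i t <= th <= 0 -> phi th <= W i) ->
  - \sum_i lam1 i t * W i <= total_rhs f_ t phi.
Proof.
move=> W0 pW; rewrite lerNl; apply/ler_addgt0Pr => e e0.
pose K := \sum_i lam1 i t.
have K0 : 0 <= K by apply: sumr_ge0 => i _; exact: lam1_ge0.
pose e' := e / (K + 1).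
have e'0 : 0 < e' by rewrite divr_gt0//; lra.
have [psi [pc pe pF]] := rhs_approx e'0.
have : - \sum_i lam1 i t * (W i + e') <= total_rhs f_ t psi.
  apply: rhs_ge_PC => // [i|i th thI]; first by rewrite addr_ge0// ltW.
  have th0 : th <= 0 by lra.
  by have := pe th th0; have := pW i th thI; rewrite ltr_norml; lra.
under eq_bigr do rewrite mulrDr.
rewrite big_split/= -mulr_suml -/K => H.
have eE : K * e' + e' = e by rewrite /e'; field; lra.
by move: pF; rewrite ltr_norml => /andP[]; lra.
Qed.

End approximable.
End rhs_bound.

(** * Left derivatives, limits and integrals at infinity *)

Lemma partial_prod_ratio (R : realType) (c : nat -> R) (m p : nat) : (m <= p)%N ->
  partial_prod c p = partial_prod c m * \prod_(m <= k < p) c k.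
Proof.
move=> mp; rewrite /partial_prod -(big_mkord xpredT c) -[in RHS](big_mkord xpredT c).
by rewrite (@big_cat_nat _ _ _ m).
Qed.

Lemma BPC_regular_limits (R : realType) (F : R -> (R -> R) -> R) :
  BPC_continuous F \/ BPC_piecewise_continuous F ->
  exists D : set R, (forall be, finite_set (D `&` `[0, be])) /\
    forall t phi, 0 <= t -> ~ D t -> BPC phi ->
      BPC_limit F `[0, +oo[ t phi (F t phi).
Proof.
case=> [cF|[D [fD cF _ _]]]; last by exists D.
exists set0; split; first by move=> be; rewrite set0I.
by move=> t phi t0 _; exact: cF.
Qed.

Lemma is_left_derive_eq (R : realType) (g h : R -> R) (t d r : R) : r < t ->
  (forall u, r < u -> u <= t -> g u = h u) ->
  is_left_derive h t d -> is_left_derive g t d.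
Proof.
move=> rt gh; apply: cvg_trans; apply: near_eq_cvg.
rewrite near_withinE; apply/nbhs_ballP; exists (t - r); first by rewrite /= subr_gt0.
move=> s; rewrite /ball/= sub0r normrN => sr s0.
rewrite ltr0_norm// in sr.
by rewrite !gh//; lra.
Qed.

Lemma is_left_derive_cst (R : realType) (c t : R) : is_left_derive (fun=> c) t 0.
Proof.
rewrite /is_left_derive; have -> : (fun h : R => h^-1 * (c - c)) = cst 0.
  by apply/funext => h; rewrite subrr mulr0.
exact: cvg_cst.
Qed.

Lemma is_left_deriveZ (R : realType) (c : R) (g : R -> R) (t d : R) :
  is_left_derive g t d -> is_left_derive (fun s => c * g s) t (c * d).
Proof.
move=> gd; have := is_left_deriveM (is_left_derive_cst c t) gd.
by rewrite mul0r addr0.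
Qed.

Import HBNNSimple.

(** The integral of a nonnegative function is the supremum over the simple
    functions below it; no measurability of f is involved. *)
Lemma integral_le_nnsfun (R : realType) (D : set R) (f : R -> \bar R) (K : \bar R) :
  (forall x, D x -> (0 <= f x)%E) ->
  (forall h : {nnsfun (measurableTypeR R) >-> R},
     (forall x, ((h x)%:E <= (f \_ D) x)%E) ->
     (\int[@lebesgue_measure R]_x (h x)%:E <= K)%E) ->
  (\int[@lebesgue_measure R]_(x in D) f x <= K)%E.
Proof.
move=> f0 hK; rewrite ge0_integralE//; apply: ge_ereal_sup => _ [h hf <-].
by rewrite -integralT_nnsfun; exact: hK.
Qed.

(** Monotone convergence along the intervals [0, n + 1]. *)
Lemma ge0_integral_exhaustion (R : realType) (f : R -> R) (K : R) :
  (forall x, 0 <= f x) -> measurable_fun setT f ->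
  (forall n : nat, (\int[@lebesgue_measure R]_(x in `[0%R, n.+1%:R]) (f x)%:E <= K%:E)%E) ->
  (\int[@lebesgue_measure R]_(x in `[0%R, +oo[) (f x)%:E <= K%:E)%E.
Proof.
move=> f0 mf fK; rewrite ge0_integral_ereal_sup//.
by apply: ge_ereal_sup => _ [n _ <-]; exact: fK.
Qed.

Lemma rate_integral_unbounded (R : realType) (a : R -> R) :
  (forall t : R, 0 <= t -> 0 <= a t) -> {within `[0, +oo[, continuous a} ->
  (\int[@lebesgue_measure R]_(u in `[0%R, +oo[) (a u)%:E = +oo)%E ->
  forall K, exists2 N : R, 0 <= N & K <= \int[@lebesgue_measure R]_(u in `[0, N]) a u.
Proof.
move=> a0 ca ainf K; apply: contrapT => /forall2NP nK.
have {}nK (N : R) : 0 <= N -> \int[@lebesgue_measure R]_(u in `[0, N]) a u <= K.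
  by move=> N0; case: (nK N) => // /negP; rewrite -ltNge => /ltW.
pose a' := a \_ `[0, +oo[%classic.
have a'E t : 0 <= t -> a' t = a t.
  by move=> t0; rewrite /a' patchE ifT// inE /= in_itv/= t0.
have a'0 t : 0 <= a' t.
  have -> : a' t = if t \in `[0, +oo[%classic then a t else 0 by [].
  by case: ifP => //; rewrite inE/= in_itv/= andbT; exact: a0.
have ma : measurable_fun setT a'.
  apply/(measurable_restrictT _ _).1 => //.
  exact: subspace_continuous_measurable_fun.
have : (\int[@lebesgue_measure R]_(x in `[0%R, +oo[) (a' x)%:E <= K%:E)%E.
  apply: ge0_integral_exhaustion => // m.
  have -> : (\int[@lebesgue_measure R]_(x in `[0%R, m.+1%:R]) (a' x)%:E =
      \int[@lebesgue_measure R]_(x in `[0%R, m.+1%:R]) (a x)%:E)%E.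
    by apply: eq_integral => u; rewrite inE/= in_itv/= => /andP[u0 _]; rewrite a'E.
  have int := rate_integrable ca m.+1%:R (lexx 0).
  rewrite -[leLHS]fineK; last exact: integrable_fin_num.
  by rewrite lee_fin; apply: nK.
have -> : (\int[@lebesgue_measure R]_(x in `[0%R, +oo[) (a' x)%:E =
    \int[@lebesgue_measure R]_(x in `[0%R, +oo[) (a x)%:E)%E.
  by apply: eq_integral => u; rewrite inE/= in_itv/= andbT => u0; rewrite a'E.
by rewrite ainf.
Qed.

Lemma nonincreasing_cvg_pinfty (R : realType) (v : R -> R) (p : R) :
  (forall r q, p <= r -> r <= q -> v q <= v r) -> (forall r, p <= r -> 0 <= v r) ->
  exists2 l : R, 0 <= l & v t @[t --> +oo] --> l.
Proof.
move=> vd v0; pose S := [set v r | r in [set r | p <= r]].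
have S0 : S !=set0 by exists (v p); exists p => //=.
have lS : lbound S 0 by move=> _ [r pr <-]; exact: v0.
have hS : has_inf S by split => //; exists 0.
exists (inf S); first exact: lb_le_inf.
apply/cvgrPdist_lt => e e0.
have [_ [r pr <-] ve] := inf_adherent e0 hS.
exists r; split; first exact: num_real.
move=> t /ltW rt /=; rewrite distrC ger0_norm.
  by rewrite ltrBlDl; apply: le_lt_trans ve; exact: vd.
rewrite subr_ge0; apply: ge_inf; first by exists 0.
by exists t => //=; exact: le_trans rt.
Qed.

Lemma is_left_derive_le0 (R : realType) (z : R -> R) (t d r : R) : r < t ->
  (forall u, r < u -> u < t -> z t <= z u) -> is_left_derive z t d -> d <= 0.
Proof.
move=> rt zt zd; rewrite leNgt; apply/negP => d0.
have d20 : 0 < d / 2 by lra.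
have [s s0 sP] := is_left_derive_upper (@is_left_deriveZ _ (-1) _ _ _ zd) d20.
pose h := Num.min (s / 2) ((t - r) / 2).
have h0 : 0 < h by rewrite lt_min; apply/andP; split; lra.
have hs : h <= s / 2 by rewrite ge_min lexx.
have hr : h <= (t - r) / 2 by rewrite ge_min lexx orbT.
have hI : 0 < h < s by lra.
have := sP h hI.
have h1 : r < t - h by lra.
have h2 : t - h < t by lra.
have := zt _ h1 h2.
have : 0 < d * h by rewrite mulr_gt0.
lra.
Qed.

(** Of the positive and negative parts, only the one that would have to be infinite
    matters, which also covers an indeterminate difference of two infinities. *)
Lemma integral_infty_sign (R : realType) (D : set R) (q : R -> R) (sg K : R) :
  sg = 1 \/ sg = -1 ->
  (\int[@lebesgue_measure R]_(s in D) (q s)%:E = (- sg)%:E * +oo)%E ->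
  (\int[@lebesgue_measure R]_(s in D) (Num.max 0 (- (sg * q s)))%:E <= K%:E)%E ->
  False.
Proof.
move=> sgE; rewrite integralE.
set Ip := (X in (X - _)%E); set In := (X in (_ - X)%E).
set I := (X in (X <= K%:E)%E).
have Ip0 : (0 <= Ip)%E by exact: integral_ge0.
have In0 : (0 <= In)%E by exact: integral_ge0.
case: sgE => sgE; rewrite sgE ?opprK ?mul1e ?mulN1e.
  have -> : I = In.
    by apply: eq_integral => s _; rewrite funenegE sgE mul1r maxC EFin_max.
  by case: In In0 => // r _; case: Ip Ip0.
have -> : I = Ip.
  by apply: eq_integral => s _; rewrite funeposE sgE mulN1r opprK maxC EFin_max.
by case: Ip Ip0 => // r _; case: In In0.
Qed.

(** * Removing the impulses from a solution *)

Section solution.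
Variables (R : realType) (n : nat) (tau : 'I_n -> R -> R).
Hypothesis tau_ge0 : forall i (t : R), 0 <= t -> 0 <= tau i t.
Variable tk : nat -> R.
Hypothesis tk_incr : forall k, tk k < tk k.+1.
Hypothesis tk_infty : tk k @[k --> \oo] --> +oo.
Variables (a : R -> R) (Ik : nat -> R -> R).
Variable f_ : 'I_n -> R -> (R -> R) -> R.
Hypothesis f_local : history_local tau f_.
Variable D : set R.
Hypothesis F_cont : forall t phi, 0 <= t -> ~ D t -> BPC phi ->
  BPC_limit (total_rhs f_) `[0, +oo[ t phi (total_rhs f_ t phi).
Hypothesis Ik0 : forall k, Ik k 0 = 0.
Variables (ak bk : nat -> R).
Hypothesis ak_gt0 : forall k, 0 < ak k.
Hypothesis bk_gt0 : forall k, 0 < bk k.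
Hypothesis Ik_bounds : forall k x,
     bk k * x ^+ 2 <= x * (x + Ik k x) /\ x * (x + Ik k x) <= ak k * x ^+ 2.
Variables lam1 lam2 : 'I_n -> R -> R.
Hypothesis lam1_ge0 : forall i (t : R), 0 <= t -> 0 <= lam1 i t.
Hypothesis lam2_ge0 : forall i (t : R), 0 <= t -> 0 <= lam2 i t.
Hypothesis f_bounds : forall i (t : R) phi, 0 <= t -> PC_on (- tau i t) 0 phi ->
     - lam1 i t * Msup (tau i t) phi <= f_ i t phi /\
     f_ i t phi <= lam2 i t * Msup (tau i t) (\- phi).
Variables (t0 : R) (phi x : R -> R).
Hypothesis t0_ge0 : 0 <= t0.
Hypothesis phi_BPC : BPC phi.
Hypothesis xsol : solution tk a Ik (total_rhs f_) t0 phi x.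

Let idx := jump_count tk.

(** At a zero of x the quotient is meaningless and any value between 1 / a_k and
    1 / b_k would do; impulses before t0 do not act on the solution. *)
Definition jump_factor (k : nat) : R :=
  if tk k < t0 then 1
  else if x (tk k) == 0 then (bk k)^-1
  else x (tk k) / (x (tk k) + Ik k (x (tk k))).
Let J := jump_factor.

Definition jump_weight (t : R) : R := partial_prod J (idx t).
Let Pi := jump_weight.

(** The solution with its jumps divided out. *)
Definition smoothed (t : R) : R := Pi t * x t.
Let y := smoothed.

Lemma jump_bounds_le k : bk k <= ak k.
Proof. by have [h1 h2] := Ik_bounds k 1; have := le_trans h1 h2; rewrite !expr1n !mulr1. Qed.

Lemma jump_factorP k : t0 <= tk k ->
  [/\ (ak k)^-1 <= J k, J k <= (bk k)^-1 &
      J k * (x (tk k) + Ik k (x (tk k))) = x (tk k)].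
Proof.
move=> t0k; rewrite /J /jump_factor ltNge t0k/=.
have [b0 a0] := (bk_gt0 k, ak_gt0 k).
have [xk|xk] := eqVneq (x (tk k)) 0.
  by rewrite lef_pV2 ?posrE// jump_bounds_le xk Ik0 addr0 mulr0.
have [h1 h2] := Ik_bounds k (x (tk k)).
have x20 : 0 < x (tk k) ^+ 2 by rewrite exprn_even_gt0.
have xv0 : 0 < x (tk k) * (x (tk k) + Ik k (x (tk k))).
  by apply: lt_le_trans h1; rewrite mulr_gt0.
move: xk x20 xv0 h1 h2; move: (x (tk k)) (x _ + _) => u v u0 u20 uv0 h1 h2.
have v0 : v != 0 by apply: contraTneq uv0 => ->; rewrite mulr0 ltxx.
have -> : u / v = u ^+ 2 / (u * v) by field; rewrite u0 v0.
split; last by field; rewrite ?u0 ?v0.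
  by rewrite ler_pdivlMr// -ler_pdivlMl ?invr_gt0// invrK.
by rewrite ler_pdivrMr// -ler_pdivrMl ?invr_gt0// invrK.
Qed.

Lemma jump_factor_before k : tk k < t0 -> J k = 1.
Proof. by rewrite /J /jump_factor => ->. Qed.

Lemma jump_factor_gt0 k : 0 < J k.
Proof.
have [/jump_factor_before->//|/jump_factorP[h _ _]] := ltP (tk k) t0.
by apply: lt_le_trans h; rewrite invr_gt0.
Qed.

Lemma jump_weight_gt0 t : 0 < Pi t.
Proof. by apply: prodr_gt0 => k _; exact: jump_factor_gt0. Qed.

Lemma jump_weight_ratio (s t : R) : s <= t ->
  Pi t = Pi s * \prod_(idx s <= k < idx t) J k.
Proof. by move=> st; apply: partial_prod_ratio; exact: jump_count_le. Qed.

Lemma jump_weight_before t : t <= t0 -> Pi t = 1.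
Proof.
move=> tt0; apply: big1 => k _; apply: jump_factor_before.
by apply: lt_le_trans tt0; rewrite -(jump_countP tk_incr tk_infty).
Qed.

(** Between r and t the weight is multiplied by factors at most 1 / b_k; when r is
    before t0 only the impulses after t0 count, and the supremum defining B_i also
    ranges over the left end t0. *)
Lemma jump_weight_le_Bmax i (r t : R) : t0 <= t -> t - tau i t <= r <= t ->
  Pi t <= Pi r * Bmax tk bk (tau i) t.
Proof.
move=> t0t rt.
have H s : t0 <= s -> t - tau i t <= s <= t -> Pi t <= Pi s * Bmax tk bk (tau i) t.
  move=> t0s st; have /andP[_ st'] := st.
  rewrite (jump_weight_ratio st') ler_wpM2l ?(ltW (jump_weight_gt0 _))//.
  apply: le_trans (le_Bmax tk_incr tk_infty bk_gt0 st).
  rewrite big_nat_cond [leRHS]big_nat_cond; apply: ler_prod => k.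
  rewrite andbT => /andP[sk _]; rewrite (ltW (jump_factor_gt0 _))/=.
  have /jump_factorP[_ //] : t0 <= tk k.
  by apply: le_trans t0s _; rewrite -(jump_count_leP tk_incr tk_infty).
have [t0r|rt0] := leP t0 r; first exact: H.
have t0I : t - tau i t <= t0 <= t by lra.
have := H t0 (lexx t0) t0I.
by rewrite (jump_weight_before (lexx t0)) (jump_weight_before (ltW rt0)).
Qed.

Lemma smoothed_before t : t <= t0 -> y t = x t.
Proof. by move=> tt0; rewrite /y /smoothed -/Pi jump_weight_before// mul1r. Qed.

Lemma solution_left_lim (u : R) : t0 < u -> left_lim x u (x u).
Proof. by case: xsol => _ xl _ _ _ /xl/left_limP. Qed.

Lemma solution_right_lim (u : R) : t0 <= u -> exists l, right_lim x u l.
Proof.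
move=> t0u; case: xsol => _ _ xr _ xj.
have [[k uk]|nuk] := pselect (exists k, u = tk k).
  by eexists; apply/right_limP; rewrite uk; apply: xj; rewrite -uk.
exists (x u); apply/right_limP; apply: xr => // k; apply/eqP => uk.
by apply: nuk; exists k.
Qed.

Lemma smoothed_left_lim (u : R) : t0 < u -> left_lim y u (y u).
Proof.
move=> t0u; have [d d0 dP] := jump_count_left tk_incr tk_infty u.
apply: (@left_lim_eq _ _ (fun s => Pi u * x s) _ _ (u - d)); first lra.
  by move=> s us su; rewrite /y /smoothed /Pi /jump_weight /idx dP//; exact: ltW.
apply/left_limP; apply: cvgMr; apply/left_limP; exact: solution_left_lim.
Qed.

(** At t_k the weight is multiplied by J_k, the inverse of the factor by which x
    jumps. *)
Lemma smoothed_right_lim (u : R) : t0 <= u -> right_lim y u (y u).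
Proof.
move=> t0u; case: xsol => _ _ xr _ xj.
have [[k uk]|nuk] := pselect (exists k, u = tk k).
  have [d d0 dP] := jump_count_after tk_incr tk_infty k.
  apply: (@right_lim_eq _ _ (fun s => Pi u * J k * x s) _ _ (u + d)); first lra.
    move=> s us su; rewrite /y /smoothed /Pi /jump_weight /idx dP -?uk//.
    by rewrite uk /idx (jump_count_impulse tk_incr tk_infty) /partial_prod big_ord_recr.
  apply/right_limP.
  have t0k : t0 <= tk k by rewrite -uk.
  have [_ _ JE] := jump_factorP t0k.
  have -> : y u = Pi u * J k * (x (tk k) + Ik k (x (tk k))).
    by rewrite -mulrA JE /y /smoothed -uk.
  by apply: cvgMr; rewrite uk; exact: xj.
have nu k : u != tk k by apply/eqP => uk; apply: nuk; exists k.
have [d d0 dP] := jump_count_right tk_incr tk_infty nu.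
apply: (@right_lim_eq _ _ (fun s => Pi u * x s) _ _ (u + d)); first lra.
  by move=> s us su; rewrite /y /smoothed /Pi /jump_weight /idx dP//; exact: ltW.
by apply/right_limP; apply: cvgMr; exact: xr.
Qed.

Lemma smoothed_continuous (q : R) : {within `[t0, q], continuous y}.
Proof.
apply: within_itv_one_sided => u uI.
  by apply: smoothed_left_lim; lra.
by apply: smoothed_right_lim; lra.
Qed.

Lemma smoothed_left_derive (t : R) : t0 < t -> (forall k, t != tk k) ->
  exists2 d, is_left_derive y t d &
    d + a t * y t = Pi t * total_rhs f_ t (segment x t).
Proof.
move=> t0t nt; case: xsol => _ _ _ xd _.
have [d dP dE] := xd t t0t nt.
exists (Pi t * d); last by rewrite -dE /y /smoothed -/Pi; ring.
have [r r0 rP] := jump_count_left tk_incr tk_infty t.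
apply: (@is_left_derive_eq _ _ (fun s => Pi t * x s) _ _ (t - r)); first lra.
  by move=> s us su; rewrite /y /smoothed /Pi /jump_weight /idx rP.
exact: is_left_deriveZ.
Qed.

(** The times at which the differential inequality may fail: the impulses, and
    the discontinuities of f in time. *)
Definition exceptional : set R := [set t | (exists k, t = tk k) \/ D t].

(** The bounds on the f_i for the segments of a solution, also for those that
    reach into the initial history. *)
Lemma segment_rhs_bounds (t : R) : t0 < t -> ~ exceptional t ->
  (forall W : 'I_n -> R, (forall i, 0 <= W i) ->
    (forall i th, - tau i t <= th <= 0 -> - W i <= x (t + th)) ->
    total_rhs f_ t (segment x t) <= \sum_i lam2 i t * W i) /\
  (forall W : 'I_n -> R, (forall i, 0 <= W i) ->
    (forall i th, - tau i t <= th <= 0 -> x (t + th) <= W i) ->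
    - \sum_i lam1 i t * W i <= total_rhs f_ t (segment x t)).
Proof.
move=> t0t nE; have t_ge0 : 0 <= t by have := t0_ge0; lra.
(* The truncation point lies strictly beyond the delay window. *)
pose L := max_delay tau t + 1.
have md0 := max_delay_ge0 tau t.
have L0 : 0 < L by rewrite /L; lra.
pose sx := map tk (iota 0 (idx t)).
have xphi : forall s, s <= 0 -> x (t0 + s) = phi s by case: xsol.
have xs (u : R) : t0 <= u < t -> u \notin sx -> right_lim x u (x u).
  move=> /andP[t0u ut] us; case: xsol => _ _ xr _ _; apply/right_limP.
  apply: xr => // k; apply: contra us => /eqP uk; apply/mapP; exists k => //.
  by rewrite mem_iota/= add0n (jump_countP tk_incr tk_infty) -uk.
have := segment_approx (ltW t0t) L0 phi_BPC xphi solution_left_lim solution_right_lim xs.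
set phi' := glue _ _ _ => /= ap.
have pE th : - max_delay tau t <= th -> phi' th = x (t + th).
  move=> h; rewrite /phi' /glue ifF//; apply/negbTE; rewrite -ltNge /L; lra.
have pB : BPC phi'.
  apply: (BPC_approx ap).
  have [psi [s [rp pe]]] := ap 1 ltr01.
  have [pc _] := regular_below_PC (- (t - t0 + L)) rp (lexx 0).
  have [C C0 CP] := piecewise_continuous_bounded pc.
  exists (C + 1) => th th0; have [h|h] := leP th (- (t - t0 + L)).
    by rewrite /phi' /glue h normr0; lra.
  have := pe th th0; have hI : - (t - t0 + L) <= th <= 0 by lra.
  have := CP th hI; have := ler_normB (psi th) (psi th - phi' th).
  by rewrite opprB addrC subrK; lra.
have FE : total_rhs f_ t (segment x t) = total_rhs f_ t phi'.
  apply: eq_bigr => i _; apply: f_local => // th thI.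
  by rewrite pE//; have := le_max_delay tau i t; lra.
have tauI i th : - tau i t <= th <= 0 -> phi' th = x (t + th).
  by move=> thI; rewrite pE//; have := le_max_delay tau i t; lra.
have nD : ~ D t by move=> Dt; apply: nE; right.
have Fc := F_cont t_ge0 nD pB.
rewrite FE; split=> W W0 xW.
  apply: (rhs_le tau_ge0 lam2_ge0 f_bounds t_ge0 pB ap Fc W0) => i th thI.
  by rewrite (tauI i)//; exact: xW.
apply: (rhs_ge tau_ge0 lam1_ge0 f_bounds t_ge0 pB ap Fc W0) => i th thI.
by rewrite (tauI i)//; exact: xW.
Qed.

(** The bound - V on y becomes - V B_i(t) / Pi(t) for x on the window of the i-th
    delay, and multiplying the equation by Pi(t) cancels the denominator. *)
Lemma smoothed_delay_ineq_upper :
  delay_ineq a (max_delay tau) exceptional t0 (gain tau lam2 tk bk) y.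
Proof.
move=> t V t0t nE V0 yV.
have nt k : t != tk k by apply/eqP => tk'; apply: nE; left; exists k.
have [d dy dE] := smoothed_left_derive t0t nt.
exists d => //; rewrite dE.
have [H _] := segment_rhs_bounds t0t nE.
have P0 := jump_weight_gt0 t.
have t_ge0 : 0 <= t by have := t0_ge0; lra.
have B0 i : 0 <= Bmax tk bk (tau i) t.
  apply: le_trans ler01 _.
  exact: (Bmax_ge1 tk_incr tk_infty bk_gt0 (@tau_ge0 i)).
have -> : V * gain tau lam2 tk bk t =
    Pi t * \sum_i lam2 i t * (Bmax tk bk (tau i) t * V / Pi t).
  rewrite /gain !big_distrr/=; apply: eq_bigr => i _.
  by field; rewrite gt_eqF.
rewrite ler_pM2l//; apply: H => [i|i th thI].
  by rewrite divr_ge0 ?mulr_ge0// ltW.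
have tI : t - max_delay tau t <= t + th <= t by have := le_max_delay tau i t; lra.
have := yV _ tI; rewrite /y /smoothed -/Pi => yth.
have tI' : t - tau i t <= t + th <= t by lra.
have Pr := jump_weight_le_Bmax (ltW t0t) tI'.
have Pr0 := jump_weight_gt0 (t + th).
rewrite -mulNr ler_pdivrMr//.
have [x0|x0] := leP 0 (x (t + th)).
  apply: (@le_trans _ _ 0); first by rewrite oppr_le0 mulr_ge0.
  by rewrite mulr_ge0// ltW.
have := ler_wpM2l (B0 i) yth.
have := ler_wnM2l (ltW x0) Pr.
lra.
Qed.

Lemma smoothed_delay_ineq_lower :
  delay_ineq a (max_delay tau) exceptional t0 (gain tau lam1 tk bk) (fun t => - y t).
Proof.
move=> t V t0t nE V0 yV.
have nt k : t != tk k by apply/eqP => tk'; apply: nE; left; exists k.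
have [d dy dE] := smoothed_left_derive t0t nt.
exists (- d).
  have := @is_left_deriveZ _ (-1) _ _ _ dy; rewrite mulN1r.
  by apply: (@is_left_derive_eq _ _ _ _ _ (t - 1)) => [|u _ _]; [lra|rewrite mulN1r].
rewrite mulrN -opprD dE.
have [_ H] := segment_rhs_bounds t0t nE.
have P0 := jump_weight_gt0 t.
have t_ge0 : 0 <= t by have := t0_ge0; lra.
have B0 i : 0 <= Bmax tk bk (tau i) t.
  apply: le_trans ler01 _.
  exact: (Bmax_ge1 tk_incr tk_infty bk_gt0 (@tau_ge0 i)).
have -> : V * gain tau lam1 tk bk t =
    Pi t * \sum_i lam1 i t * (Bmax tk bk (tau i) t * V / Pi t).
  rewrite /gain !big_distrr/=; apply: eq_bigr => i _.
  by field; rewrite gt_eqF.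
rewrite -mulrN ler_pM2l// lerNl; apply: H => [i|i th thI].
  by rewrite divr_ge0 ?mulr_ge0// ltW.
have tI : t - max_delay tau t <= t + th <= t by have := le_max_delay tau i t; lra.
have := yV _ tI; rewrite lerN2 /y /smoothed -/Pi => yth.
have tI' : t - tau i t <= t + th <= t by lra.
have Pr := jump_weight_le_Bmax (ltW t0t) tI'.
rewrite ler_pdivlMr//.
have [x0|x0] := leP (x (t + th)) 0.
  apply: (@le_trans _ _ 0); last by rewrite mulr_ge0.
  by rewrite mulr_le0_ge0// ltW.
have := ler_wpM2l (B0 i) yth.
have := ler_wpM2l (ltW x0) Pr.
lra.
Qed.

Lemma partial_prod_gt0 (c : nat -> R) m : (forall k, 0 < c k) -> 0 < partial_prod c m.
Proof. by move=> c0; apply: prodr_gt0. Qed.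

Lemma jump_weight_inv_le (M : R) : (forall m, partial_prod ak m <= M) -> forall t,
  t0 <= t -> (Pi t)^-1 <= M / partial_prod ak (idx t0).
Proof.
move=> aM t t0t; have P0 := partial_prod_gt0 (idx t0) ak_gt0.
apply: (@le_trans _ _ (partial_prod ak (idx t) / partial_prod ak (idx t0))); last first.
  by rewrite ler_wpM2r ?invr_ge0 ?(ltW P0).
rewrite (partial_prod_ratio ak (jump_count_le tk_incr tk_infty t0t)).
rewrite [_ * \prod_(_ <= _ < _) _]mulrC mulfK ?gt_eqF//.
rewrite (jump_weight_ratio t0t) jump_weight_before// mul1r -prodfV.
rewrite big_nat_cond [leRHS]big_nat_cond; apply: ler_prod => k.
rewrite andbT => /andP[sk _]; rewrite invr_ge0 (ltW (jump_factor_gt0 _))/=.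
have /jump_factorP[h _ _] : t0 <= tk k by rewrite -(jump_count_leP tk_incr tk_infty).
by rewrite -[leRHS]invrK lef_pV2// posrE ?invr_gt0// jump_factor_gt0.
Qed.

Lemma solution_le_smoothed (M : R) : (forall m, partial_prod ak m <= M) -> forall t,
  t0 <= t -> `|x t| <= M / partial_prod ak (idx t0) * `|y t|.
Proof.
move=> aM t t0t; have P0 := jump_weight_gt0 t.
have -> : x t = (Pi t)^-1 * y t by rewrite /y /smoothed -/Pi mulKf ?gt_eqF.
by rewrite normrM ler_wpM2r// gtr0_norm ?invr_gt0// jump_weight_inv_le.
Qed.


Lemma jump_count_infty : idx t @[t --> +oo] --> \oo.
Proof.
move=> P [m _ mP]; exists (tk m); split; first exact: num_real.
move=> t mt; apply: mP => /=; apply: ltnW.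
by rewrite (jump_countP tk_incr tk_infty).
Qed.

(** The partial products of J_k^-1 / a_k are nonincreasing beyond t0, hence
    converge, and those of a_k converge by assumption. *)
Lemma jump_weight_inv_cvg : cvg (partial_prod ak m @[m --> \oo]) ->
  exists l : R, (Pi t)^-1 @[t --> +oo] --> l.
Proof.
move=> cP; pose m0 := idx t0.
have P0 := partial_prod_gt0 m0 ak_gt0.
pose Q (m : nat) := \prod_(m0 <= k < m) ((J k)^-1 / ak k).
have r1 k : (m0 <= k)%N -> 0 <= (J k)^-1 / ak k <= 1.
  rewrite (jump_count_leP tk_incr tk_infty) => /jump_factorP[h _ _].
  rewrite divr_ge0 ?invr_ge0 ?(ltW (jump_factor_gt0 _)) ?(ltW (ak_gt0 _))//=.
  rewrite ler_pdivrMr// mul1r -[leRHS]invrK.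
  by rewrite lef_pV2// posrE ?invr_gt0// jump_factor_gt0.
have Q0 m : 0 <= Q m.
  by rewrite /Q big_nat_cond; apply: prodr_ge0 => k /andP[/andP[/r1/andP[]]].
have cQ : cvgn Q.
  apply: nonincreasing_is_cvgn; last by exists 0 => _ [m _ <-]; exact: Q0.
  apply/nonincreasing_seqP => m; rewrite /Q; have [m0m|mm0] := leqP m0 m.
    by rewrite big_nat_recr//= ler_piMr ?Q0//; have /andP[] := r1 m m0m.
  by rewrite !big_geq// ltnW.
have uE m : (m0 <= m)%N ->
    (partial_prod J m)^-1 = Q m * (partial_prod ak m / partial_prod ak m0).
  move=> m0m; rewrite (partial_prod_ratio J m0m) (partial_prod_ratio ak m0m).
  have -> : partial_prod J m0 = 1 by exact: (jump_weight_before (lexx t0)).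
  rewrite mul1r [_ / partial_prod ak m0]mulrAC divff ?gt_eqF// mul1r.
  rewrite /Q big_split/= !prodfV mulfVK// gt_eqF//.
  by apply: prodr_gt0 => k _; exact: ak_gt0.
have cu : cvg ((partial_prod J m)^-1 @[m --> \oo]).
  have /cvg_ex[lQ lQP] := cQ; have /cvg_ex[la laP] := cP.
  apply/cvg_ex; exists (lQ * (la * (partial_prod ak m0)^-1)).
  apply: cvg_trans (_ : Q m * (partial_prod ak m * (partial_prod ak m0)^-1)
    @[m --> \oo] --> _); last first.
    by apply: cvgM => //; apply: cvgM => //; exact: cvg_cst.
  by apply: near_eq_cvg; exists m0 => // m /= m0m; rewrite uE.
have /cvg_ex[l lP] := cu; exists l.
exact: (cvg_comp _ _ jump_count_infty lP).
Qed.

Section eventually_signed.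
Variables (sg p M : R).
Hypothesis sgE : sg = 1 \/ sg = -1.
Hypothesis t0p : t0 <= p.
Hypothesis ypos : forall t, p <= t -> 0 < sg * y t.
Hypothesis ymono : forall r q, p <= r -> r <= q -> sg * y q <= sg * y r.
Hypothesis akM : forall m, partial_prod ak m <= M.
Hypothesis lam1_pc : forall i, piecewise_continuous_pos (lam1 i).
Hypothesis lam2_pc : forall i, piecewise_continuous_pos (lam2 i).
Hypothesis a_ge0 : forall t : R, 0 <= t -> 0 <= a t.
Hypothesis D_fin : forall be, finite_set (D `&` `[0, be]).
Hypothesis tau_infty : forall K : R, exists S : R, forall t, S <= t -> K <= t - max_delay tau t.

Let sg2 : sg * sg = 1.
Proof. by case: sgE => ->; rewrite ?mulrNN mulr1. Qed.

Let sg_norm (u : R) : `|sg * u| = `|u|.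
Proof. by rewrite normrM; case: sgE => ->; rewrite ?normrN normr1 mul1r. Qed.

Lemma solution_signed t : p <= t -> 0 < sg * x t.
Proof.
move=> pt; have := ypos pt; rewrite /y /smoothed -/Pi mulrCA pmulr_rgt0//.
exact: jump_weight_gt0.
Qed.

(** The solution, made constant before p.  It keeps the sign that the solution
    has only from p on, as a test function has to. *)
Definition frozen : R -> R := glue p (fun=> x p) x.

Lemma frozenE t : p <= t -> frozen t = x t.
Proof.
rewrite /frozen /glue le_eqVlt => /predU1P[<-|pt]; first by rewrite lexx.
by rewrite leNgt pt.
Qed.

Lemma frozen_left_lim t : left_lim frozen t (frozen t).
Proof.
apply: glue_left_lim => h; first exact: left_lim_cst.
by apply: solution_left_lim; have := t0p; lra.
Qed.

Lemma frozen_right_lim t : exists l, right_lim frozen t l.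
Proof.
have [tp|pt] := ltP t p.
  by exists (x p); apply: glue_right_lim1 => //; exact: right_lim_cst.
have [|l lP] := @solution_right_lim t; first by have := t0p; lra.
by exists l; exact: glue_right_lim2.
Qed.

Lemma frozen_right_cont t : (forall k, t != tk k) -> right_lim frozen t (frozen t).
Proof.
move=> nt; have [tp|pt] := ltP t p.
  have -> : frozen t = x p by rewrite /frozen /glue ltW.
  by apply: glue_right_lim1 => //; exact: right_lim_cst.
rewrite frozenE//; apply: glue_right_lim2 => //; apply/right_limP.
by case: xsol => _ _ xr _ _; apply: xr => //; have := t0p; lra.
Qed.

Lemma frozen_left_derive t : (forall k, t != tk k) -> exists d, is_left_derive frozen t d.
Proof.
move=> nt; have [tp|pt] := leP t p.
  exists 0; apply: (@is_left_derive_eq _ _ (fun=> x p) _ _ (t - 1)); first lra.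
    by move=> u _ ut; rewrite /frozen /glue ifT//; lra.
  exact: is_left_derive_cst.
case: xsol => _ _ _ xd _; have [|d dP _] := xd t _ nt; first by have := t0p; lra.
exists d; apply: (@is_left_derive_eq _ _ x _ _ p) => // u pu _.
by rewrite frozenE// ltW.
Qed.

Let Cx := M / partial_prod ak (idx t0).

Let Cx_gt0 : 0 < Cx.
Proof.
rewrite divr_gt0 ?partial_prod_gt0//.
by apply: lt_le_trans (akM 0%N); rewrite /partial_prod big_ord0.
Qed.

Lemma frozen_bounded t : `|frozen t| <= Cx * (sg * y p).
Proof.
have H u : p <= u -> `|x u| <= Cx * (sg * y p).
  move=> pu; have t0u : t0 <= u by have := t0p; lra.
  apply: (le_trans (solution_le_smoothed akM t0u)).
  rewrite -/Cx ler_wpM2l ?(ltW Cx_gt0)// -sg_norm ger0_norm; last exact/ltW/ypos.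
  exact: ymono.
have [tp|pt] := leP t p; last by rewrite frozenE ?H// ltW.
by have -> : frozen t = x p; [rewrite /frozen /glue tp|exact: H].
Qed.

Lemma frozen_signed t : 0 < sg * frozen t.
Proof.
have [tp|pt] := leP t p; last by rewrite frozenE ?solution_signed// ltW.
by have -> : frozen t = x p; [rewrite /frozen /glue tp|rewrite solution_signed].
Qed.

(** Between impulses x is a positive multiple of y, so |x| inherits from |y| that
    it does not increase.  This gives the sign of the derivative even at times
    where f is discontinuous and the equation tells nothing about y'. *)
Lemma frozen_test_function : test_function tk frozen.
Proof.
split.
- by exists (Cx * (sg * y p)) => t _; exact: frozen_bounded.
- move=> [_ osc]; have [t _ wt] := osc 0.
  by have := frozen_signed t; rewrite wt mulr0 ltxx.
- split.
  + by move=> t _; apply/left_limP; exact: frozen_left_lim.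
  + by move=> t _ nt; apply/right_limP; exact: frozen_right_cont.
  + by move=> k; have [l lP] := frozen_right_lim (tk k); apply/cvg_ex; exists l; apply/right_limP.
  + by move=> t _ nt; exact: frozen_left_derive.
move=> k t d /andP[kt tk1] dP.
have [r r0 rP] := jump_count_left tk_incr tk_infty t.
have sd : sg * d <= 0.
  apply: (@is_left_derive_le0 _ (fun s => sg * frozen s) t _ (t - r)); first lra.
    move=> u ru ut; have [tp|pt] := leP t p.
      by rewrite /frozen /glue !ifT//; lra.
    rewrite (frozenE (ltW pt)).
    pose v := Num.max u p.
    have [uv pv] : u <= v /\ p <= v by rewrite !le_max !lexx orbT.
    have vt : v < t by rewrite gt_max ut pt.
    have -> : frozen u = x v.
      by rewrite /frozen /glue /v; case: (leP u p).
    have Pv : Pi v = Pi t by rewrite /Pi /jump_weight /idx rP//; lra.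
    have := ymono pv (ltW vt); rewrite /y /smoothed -/Pi Pv !(mulrCA sg).
    by rewrite ler_pM2l// jump_weight_gt0.
  exact: is_left_deriveZ.
have -> : d * frozen t = (sg * d) * (sg * frozen t).
  by rewrite mulrACA sg2 mul1r.
by rewrite mulr_le0_ge0// ltW// frozen_signed.
Qed.

Lemma segment_frozen_PC i (s : R) : 0 <= s -> PC_on (- tau i s) 0 (segment frozen s).
Proof.
move=> s0; apply: (@PC_onI _ (map (fun k => tk k - s) (iota 0 (idx s)))) => th thI.
- by apply: left_lim_shift; exact: frozen_left_lim.
- by have [l lP] := frozen_right_lim (s + th); exists l; exact: right_lim_shift.
move=> nth; apply: right_lim_shift; apply: frozen_right_cont => k.
apply: contra nth => /eqP kE; apply/mapP; exists k; last lra.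
by rewrite mem_iota/= add0n (jump_countP tk_incr tk_infty) -kE; lra.
Qed.

Let q s := total_rhs f_ s (segment frozen s).

(** The segments of the frozen function are piecewise continuous at every time, so
    the bounds on the f_i apply without exceptional times. *)
Lemma rhs_frozen_bounded (N : R) : 0 < N -> exists2 C, 0 <= C &
  forall s, 0 <= s <= N -> `|q s| <= C.
Proof.
move=> N0; pose W := Cx * (sg * y p).
have W0 : 0 <= W by apply: le_trans (frozen_bounded 0).
have B (lam : 'I_n -> R -> R) : (forall i, piecewise_continuous_pos (lam i)) ->
    exists2 C, 0 <= C & forall s, 0 <= s <= N -> \sum_i lam i s * W <= C.
  move=> pc.
  have Ci i : exists C, 0 <= C /\ forall s, 0 <= s <= N -> lam i s * W <= C.
    have [C C0 CP] := piecewise_continuous_bounded (pc i N N0).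
    exists (C * W); split; first by rewrite mulr_ge0.
    move=> s sN; rewrite ler_wpM2r//; exact: le_trans (ler_norm _) (CP s sN).
  have [C CP] := choice Ci.
  exists (\sum_i C i); first by apply: sumr_ge0 => i _; exact: (CP i).1.
  by move=> s sN; apply: ler_sum => i _; exact: (CP i).2.
have [C1 C10 C1P] := B lam1 lam1_pc.
have [C2 C20 C2P] := B lam2 lam2_pc.
exists (Num.max C1 C2) => [|s sN]; first by rewrite le_max C10.
have s0 : 0 <= s by lra.
have fb v : - W <= frozen v <= W by rewrite -ler_norml; exact: frozen_bounded.
have up : q s <= \sum_i lam2 i s * W.
  apply: (rhs_le_PC tau_ge0 lam2_ge0 f_bounds s0 (W := fun=> W)) => // i.
    exact: segment_frozen_PC.
  by move=> th _; have /andP[] := fb (s + th).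
have lo : - \sum_i lam1 i s * W <= q s.
  apply: (rhs_ge_PC tau_ge0 lam1_ge0 f_bounds s0 (W := fun=> W)) => // i.
    exact: segment_frozen_PC.
  by move=> th _; have /andP[] := fb (s + th).
rewrite ler_norml; have := C1P s sN; have := C2P s sN.
have := le_max C1 C1 C2; have := le_max C2 C1 C2; rewrite !lexx orbT /= => m2 m1.
by move=> h2 h1; apply/andP; split; lra.
Qed.

(** Far enough from p the delay window only sees values of one sign, and the
    bounds on the f_i, with 0 as the supremum, give the sign of f.  The weight is at least 1 / Cx, so a forcing
    of size |q| moves y at the rate |q| / Cx or faster. *)
Lemma rhs_frozen_le (s : R) : p <= s -> t0 < s -> p <= s - max_delay tau s ->
    ~ exceptional s ->
  sg * q s <= 0 /\ exists2 d, is_left_derive (fun u => sg * y u) s d &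
    d <= Cx^-1 * (sg * q s).
Proof.
move=> ps t0s pd nE; have s0 : 0 <= s by have := t0_ge0; lra.
have pI i th : - tau i s <= th <= 0 -> p <= s + th.
  by have := le_max_delay tau i s; lra.
have qE : q s = total_rhs f_ s (segment x s).
  apply: eq_bigr => i _; apply: f_local => // th /pI pth.
  by rewrite /segment frozenE.
have q0 : sg * q s <= 0.
  have [H2 H1] := segment_rhs_bounds t0s nE; rewrite qE.
  have /(_ (fun=> 0)) := H2; have /(_ (fun=> 0)) := H1.
  rewrite !big1 ?oppr0; try by move=> i _; rewrite mulr0.
  case: sgE => sgv H1' H2'; rewrite sgv.
    rewrite mul1r; apply: H2' => // i th /pI /solution_signed.
    by rewrite sgv mul1r => /ltW.
  rewrite mulN1r oppr_le0; apply: H1' => // i th /pI /solution_signed.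
  by rewrite sgv mulN1r oppr_gt0 => /ltW.
split=> //.
have ns k : s != tk k by apply/eqP => tk'; apply: nE; left; exists k.
have [d dy dE] := smoothed_left_derive t0s ns.
exists (sg * d); first exact: is_left_deriveZ.
have -> : sg * d = Pi s * (sg * q s) - a s * (sg * y s).
  by rewrite qE mulrCA -dE; ring.
have : 0 <= a s * (sg * y s) by rewrite mulr_ge0 ?a_ge0// ltW// ypos.
have : Pi s * (sg * q s) <= Cx^-1 * (sg * q s).
  rewrite ler_wnM2r//.
  have := jump_weight_inv_le akM (ltW t0s); rewrite -/Cx => h.
  by rewrite -[leRHS]invrK lef_pV2// posrE ?invr_gt0 ?jump_weight_gt0.
lra.
Qed.

Lemma exceptional_finite (N : R) : finite_set (exceptional `&` `[0, N]).
Proof.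
apply: (@sub_finite_set _ _ ([set t | t <= N /\ exists k, t = tk k] `|` (D `&` `[0, N]))).
  move=> t [[h|h]]; rewrite /= in_itv/= => /andP[h0 hN]; first by left.
  by right; split => //; rewrite /= ?in_itv/= h0.
by rewrite finite_setU; split; [exact: (impulse_finite tk_incr tk_infty)|exact: D_fin].
Qed.

(** The part of f(s, w_s) opposite in sign to w has finite integral: up to S3 it is
    bounded, and after S3 its integral is at most Cx times the decrease of |y|,
    hence at most Cx |y(S3)|.  Both bounds are proved for the simple functions
    below it. *)
Lemma rhs_frozen_integral (S : R) : 0 <= S -> exists K : R,
  (\int[@lebesgue_measure R]_(s in `[S, +oo[) (Num.max 0 (- (sg * q s)))%:E <= K%:E)%E.
Proof.
move=> S0; have [S1 S1P] := tau_infty p.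
pose S3 := Num.max 1 (Num.max S1 (t0 + p)).
have [S31 S3S1 S3p] : [/\ 1 <= S3, S1 <= S3 & t0 + p <= S3] by rewrite !le_max !lexx !orbT.
have S30 : 0 < S3 by lra.
have [C C0 CP] := rhs_frozen_bounded S30.
have t00 := t0_ge0. have t0p' := t0p.
have [pS3 t0S3] : p <= S3 /\ t0 <= S3 by split; lra.
have yS3 : 0 < sg * y S3 by exact: ypos.
pose K := C * S3 + Cx * (sg * y S3).
exists K; apply: integral_le_nnsfun => [s _|h hq].
  by rewrite lee_fin le_max lexx.
have h0 s : 0 <= h s by exact: fun_ge0.
have hE s : ((h s)%:E <= if s \in `[S, +oo[%classic
    then (Num.max 0 (- (sg * q s)))%:E else 0)%E by exact: hq.
have hS s : s < S -> h s <= 0.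
  move=> sS; have := hE s; rewrite ifF ?lee_fin//.
  apply/negP; rewrite inE/= in_itv/= andbT; lra.
have hle s : h s <= Num.max 0 (- (sg * q s)).
  have [sS|Ss] := ltP s S; first by rewrite le_max hS.
  have := hE s; rewrite ifT ?lee_fin// inE/= in_itv/= andbT//.
have hC s : 0 <= s <= S3 -> h s <= C.
  move=> sI; apply: (le_trans (hle s)); rewrite ge_max C0/=.
  by apply: (le_trans (ler_norm _)); rewrite normrN sg_norm CP.
have mhT : measurable_fun setT (h : measurableTypeR R -> R).
  exact: measurable_funPT.
have mh (A : set R) : measurable A -> measurable_fun A (h : R -> R).
  by move=> mA; apply: measurable_funS mhT.
have [B hB] : exists B, forall s, `|h s| <= B.
  have [B [_ BP]] := simple_bounded h.
  by exists (B + 1) => s; apply: BP => //; lra.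
have hI N : \int[@lebesgue_measure R]_(s in `[0, N]) h s <= K -> 0 <= N ->
    (\int[@lebesgue_measure R]_(s in `[0%R, N]) (h s)%:E <= K%:E)%E.
  move=> hK N0; rewrite -[leLHS]fineK ?lee_fin//.
  apply: integrable_fin_num => //.
  by apply: (@bounded_integrable_itv _ _ 0 N B) => //; exact: mh.
have iC : 0 < Cx^-1 by rewrite invr_gt0.
have part N : S3 <= N -> \int[@lebesgue_measure R]_(s in `[0, N]) h s <= K.
  move=> S3N.
  have int : (@lebesgue_measure R).-integrable `[0, N] (EFin \o (h : R -> R)).
    by apply: (@bounded_integrable_itv _ _ 0 N B) => //; exact: mh.
  have int3 : (@lebesgue_measure R).-integrable `[S3, N] (EFin \o (h : R -> R)).
    by apply: integrableS int => //; apply: subset_itvr; rewrite bnd_simp ltW.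
  have I1 : \int[@lebesgue_measure R]_(s in `[0, S3]) h s <= C * S3.
    have := @Rintegral_itv_le R 0 S3 B C h 0 S3.
    rewrite set_itv1 Rintegral_set1 add0r subr0; apply => //.
    - exact: mh.
    - exact: ltW.
    - by move=> s /andP[s1 s2]; apply: hC; rewrite ltW.
  have I2 : \int[@lebesgue_measure R]_(s in `[0, N]) h s -
      \int[@lebesgue_measure R]_(s in `[0, S3]) h s =
      \int[@lebesgue_measure R]_(s in `[S3, N]) h s.
    rewrite Rintegral_itvB ?bnd_simp ?(ltW S30)// Rintegral_itv_obnd_cbnd//.
    by apply: integrableS int3 => //; apply: subset_itvr; rewrite bnd_simp.
  have I3 : sg * y N - sg * y S3 <=
      \int[@lebesgue_measure R]_(s in `[S3, N]) (- Cx^-1 * h s).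
    apply: (@left_derive_le_integral R S3 N (Cx^-1 * B) (fun u => sg * y u)
      (fun s => - Cx^-1 * h s) exceptional) => //.
    - apply: sub_finite_set (exceptional_finite N) => s [Es]; rewrite /= !in_itv/= => sI.
      case/andP: sI => S3s sN; split => //.
      by rewrite sN andbT; apply: le_trans S3s; exact: ltW.
    - apply/subspace_continuousP => u uI; apply: cvgM; first exact: cvg_cst.
      have sub : `[S3, N] `<=` `[t0, N] by apply: subset_itvr; rewrite bnd_simp.
      have cN := continuous_subspaceW sub (smoothed_continuous (q := N)).
      exact: ((subspace_continuousP _ _).1 cN).
    - by apply: measurable_funM => //; exact: mh.
    - move=> s _; rewrite normrM normrN (gtr0_norm iC).
      by apply: ler_wpM2l; [exact: ltW|exact: hB].
    move=> s /andP[S3s sN] nE.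
    have ps := le_trans pS3 (ltW S3s).
    have t0s := le_lt_trans t0S3 S3s.
    have pd := S1P s (le_trans S3S1 (ltW S3s)).
    have [q0 [d dy dq]] := rhs_frozen_le ps t0s pd nE.
    exists d => //; apply: (le_trans dq); rewrite mulNr -mulrN.
    apply: ler_wpM2l; first exact: ltW.
    by rewrite lerNr; apply: (le_trans (hle s)); rewrite ge_max lexx andbT oppr_ge0.
  move: I3; rewrite RintegralZl// => I3.
  have yN : 0 < sg * y N by apply: ypos; exact: le_trans S3N.
  have I4 : Cx^-1 * \int[@lebesgue_measure R]_(s in `[S3, N]) h s <= sg * y S3.
    move: I3; rewrite mulNr -lerN2 opprK opprB => /le_trans; apply.
    by rewrite gerBl ltW.
  move: I4; rewrite -ler_pdivlMl// invrK => I5.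
  by rewrite -[leLHS](subrK (\int[@lebesgue_measure R]_(s in `[0, S3]) h s)) I2 addrC lerD.
have -> : (\int[@lebesgue_measure R]_x (h x)%:E =
    \int[@lebesgue_measure R]_(x in `[0%R, +oo[) (h x)%:E)%E.
  rewrite [RHS]integral_mkcond; apply: eq_integral => s _.
  have -> : ((fun x0 => (h x0)%:E) \_ `[0%R, +oo[%classic) s =
    if s \in `[0%R, +oo[%classic then (h s)%:E else 0%E by [].
  case: ifPn => // /negP; rewrite inE/= in_itv/= andbT => s0.
  by congr EFin; apply/eqP; rewrite eq_le h0 andbT hS//; lra.
apply: ge0_integral_exhaustion => // m.
have mN : m.+1%:R <= Num.max S3 m.+1%:R by rewrite le_max lexx orbT.
have SN : S3 <= Num.max S3 m.+1%:R by rewrite le_max lexx.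
apply: (@le_trans _ _ (\int[@lebesgue_measure R]_(s in `[0%R, Num.max S3 m.+1%:R]) (h s)%:E)%E).
  apply: ge0_subset_integral => //.
  - by apply/measurable_EFinP; exact: mh.
  - by move=> s _; rewrite lee_fin.
  - by apply: subset_itvl; rewrite bnd_simp.
by apply: hI; [exact: part|rewrite (le_trans _ SN)// ltW].
Qed.

Lemma frozen_not_divergent :
  ~ history_integral_diverges (max_delay tau) (total_rhs f_) frozen ((- sg)%:E * +oo)%E.
Proof.
move=> [S [S0 _ int]]; have [K KP] := rhs_frozen_integral S0.
exact: (integral_infty_sign sgE int KP).
Qed.

Lemma frozen_cvg (c : R) : x t @[t --> +oo] --> c -> frozen t @[t --> +oo] --> c.
Proof.
apply: cvg_trans; apply: near_eq_cvg; exists p; split; first exact: num_real.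
by move=> t pt; rewrite /= frozenE// ltW.
Qed.

End eventually_signed.

Lemma smoothed_vanishes_solution (M : R) : (forall m, partial_prod ak m <= M) ->
  y t @[t --> +oo] --> (0 : R) -> x t @[t --> +oo] --> (0 : R).
Proof.
move=> akM /cvgrPdist_lt y0; pose C := M / partial_prod ak (idx t0).
have C0 : 0 < C.
  rewrite divr_gt0 ?partial_prod_gt0//.
  by apply: lt_le_trans (akM 0%N); rewrite /partial_prod big_ord0.
apply/cvgrPdist_lt => e e0.
have eC : 0 < e / C by rewrite divr_gt0.
have [S [_ SP]] := y0 _ eC.
exists (Num.max S t0); split; first exact: num_real.
move=> t; rewrite gt_max => /andP[St t0t].
have := SP t St; rewrite !sub0r !normrN ltr_pdivlMr// mulrC.
by apply: le_lt_trans; apply: solution_le_smoothed => //; exact: ltW.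
Qed.

End solution.

(** * Global asymptotic stability *)

(** The integral of a over [p, t] exceeds any given ln L, and then the exponential
    is below 1 / L. *)
Lemma decay_cvg0 (R : realType) (a v : R -> R) (p : R) :
    (forall t : R, 0 <= t -> 0 <= a t) -> {within `[0, +oo[, continuous a} ->
    (\int[@lebesgue_measure R]_(u in `[0%R, +oo[) (a u)%:E = +oo)%E ->
    0 <= p -> (forall t, p <= t -> 0 <= v t) ->
    (forall q, p <= q ->
      v q <= v p * expR (- \int[@lebesgue_measure R]_(u in `[p, q]) a u)) ->
  v t @[t --> +oo] --> (0 : R).
Proof.
move=> a0 ca ainf p0 v0 vd; apply/cvgrPdist_lt => e e0.
pose A t := \int[@lebesgue_measure R]_(u in `[0, t]) a u.
pose L := (v p + 1) / e.
have vp := v0 p (lexx p).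
have L0 : 0 < L by rewrite divr_gt0//; lra.
have [N N0 NP] := rate_integral_unbounded a0 ca ainf (A p + ln L).
exists (Num.max p N); split; first exact: num_real.
move=> t; rewrite gt_max => /andP[pt Nt]; rewrite sub0r normrN ger0_norm ?v0 ?ltW//.
apply: le_lt_trans (vd t (ltW pt)) _.
have Apt : A p + ln L <= A t.
  apply: (le_trans NP); rewrite -/(A t) -subr_ge0 -(rate_integralB ca)//; last exact: ltW.
  exact: rate_integral_ge0.
rewrite (rate_integralB ca p0 (ltW pt)) -/(A t) -/(A p).
have : expR (- (A t - A p)) <= L^-1.
  rewrite -[L in leRHS]lnK ?posrE// -expRN ler_expR; lra.
move=> /(ler_wpM2l vp); move/le_lt_trans; apply.
by rewrite /L invf_div mulrCA gtr_pMr// ltr_pdivrMr; lra.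
Qed.

(** Intermediate value theorem beyond the last zero. *)
Lemma signed_or_oscillating (R : realType) (y : R -> R) (t0 : R) :
    (forall q : R, {within `[t0, q], continuous y}) ->
  (forall K, exists2 t, K <= t & y t = 0) \/
  exists S sg, [/\ t0 <= S, sg = 1 \/ sg = -1 & forall t, S <= t -> 0 < sg * y t].
Proof.
move=> cy; have [osc|] := pselect (forall K, exists2 t, K <= t & y t = 0); first by left.
move=> /existsNP[K /forall2NP nK]; right.
pose S := Num.max t0 K.
have t0S : t0 <= S by rewrite le_max lexx.
have KS : K <= S by rewrite le_max lexx orbT.
have ynz t : S <= t -> y t != 0.
  move=> St; apply/eqP => yt; by case: (nK t) => // h; apply: h; exact: le_trans St.
have cyS q : {within `[S, q], continuous y}.
  by apply: continuous_subspaceW (cy q); apply: subset_itvr; rewrite bnd_simp.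
have noz q : S <= q -> ~ (y S <= 0 <= y q \/ y q <= 0 <= y S).
  move=> Sq h.
  have h0 : Num.min (y S) (y q) <= 0 <= Num.max (y S) (y q).
    by rewrite ge_min le_max; case: h => /andP[-> ->]; rewrite ?orbT.
  have [c] := IVT Sq (cyS q) h0.
  by rewrite in_itv/= => /andP[Sc _] yc; move: (ynz c Sc); rewrite yc eqxx.
have [yS|yS] := ltP 0 (y S).
  exists S, 1; split => //; first by left.
  move=> t St; rewrite mul1r ltNge; apply/negP => yt.
  by apply: (noz t St); right; rewrite yt ltW.
exists S, (-1); split => //; first by right.
move=> t St; rewrite mulN1r oppr_gt0 ltNge; apply/negP => yt.
by apply: (noz t St); left; rewrite yt yS.
Qed.

Theorem theorem2p3 (R : realType) (n : nat) (n_gt0 : (0 < n)%N)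
  (tau : 'I_n -> R -> R)
  (tau_ge0 : forall i t, 0 <= t -> 0 <= tau i t)
  (tau_cont : forall i, {within `[0, +oo[, continuous (tau i)})
  (tau_infty : forall i, (t - tau i t) @[t --> +oo] --> +oo)
  (tau_mono : forall i s t, 0 <= s -> s <= t -> s - tau i s <= t - tau i t)
  (tk : nat -> R)
  (tk_gt0 : forall k, 0 < tk k)
  (tk_incr : forall k, tk k < tk k.+1)
  (tk_infty : tk k @[k --> \oo] --> +oo)
  (a : R -> R)
  (a_ge0 : forall t, 0 <= t -> 0 <= a t)
  (a_cont : {within `[0, +oo[, continuous a})
  (Ik : nat -> R -> R)
  (Ik_cont : forall k, continuous (Ik k))
  (Ik0 : forall k, Ik k 0 = 0)
  (f_ : 'I_n -> R -> (R -> R) -> R)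
  (f_local : history_local tau f_)
  (f0 : forall t, 0 <= t -> total_rhs f_ t (fun=> 0) = 0)
  (f_cont : BPC_continuous (total_rhs f_) \/ BPC_piecewise_continuous (total_rhs f_))
  (ivp : uniquely_solvable (solution tk a Ik (total_rhs f_)))
  (* (1) *)
  (ak bk : nat -> R)
  (ak_gt0 : forall k, 0 < ak k)
  (bk_gt0 : forall k, 0 < bk k)
  (Ik_bounds : forall k x,
     bk k * x ^+ 2 <= x * (x + Ik k x) /\ x * (x + Ik k x) <= ak k * x ^+ 2)
  (* (2) *)
  (H2 :
     ((exists M, forall m, partial_prod ak m <= M) /\
      (\int[@lebesgue_measure R]_(u in `[0%R, +oo[) (a u)%:E = +oo)%E)
     \/
     (cvg (partial_prod ak m @[m --> \oo]) /\
      forall (w : R -> R) (c : R), test_function tk w ->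
        w t @[t --> +oo] --> c -> c != 0 ->
        history_integral_diverges (max_delay tau) (total_rhs f_) w
          ((- Num.sg c)%:E * +oo)%E))
  (* (3) *)
  (lam1 lam2 : 'I_n -> R -> R)
  (lam1_ge0 : forall i t, 0 <= t -> 0 <= lam1 i t)
  (lam2_ge0 : forall i t, 0 <= t -> 0 <= lam2 i t)
  (lam1_pc : forall i, piecewise_continuous_pos (lam1 i))
  (lam2_pc : forall i, piecewise_continuous_pos (lam2 i))
  (f_bounds : forall i t phi, 0 <= t -> PC_on (- tau i t) 0 phi ->
     - lam1 i t * Msup (tau i t) phi <= f_ i t phi /\
     f_ i t phi <= lam2 i t * Msup (tau i t) (\- phi))
  (* (4) *)
  (T : R) (T_gt0 : 0 < T) (T_tau : max_delay tau T <= T)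
  (alpha1_fin : alpha tk bk a tau lam1 T \is a fin_num)
  (alpha2_fin : alpha tk bk a tau lam2 T \is a fin_num)
  (alpha_lt1 :
     (alpha tk bk a tau lam1 T * alpha tk bk a tau lam2 T < 1)%E) :
  zero_globally_asymptotically_stable (solution tk a Ik (total_rhs f_)).
Proof.
have [D [D_fin F_cont]] := BPC_regular_limits f_cont.
have T0 := ltW T_gt0.
have taum_ge0 (t : R) : 0 <= t -> 0 <= max_delay tau t by move=> _; exact: max_delay_ge0.
have taum_mono (s t : R) : 0 <= s -> s <= t ->
    s - max_delay tau s <= t - max_delay tau t.
  by move=> s0 st; apply: max_delay_mono => // i; exact: tau_mono.
have taum_infty := max_delay_infty tau_infty.
have T_past : 0 <= T - max_delay tau T by rewrite subr_ge0.
have past t : T <= t -> 0 <= t - max_delay tau t.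
  by move=> Tt; apply: le_trans (taum_mono _ _ T0 Tt).
have ga1 := gain_admissible tau_ge0 tau_cont tk_incr tk_infty bk_gt0 lam1_ge0 lam1_pc.
have ga2 := gain_admissible tau_ge0 tau_cont tk_incr tk_infty bk_gt0 lam2_ge0 lam2_pc.
have gb1 := alpha_gain_bound tau_ge0 tau_cont tk_incr tk_infty bk_gt0 lam1_ge0 lam1_pc
  alpha1_fin past.
have gb2 := alpha_gain_bound tau_ge0 tau_cont tk_incr tk_infty bk_gt0 lam2_ge0 lam2_pc
  alpha2_fin past.
set al1 := fine (alpha tk bk a tau lam1 T) in gb1.
set al2 := fine (alpha tk bk a tau lam2 T) in gb2.
have al12 : al1 * al2 < 1 by rewrite -lte_fin EFinM !fineK.
have al10 : 0 <= al1 := gain_bound_ge0 T_past ga1 gb1.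
have al20 : 0 <= al2 := gain_bound_ge0 T_past ga2 gb2.
have E_fin N : finite_set (exceptional tk D `&` `[0, N]).
  exact: (exceptional_finite tk_incr tk_infty D_fin).
have [M akM] : exists M, forall m, partial_prod ak m <= M.
  case: H2 => [[]//|[cP _]].
  have [B [_ BP]] := cvg_seq_bounded cP.
  exists (B + 1) => m; apply: le_trans (ler_norm _) _; apply: BP => //; lra.
have Cx0 t0 : 0 < M / partial_prod ak (jump_count tk t0).
  rewrite divr_gt0 ?partial_prod_gt0//.
  by apply: lt_le_trans (akM 0%N); rewrite /partial_prod big_ord0.
pose C := (1 + al1 + al2) / (1 - al1 * al2).
have C0 : 0 < C by rewrite divr_gt0//; lra.
pose ysm t0 x := smoothed tk Ik bk t0 x.
have ycont (t0 : R) phi x : solution tk a Ik (total_rhs f_) t0 phi x ->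
    forall q, {within `[t0, q], continuous (ysm t0 x)}.
  by move=> sol; exact: (smoothed_continuous tk_incr tk_infty Ik0 ak_gt0 bk_gt0 Ik_bounds sol).
have yupper (t0 : R) phi x : 0 <= t0 -> BPC phi ->
    solution tk a Ik (total_rhs f_) t0 phi x ->
    delay_ineq a (max_delay tau) (exceptional tk D) t0 (gain tau lam2 tk bk) (ysm t0 x).
  by move=> t00 pB sol; exact: (smoothed_delay_ineq_upper tau_ge0 tk_incr tk_infty
    f_local F_cont Ik0 ak_gt0 bk_gt0 Ik_bounds lam1_ge0 lam2_ge0 f_bounds t00 pB sol).
have ylower (t0 : R) phi x : 0 <= t0 -> BPC phi ->
    solution tk a Ik (total_rhs f_) t0 phi x ->
    delay_ineq a (max_delay tau) (exceptional tk D) t0 (gain tau lam1 tk bk)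
      (fun t => - ysm t0 x t).
  by move=> t00 pB sol; exact: (smoothed_delay_ineq_lower tau_ge0 tk_incr tk_infty
    f_local F_cont Ik0 ak_gt0 bk_gt0 Ik_bounds lam1_ge0 lam2_ge0 f_bounds t00 pB sol).
have growth (t0 : R) : 0 <= t0 -> exists2 K, 0 < K & forall phi x,
    BPC phi -> solution tk a Ik (total_rhs f_) t0 phi x ->
    forall t, `|ysm t0 x t| <= C * (K * normBPC phi).
  move=> t00; have [K K0 KP] := finite_time_growth (max_delay tau) a_ge0 a_cont E_fin t00
    (Num.max T t0) ga1 ga2.
  exists K => // phi x pB sol.
  have Y0 : 0 <= normBPC phi by apply: le_trans (BPC_le_norm pB (lexx 0)).
  have yY s : s <= t0 -> `|ysm t0 x s| <= normBPC phi.
    move=> st0; rewrite /ysm smoothed_before//.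
    have -> : x s = phi (s - t0).
      by case: sol => xphi _ _ _ _; rewrite -xphi ?subr_le0// addrC subrK.
    by apply: BPC_le_norm => //; rewrite subr_le0.
  have KY := KP _ _ (ycont _ _ _ sol) (yupper _ _ _ t00 pB sol) (ylower _ _ _ t00 pB sol) Y0 yY.
  apply: (global_bound a_ge0 a_cont taum_ge0 taum_mono E_fin t00 T0 T_past ga1 ga2 gb1 gb2 al12
    (ycont _ _ _ sol) (yupper _ _ _ t00 pB sol) (ylower _ _ _ t00 pB sol) _ _ _ KY).
  - by rewrite le_max lexx orbT.
  - by rewrite le_max lexx.
  - by rewrite mulr_ge0// ltW.
split.
  move=> e t0 e0 t00; have [K K0 KP] := growth t0 t00.
  set Cx := M / partial_prod ak (jump_count tk t0).
  have CC : 0 < Cx * (C * K) :=  mulr_gt0 (Cx0 t0) (mulr_gt0 C0 K0).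
  exists (e / (Cx * (C * K))); first by rewrite divr_gt0.
  move=> phi x pB pd sol t t0t.
  apply: (le_lt_trans (solution_le_smoothed tk_incr tk_infty Ik0 ak_gt0 bk_gt0
    Ik_bounds x akM t0t)).
  have := ler_wpM2l (ltW (Cx0 t0)) (KP phi x pB sol t); rewrite -/Cx => /le_lt_trans; apply.
  by rewrite [C * _]mulrA [Cx * _]mulrA mulrC -ltr_pdivlMr.
move=> t0 phi x t00 pB sol.
have [K K0 KP] := growth t0 t00.
have [osc|[S [sg [t0S sgE ypos]]]] := signed_or_oscillating (ycont _ _ _ sol).
  apply: (smoothed_vanishes_solution tk_incr tk_infty Ik0 ak_gt0 bk_gt0 Ik_bounds akM).
  apply: (oscillating_cvg0 a_ge0 a_cont taum_ge0 taum_mono taum_infty E_fin t00 T0 T_past ga1 ga2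
    gb1 gb2 al12 (ycont _ _ _ sol) (yupper _ _ _ t00 pB sol) (ylower _ _ _ t00 pB sol) osc
    (M0 := C * (K * normBPC phi))) => [|t _]; last exact: KP.
  by apply: le_trans (KP phi x pB sol 0).
pose v t := sg * ysm t0 x t.
have [p [t0p Sp] vdec] : exists2 p, t0 <= p /\ S <= p & forall r q, p <= r -> r <= q ->
    v q <= v r * expR (- \int[@lebesgue_measure R]_(u in `[r, q]) a u).
  have vcont q : {within `[t0, q], continuous v}.
    by move=> u; apply: cvgM; [exact: cvg_cst|exact: (ycont _ _ _ sol)].
  case: sgE => sgE.
    apply: (eventually_pos_decay a_ge0 a_cont taum_infty E_fin t00 ga2 vcont _ ypos).
    have -> : v = ysm t0 x by apply/funext => t; rewrite /v sgE mul1r.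
    exact: (yupper _ _ _ t00 pB sol).
  apply: (eventually_pos_decay a_ge0 a_cont taum_infty E_fin t00 ga1 vcont _ ypos).
  have -> : v = (fun t => - ysm t0 x t) by apply/funext => t; rewrite /v sgE mulN1r.
  exact: (ylower _ _ _ t00 pB sol).
have p0 : 0 <= p by lra.
have vpos t : p <= t -> 0 < v t by move=> pt; apply: ypos; exact: le_trans pt.
have yv t : ysm t0 x t = sg * v t.
  by rewrite /v mulrA; case: sgE => ->; rewrite ?mulrNN !mul1r.
have from_v l : v t @[t --> +oo] --> l -> ysm t0 x t @[t --> +oo] --> sg * l.
  move=> vl; rewrite (_ : ysm t0 x = fun t => sg * v t); last exact/funext.
  by apply: cvgM => //; exact: cvg_cst.
case: H2 => [[_ ainf]|[cP test]].
  apply: (smoothed_vanishes_solution tk_incr tk_infty Ik0 ak_gt0 bk_gt0 Ik_bounds akM).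
  rewrite -[X in _ --> X](mulr0 sg); apply: from_v.
  apply: (decay_cvg0 a_ge0 a_cont ainf p0) => [t /vpos/ltW//|q pq].
  exact: vdec.
have vmono r q : p <= r -> r <= q -> v q <= v r.
  move=> pr rq; apply: (le_trans (vdec r q pr rq)).
  rewrite ler_piMr//; first by rewrite ltW// vpos.
  by apply: rate_kernel_le1 => //; lra.
have [l l0 vl] := nonincreasing_cvg_pinfty vmono (fun r pr => ltW (vpos r pr)).
have [c Wc] := jump_weight_inv_cvg tk_incr tk_infty Ik0 ak_gt0 bk_gt0 Ik_bounds t0 x cP.
have xE t : x t = ysm t0 x t * (jump_weight tk Ik bk t0 x t)^-1.
  rewrite /ysm /smoothed mulrC mulKf// gt_eqF//.
  exact: (jump_weight_gt0 tk Ik0 ak_gt0 bk_gt0 Ik_bounds).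
have xl : x t @[t --> +oo] --> sg * l * c.
  rewrite (_ : x = fun t => ysm t0 x t * (jump_weight tk Ik bk t0 x t)^-1); last exact/funext.
  by apply: cvgM => //; exact: from_v.
(* The limit of x is nonzero from here on, which the divergence of the integral excludes. *)
have [lc0|lc] := eqVneq (sg * l * c) 0; first by rewrite -lc0.
exfalso.
have vpos' t : p <= t -> 0 < sg * ysm t0 x t by exact: vpos.
have xpos := solution_signed Ik0 ak_gt0 bk_gt0 Ik_bounds vpos'.
have sgl : Num.sg (sg * l * c) = sg.
  set L := sg * l * c in lc xl *.
  have close e : 0 < e -> exists2 t, p <= t & `|L - x t| < e.
    move=> e0; have /cvgrPdist_lt/(_ e e0)[B [_ BP]] := xl.
    exists (Num.max p (B + 1)); first by rewrite le_max lexx.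
    by apply: BP; rewrite lt_max; apply/orP; right; lra.
  case: sgE => sgv; rewrite sgv.
    apply: gtr0_sg; rewrite lt_neqAle eq_sym lc/= leNgt; apply/negP => Lneg.
    have [|t pt] := close (- L); first lra.
    by have := xpos t pt; rewrite sgv mul1r ltr_norml => ? /andP[]; lra.
  apply: ltr0_sg; rewrite lt_neqAle lc/= leNgt; apply/negP => Lpos.
  have [t pt] := close L Lpos.
  by have := xpos t pt; rewrite sgv mulN1r ltr_norml => ? /andP[]; lra.
have wtest := frozen_test_function tk_incr tk_infty Ik0 ak_gt0 bk_gt0 Ik_bounds sol sgE t0p
  vpos' vmono akM.
have wl := frozen_cvg p xl.
have := test _ _ wtest wl lc; rewrite sgl.
exact: (frozen_not_divergent tau_ge0 tk_incr tk_infty f_local F_cont Ik0 ak_gt0 bk_gt0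
  Ik_bounds lam1_ge0 lam2_ge0 f_bounds t00 pB sol sgE t0p vpos' vmono akM lam1_pc lam2_pc
  a_ge0 D_fin taum_infty).
Qed.
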